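(* Let $s\in(s_0,1)$ with $s_0>0$, let $0<\lambda\le\Lambda$ and $L\in\mathcal L_s(\lambda,\Lambda;1)$. Let $\eta\in C^{1,1}(\mathbb R^n)$ be such that $\eta\ge0$. Then there exists $\sigma_0=\sigma_0(n,s,\Lambda/\lambda,\|\eta\|_{C^{1,1}(\mathbb R^n)})>0$ such that for every $\sigma\ge\sigma_0$ and every $u\in C^{1+2s+\varepsilon}_{loc}(\mathbb R^n)\cap L^\infty(\mathbb R^n)$ $$L\big(\eta^2(\partial_eu)^2+\sigma u^2\big)\le2\eta^2L(\partial_eu)\,\partial_eu+2\sigma L(u)\,u\quad\text{in }\mathbb R^n.$$
   Context: Here $e\in\mathbb S^{n-1}$ is a direction, $\partial_e$ is the directional derivative, and $\varepsilon>0$. Operators: $Lu(x)=\mathrm{p.v.}\int_{\mathbb R^n}(u(x)-u(y))K(x-y)\,dy$ with $K:\mathbb R^n\to[0,\infty]$ symmetric, $K(y)=K(-y)$. One writes $L\in\mathcal L_s(\lambda,\Lambda;1)$ if for all $y\neq0$: $\lambda|y|^{-n-2s}\le K(y)\le\Lambda|y|^{-n-2s}$ and $|\nabla K(y)|\le\Lambda|y|^{-1}K(y)$.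
   Formalization: The threshold σ_0 depends on n, s, max(Λ/λ, Λ) and the C^{1,1} norm of η instead of on Λ/λ alone: for λ>1 dependence on Λ/λ alone fails, since the bound |∇K| ≤ Λ|y|^{-1}K does not scale with K; for λ ≤ 1 the maximum equals Λ/λ. *)

(* Defs.v *)
From HB Require Import structures.
From mathcomp Require Import all_boot all_order all_algebra.
From mathcomp Require Import all_classical all_reals all_analysis.

Set Implicit Arguments.
Unset Strict Implicit.
Unset Printing Implicit Defensive.

Import Order.TTheory GRing.Theory Num.Theory.
Import numFieldNormedType.Exports.

Local Open Scope classical_set_scope.
Local Open Scope ring_scope.

Section leb_cons.
Variables (R : realType) (n : nat).
Local Notation rT := (measurableTypeR R).
Variable m : {sigma_finite_measure set (n.-tuple rT) -> \bar R}.

Definition cons_pair (p : rT * n.-tuple rT) : n.+1.-tuple rT :=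
  [tuple of p.1 :: p.2].

Lemma measurable_cons_pair : measurable_fun [set: rT * n.-tuple rT] cons_pair.
Proof. exact: measurable_cons. Qed.

Definition leb_cons : set (n.+1.-tuple rT) -> \bar R :=
  pushforward (lebesgue_measure \x m)%E cons_pair.

HB.instance Definition _ := Measure.copy leb_cons
  (measure_function_pushforward__canonical__measure_function_Measure
     (lebesgue_measure \x m)%E measurable_cons_pair).

Lemma leb_cons_sigma_finite : sigma_finite setT leb_cons.
Proof.
have /sigma_finiteP[F [TF ndF Foo]] := sigma_finiteT (@lebesgue_measure R).
have /sigma_finiteP[G [TG ndG Goo]] := sigma_finiteT m.
pose hd (t : n.+1.-tuple rT) := thead t.
pose tl (t : n.+1.-tuple rT) := [tuple of behead t] : n.-tuple rT.
have mhd : measurable_fun setT hd by exact: measurable_tnth.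
have mtl : measurable_fun setT tl by exact: measurable_behead.
exists (fun i => (hd @^-1` F i) `&` (tl @^-1` G i)).
  apply/esym; rewrite -subTset => t _.
  have : setT (hd t) by []. rewrite TF => -[i _ Fi].
  have : setT (tl t) by []. rewrite TG => -[j _ Gj].
  exists (maxn i j) => //; split.
    by have /subsetPset := ndF _ _ (leq_maxl i j); apply.
  by have /subsetPset := ndG _ _ (leq_maxr i j); apply.
move=> i; have [mF Fy] := Foo i; have [mG Gy] := Goo i; split.
  apply: measurableI.
    by rewrite -[X in measurable X]setTI; exact: mhd.
  by rewrite -[X in measurable X]setTI; exact: mtl.
rewrite /leb_cons /pushforward.
have hdE p : hd (cons_pair p) = p.1 by rewrite /hd theadE.
have tlE p : tl (cons_pair p) = p.2 by exact/val_inj.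
rewrite (_ : _ @^-1` _ = F i `*` G i).
  by rewrite product_measure1E// lte_mul_pinfty// ge0_fin_numE.
by apply/seteqP; split => p /=; rewrite hdE tlE.
Qed.

HB.instance Definition _ :=
  Measure_isSigmaFinite.Build _ _ R leb_cons leb_cons_sigma_finite.

End leb_cons.

(* n-dimensional Lebesgue measure, on the product sigma-algebra of the type of
   n-tuples; [leb_box] below checks the normalisation. *)
Fixpoint leb (R : realType) (n : nat) :
    {sigma_finite_measure set (n.-tuple (measurableTypeR R)) -> \bar R} :=
  if n is k.+1 then leb_cons (leb R k)
  else \d_([tuple] : 0.-tuple (measurableTypeR R)).

Lemma leb_box (R : realType) (n : nat) (a b : 'I_n -> R) :
  (forall i, a i <= b i) ->
  leb R n [set t | forall i, tnth t i \in `[a i, b i]] =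
  (\prod_(i < n) (b i - a i))%:E.
Proof.
elim: n a b => [|n IHn] a b leab.
  rewrite big_ord0 /= diracE mem_set//=.
  by case.
rewrite big_ord_recl EFinM -IHn; last by move=> i; exact: leab.
rewrite [LHS]/= /leb_cons /pushforward.
set B : set (n.-tuple (measurableTypeR R)) := [set t | forall i : 'I_n, _].
have mB : measurable B.
  rewrite (_ : B = \bigcap_(i in [set: 'I_n]) ((@tnth _ _)^~ i @^-1`
      `[a (lift ord0 i), b (lift ord0 i)])).
    apply: fin_bigcap_measurable => // i _.
    by rewrite -[X in measurable X]setTI; apply: measurable_tnth.
  by apply/seteqP; split => t /= tB i; [move=> _|]; exact: tB.
rewrite (_ : _ @^-1` _ = `[a ord0, b ord0] `*` B).
  rewrite product_measure1E//= lebesgue_measure_itv/= lte_fin.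
  case: ltgtP (leab ord0) => //.
  by move=> -> _; rewrite subrr.
apply/seteqP; split => -[x t] /=.
  move=> tab; split; first exact: (tab ord0).
  by move=> i; have := tab (lift ord0 i); rewrite tnthS.
move=> [xab tB] i; case: (unliftP ord0 i) => [j ->|->//].
by rewrite tnthS; exact: tB.
Qed.

(* The constant on which estimates for the class [kernel_class] below depend; it
   is Lam / lam when lam <= 1.  The ratio alone does not suffice for lam > 1: the
   gradient bound |grad K| <= Lam K / |y| is invariant under K |-> c K with Lam
   unchanged, so after normalising lam = 1 the gradient constant is still Lam. *)
Definition class_constant (R : realType) (lam Lam : R) : R :=
  Num.max (Lam / lam) Lam.

Section integro_differential.
Variables (R : realType) (n : nat).
Local Notation Rn := 'rV[R]_n.
Local Notation tupR := (n.-tuple (measurableTypeR R)).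
Implicit Types (f u eta : Rn -> R) (K : Rn -> \bar R) (x y z : Rn).

(* The library's norm [`|x|] on row vectors is the sup norm. *)
Definition enorm x : R := Num.sqrt (\sum_(i < n) x ord0 i ^+ 2).

Definition partial (i : 'I_n) f : Rn -> R := 'D_(delta_mx ord0 i) f.

Definition grad f x : Rn := \row_i partial i f x.

Definition vec (t : tupR) : Rn := \row_i tnth t i.

Definition annulus x (r rho : R) : set tupR :=
  [set t | r < enorm (x - vec t) < rho].

(* Principal value of the integral of (u(x) - u(y)) K(x - y).  Besides the
   singularity at y = x, the integral is also truncated at infinity: a bounded
   u in C^{1+2s+eps}_loc may have an unbounded derivative, so that the integral
   defining L(D_e u) only converges conditionally at infinity.  When the
   integral over |x - y| > r makes sense as a Lebesgue integral, the inner limit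
   is that integral.  The value is extended real: L f (x) = -oo can happen for
   f >= 0. *)
Definition pv_op K u x : \bar R :=
  lim ((lim ((\int[leb R n]_(t in annulus x r rho)
                ((u x - u (vec t))%:E * K (x - vec t)%R))%E
             @[rho --> +oo]))
       @[r --> 0^'+]).

(* The operators of the class L_s(lam, Lam; 1), identified with their kernels. *)
Definition kernel_class (s lam Lam : R) K : Prop :=
  [/\ forall y, (0 <= K y)%E,
      forall y, K (- y) = K y,
      forall y, y != 0 ->
        ((lam * enorm y `^ (- (n%:R + 2 * s)))%:E <= K y
           <= (Lam * enorm y `^ (- (n%:R + 2 * s)))%:E)%E,
      forall y, y != 0 -> differentiable (fine \o K) y
    & forall y, y != 0 ->
        ((enorm (grad (fine \o K) y))%:E <= (Lam / enorm y)%:E * K y)%E].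

Definition C11_norm f : \bar R :=
  (ereal_sup [set `|f x|%:E | x in setT]
   + ereal_sup [set (enorm (grad f x))%:E | x in setT]
   + ereal_sup [set z | exists x y, x != y /\
       z = (enorm (grad f x - grad f y) / enorm (x - y))%:E])%E.

Definition C11 f : Prop :=
  (forall x, differentiable f x) /\ (C11_norm f < +oo)%E.

(* C^{k,alpha} on every ball, for k : nat and 0 <= alpha. *)
Fixpoint Ck_holder_loc (k : nat) (alpha : R) f : Prop :=
  if k is k'.+1 then
    (forall x, differentiable f x) /\
    (forall i, Ck_holder_loc k' alpha (partial i f))
  else
    continuous f /\
    forall rho : R, exists C : R, forall x y, enorm x <= rho -> enorm y <= rho ->
      `|f x - f y| <= C * enorm (x - y) `^ alpha.

(* C^beta_loc for a real exponent beta >= 0, i.e. C^{k,alpha}_loc where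
   beta = k + alpha and 0 <= alpha < 1.  For alpha = 0 the Hoelder condition is
   void (a `^ 0 = 1) and this is C^k. *)
Definition C_loc (beta : R) f : Prop :=
  Ck_holder_loc (Num.truncn beta) (beta - (Num.truncn beta)%:R) f.

Definition Linfty f : Prop :=
  (Lnorm (leb R n) +oo%E (fun t => (f (vec t))%:E) < +oo)%E.

End integro_differential.

(* Main.v *)
(* Fix x and write z = x - y, u0 = u(x), v = D_e u, v0 = v(x), eta0 = eta(x).
   Expanding squares,
     L(eta^2 v^2 + sigma u^2) - 2 eta0^2 v0 L v - 2 sigma u0 L u
   is at x the integral of (Q - sigma (u(y) - u0)^2) K(z), where
     Q = - eta0^2 v0^2 - eta(y)^2 v(y)^2 + 2 eta0^2 v0 v(y).
   Far from x, drop - eta^2 v^2: what is left is the negative term - eta0^2 v0^2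
   and a term linear in v = D_e (u - u0), which is integrated by parts; as
   |grad K| <= Lam K / |z|, Young's inequality absorbs it into - eta0^2 v0^2 / 2
   and sigma (u - u0)^2.  Near x, maximise Q over v(y): with h = eta(y) - eta0,
     Q <= v0^2 (- 2 eta0 h + 10 h^2),
   whose linear part in z is odd and whose remainder is at most
   C eta0 v0^2 |z|^2, because eta >= 0 and C^{1,1} give |grad eta|^2 <= C eta.
   Gluing at the scale |z|^2 ~ c eta0 with c small, the near contribution
   is dominated by the far negative term.  Neither bound uses the size of v at
   infinity or the integrability of eta^2 v^2, so the left-hand side is allowed
   to be -oo. *)

(* [lim] has a default value on divergent functions, so a bound on truncated integrals says nothing
   about [pv_op] until the truncations of the left-hand side are known to converge. This is obtained
   from monotonicity alone. Away from [x], the contribution of [F (x - z) >= 0] is monotone in the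
   outer radius. Near [x], the integral is a convergent one minus that of [P - G >= 0], which is
   monotone in the inner radius.

   Integration by parts is done on full balls. The cutoff makes the kernel vanish near 0, so there
   is no inner boundary.

   At distance at most [Num.sqrt (c1 * eta x)] the variation of [eta] is at most [eta x / 2], which
   the maximisation of the quadratic form in [v(y)] needs. The near part then has size [eta x * d]^
   (2 - 2 * s)[, comparable to the far term]eta x ^+ 2 * d [^ (- (2 * s))] because
   [d ^+ 2 = c1 * eta x]. If [eta x = 0] this radius collapses, but then the error integrand is
   nonpositive everywhere. *)
Require Import Defs.
From mathcomp Require Import all_boot all_order all_algebra.
From mathcomp Require Import all_classical all_reals all_analysis.
From mathcomp Require Import measurable_realfun ess_sup_inf ring lra.

Set Implicit Arguments.
Unset Strict Implicit.
Unset Printing Implicit Defensive.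

Import Order.TTheory GRing.Theory Num.Theory.
Import numFieldNormedType.Exports.

Local Open Scope classical_set_scope.
Local Open Scope ring_scope.

(** * Euclidean norm *)

Section euclidean_norm.
Variables (R : realType) (n : nat).
Local Notation Rn := 'rV[R]_n.
Implicit Types (x y z e : Rn) (a : R).

Definition dot x y : R := \sum_(i < n) x ord0 i * y ord0 i.

Lemma dotC x y : dot x y = dot y x.
Proof. by apply: eq_bigr => i _; rewrite mulrC. Qed.

Lemma dotDl x y z : dot (x + y) z = dot x z + dot y z.
Proof. by rewrite -big_split; apply: eq_bigr => i _; rewrite mxE mulrDl. Qed.

Lemma dotZl a x y : dot (a *: x) y = a * dot x y.
Proof. by rewrite mulr_sumr; apply: eq_bigr => i _; rewrite mxE mulrA. Qed.

Lemma dotNl x y : dot (- x) y = - dot x y.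
Proof. by rewrite -scaleN1r dotZl mulN1r. Qed.

Lemma dotDr x y z : dot x (y + z) = dot x y + dot x z.
Proof. by rewrite dotC dotDl !(dotC x). Qed.

Lemma dotZr a x y : dot x (a *: y) = a * dot x y.
Proof. by rewrite dotC dotZl dotC. Qed.

Lemma dotNr x y : dot x (- y) = - dot x y.
Proof. by rewrite dotC dotNl dotC. Qed.

Lemma dot_ge0 x : 0 <= dot x x.
Proof. by apply: sumr_ge0 => i _; rewrite -expr2 sqr_ge0. Qed.

Lemma sqr_enorm x : enorm x ^+ 2 = dot x x.
Proof.
rewrite /enorm sqr_sqrtr; last by apply: sumr_ge0 => i _; exact: sqr_ge0.
by apply: eq_bigr => i _; rewrite expr2.
Qed.

Lemma enorm_ge0 x : 0 <= enorm x.
Proof. exact: sqrtr_ge0. Qed.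

Lemma ler_enorm_sqr x a : 0 <= a -> (enorm x <= a) = (dot x x <= a ^+ 2).
Proof.
by move=> a0; rewrite -sqr_enorm ler_pXn2r// nnegrE// enorm_ge0.
Qed.

Lemma enormZ a x : enorm (a *: x) = `|a| * enorm x.
Proof.
apply/eqP; rewrite -(@eqrXn2 _ 2%N) ?enorm_ge0 ?mulr_ge0 ?enorm_ge0//.
by rewrite exprMn !sqr_enorm dotZl dotZr mulrA -expr2 real_normK// num_real.
Qed.

Lemma enormN x : enorm (- x) = enorm x.
Proof. by rewrite -scaleN1r enormZ normrN1 mul1r. Qed.

Lemma enormB x y : enorm (x - y) = enorm (y - x).
Proof. by rewrite -enormN opprB. Qed.

Lemma enorm0 : enorm (0 : Rn) = 0.
Proof. by rewrite -(scale0r (0 : Rn)) enormZ normr0 mul0r. Qed.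

Lemma ler_coord_enorm x i : `|x ord0 i| <= enorm x.
Proof.
rewrite -(@ler_pXn2r _ 2%N) ?nnegrE ?enorm_ge0// sqr_enorm real_normK ?num_real//.
rewrite /dot (bigD1 i)//= -expr2 lerDl; apply: sumr_ge0 => j _.
by rewrite -expr2 sqr_ge0.
Qed.

Lemma enorm_eq0 x : (enorm x == 0) = (x == 0).
Proof.
apply/eqP/eqP => [x0|->]; last exact: enorm0.
apply/rowP => i; rewrite mxE; apply/normr0_eq0/eqP.
by rewrite eq_le normr_ge0 andbT -x0 ler_coord_enorm.
Qed.

Lemma enorm_gt0 x : (0 < enorm x) = (x != 0).
Proof. by rewrite lt_neqAle enorm_ge0 andbT eq_sym enorm_eq0. Qed.

Lemma cauchy_schwarz x y : `|dot x y| <= enorm x * enorm y.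
Proof.
have [->|y0] := eqVneq y 0.
  by rewrite enorm0 mulr0 -(scale0r (0 : Rn)) dotZr mul0r normr0.
have Dy : 0 < dot y y by rewrite -sqr_enorm exprn_gt0// enorm_gt0.
rewrite -(@ler_pXn2r _ 2%N) ?nnegrE ?mulr_ge0 ?enorm_ge0//.
rewrite real_normK ?num_real// exprMn !sqr_enorm.
(* This vector is [dot y y] times the component of [x] orthogonal to [y]; its square is
   [C * (A * C - B ^+ 2)]. *)
have := dot_ge0 (dot y y *: x - dot x y *: y).
rewrite dotDl !dotDr !dotNl !dotNr !dotZl !dotZr (dotC y x).
set A := dot x x; set B := dot x y; set C := dot y y => h.
have : 0 <= C * (A * C - B ^+ 2) by move: h; congr (0 <= _); ring.
by rewrite pmulr_rge0// subr_ge0.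
Qed.

Lemma ler_enormD x y : enorm (x + y) <= enorm x + enorm y.
Proof.
rewrite ler_enorm_sqr ?addr_ge0 ?enorm_ge0// sqrrD !sqr_enorm.
rewrite dotDl !dotDr (dotC y x).
have := ler_norm (dot x y); have := cauchy_schwarz x y; rewrite -mulr_natr.
lra.
Qed.

Lemma ler_enormB x y : enorm x - enorm y <= enorm (x - y).
Proof. by have := ler_enormD (x - y) y; rewrite subrK lerBlDr. Qed.

Lemma normr_le_enorm x : `|x| <= enorm x.
Proof.
rewrite [leLHS]/Num.norm/= mx_normrE; apply/bigmax_leP; split => [|[i j] _].
  exact: enorm_ge0.
by rewrite ord1; exact: ler_coord_enorm.
Qed.

Lemma coord_le_normr x i : `|x ord0 i| <= `|x|.
Proof.
have /mapP[j Hj ->] : `|x ord0 i| \in [seq `|x k.1 k.2| | k : 'I_1 * 'I_n].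
  by apply/mapP; exists (ord0, i) => //=; rewrite mem_enum.
by rewrite [leRHS]/Num.norm /= mx_normrE; apply/bigmax_geP; right => /=; exists j.
Qed.

(** The crude factor [n] stands for its square root: the comparison only serves to pass between
    balls, boxes and neighbourhoods. *)
Lemma enorm_le_normr x : enorm x <= n%:R * `|x|.
Proof.
have n0 : 0 <= n%:R * `|x| :> R by rewrite mulr_ge0.
rewrite ler_enorm_sqr// exprMn.
apply: (@le_trans _ _ (\sum_(i < n) `|x| ^+ 2)).
  apply: ler_sum => i _; rewrite -expr2 -[leLHS]real_normK ?num_real//.
  by rewrite ler_pXn2r ?nnegrE// coord_le_normr.
rewrite sumr_const card_ord -[leLHS]mulr_natl ler_wpM2r ?sqr_ge0//.
by rewrite -natrX ler_nat; case: (n) => // m; rewrite -mulnn leq_pmull.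
Qed.

Lemma enorm_ball x d : 0 < d -> exists2 d' : R, 0 < d' &
  forall y, ball x d' y -> enorm (x - y) < d.
Proof.
(* The denominator [n.+1] is positive in dimension 0 too. *)
move=> d0; exists (d / n.+1%:R); first by rewrite divr_gt0.
move=> y; rewrite mx_norm_ball /ball_/= ltr_pdivlMr// => xy.
apply: (le_lt_trans (enorm_le_normr _)); apply: le_lt_trans xy.
by rewrite mulrC ler_wpM2l// ler_nat.
Qed.

Lemma nbhs_enorm x (P : set Rn) :
  (exists2 d : R, 0 < d & forall y, enorm (x - y) < d -> P y) -> nbhs x P.
Proof.
move=> [d /(enorm_ball x)[d' d'0 xd'] dP]; apply/nbhs_ballP; exists d' => // y.
by move=> /xd'/dP.
Qed.

Lemma enorm_continuous : continuous (@enorm R n).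
Proof.
move=> x; apply: (@cvgrPdist_lt _ _ _ (nbhs x) _ _ _).2 => /= d d0.
apply: nbhs_enorm; exists d => // y; apply: le_lt_trans.
rewrite ler_norml; apply/andP; split.
  by have := ler_enormB y x; rewrite enormB; lra.
by have := ler_enormB x y; lra.
Qed.

Lemma nbhs_enormP x (P : set Rn) : nbhs x P ->
  exists2 d : R, 0 < d & forall y, enorm (x - y) < d -> P y.
Proof.
move=> /nbhs_ballP[d /= d0 dP]; exists d => // y xy; apply: dP.
by rewrite mx_norm_ball /ball_/=; apply: le_lt_trans xy; exact: normr_le_enorm.
Qed.

Lemma compact_enorm_le (a b : R) : compact [set z : Rn | a <= enorm z <= b].
Proof.
apply: bounded_closed_compact.
  exists b; split; first exact: num_real.
  move=> c bc z /= /andP[_ zb]; apply: (le_trans (normr_le_enorm z)).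
  exact: le_trans zb (ltW bc).
rewrite (_ : [set z : Rn | _] = (@enorm R n) @^-1` `[a, b]).
  by apply: closed_comp => [z _|]; [exact: enorm_continuous|exact: interval_closed].
by apply/seteqP; split => z /=; rewrite in_itv.
Qed.

End euclidean_norm.

(** * Lebesgue measure on row vectors *)

Section measurability.
Variables (R : realType) (n : nat).
Local Notation rT := (measurableTypeR R).
Local Notation tupR := (n.-tuple rT).
Local Notation Rn := 'rV[R]_n.

Definition unvec (x : Rn) : tupR := [tuple x ord0 i | i < n].

(** Tuples carry the product sigma-algebra, which is not given by open sets: an open set is the
    union of the rational boxes that it contains, and there are countably many of these. *)
Lemma measurable_vec_open (U : set Rn) : open U -> measurable (@vec R n @^-1` U).
Proof.
move=> oU.
pose box (q : {ffun 'I_n -> rat * rat}) : set Rn :=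
  [set x | forall i, ratr (q i).1 < x ord0 i < ratr (q i).2].
have -> : @vec R n @^-1` U =
    \bigcup_(q in [set q | box q `<=` U]) (@vec R n @^-1` box q).
  apply/seteqP; split => [t /= Ut|t [q /= qU] /qU//].
  have /nbhs_enormP[d d0 dU] : nbhs (vec t) U by exact: open_nbhs_nbhs.
  pose e := d / n.+1%:R.
  have e0 : 0 < e by rewrite divr_gt0.
  have H i : {q : rat * rat | ratr q.1 < vec t ord0 i < ratr q.2 /\
      forall z : R, ratr q.1 < z < ratr q.2 -> `|vec t ord0 i - z| < e}.
    apply: cid; set y := vec t ord0 i.
    have [q1] : exists q, ratr q \in `](y - e), y[ by apply: rat_in_itvoo; lra.
    have [q2] : exists q, ratr q \in `]y, (y + e)[ by apply: rat_in_itvoo; lra.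
    rewrite !in_itv/= => /andP[a b] /andP[c f]; exists (q1, q2); split => /=.
      by rewrite f a.
    by move=> z /andP[? ?]; rewrite ltr_norml; apply/andP; split; lra.
  exists [ffun i => sval (H i)].
    move=> x /= xb; apply: dU; apply: (le_lt_trans (enorm_le_normr _)).
    apply: (@le_lt_trans _ _ (n%:R * e)).
      rewrite ler_wpM2l// [leLHS]/Num.norm/= mx_normrE.
      apply/bigmax_leP; split => [|[j i] _ /=]; first exact: ltW.
      have /= := xb i; rewrite ffunE => /(proj2 (svalP (H i)))/ltW.
      by rewrite (ord1 j) !mxE.
    rewrite /e mulrA ltr_pdivrMr// mulrC ltr_pM2l// ltr_nat//.
  by move=> i; rewrite ffunE; have [] := svalP (H i).
rewrite bigcup_mkcond; apply: countable_bigcupT_measurable => // q.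
case: ifPn => // _; rewrite (_ : _ @^-1` _ = \bigcap_(i in [set: 'I_n])
   ((@tnth _ rT)^~ i @^-1` `](ratr (q i).1 : R), ratr (q i).2[)).
  apply: fin_bigcap_measurable => // i _.
  by rewrite -[X in measurable X]setTI; apply: measurable_tnth.
apply/seteqP; split => t /= tB i; first by move=> _; have := tB i; rewrite mxE /= in_itv.
by have /= := tB i Logic.I; rewrite in_itv mxE.
Qed.

Lemma measurable_fun_vec (D : set Rn) (f : Rn -> R) : open D ->
  {in D, continuous f} ->
  measurable_fun (@vec R n @^-1` D) (fun t => f (vec t) : rT).
Proof.
move=> oD cf; apply: (measurability _ (RGenOpens.measurableE R)).
move=> _ [_ [a [b ->] <-]].
rewrite (_ : _ `&` _ = @vec R n @^-1` (D `&` f @^-1` `]a, b[))//.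
apply: measurable_vec_open; rewrite openE => x [Dx fx].
rewrite /interior; apply: filterI; first exact: open_nbhs_nbhs.
by apply: cf; [rewrite inE|exact: open_nbhs_nbhs].
Qed.

Lemma measurable_fun_vecT (f : Rn -> R) : continuous f ->
  measurable_fun [set: tupR] (fun t => f (vec t) : rT).
Proof.
move=> cf; rewrite -[X in measurable_fun X _](preimage_setT (@vec R n)).
by apply: measurable_fun_vec => //; exact: openT.
Qed.

End measurability.

(** * Affine changes of variables *)

Section affine_change_of_variables.
Variable R : realType.
Local Notation rT := (measurableTypeR R).
Local Open Scope ereal_scope.

Lemma measurable_affine (a c : R) :
  measurable_fun [set: rT] (fun x => (a * x + c)%R : rT).
Proof.
by apply: measurable_funD => //; apply: measurable_funM.
Qed.

(** The pushforward of the Lebesgue measure under the affine map, multiplied by [|a|], has the right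
    value on half-open intervals, so it is the Lebesgue measure by uniqueness. *)
Lemma lebesgue_affine (a c : R) (G : rT -> \bar R) : a != 0%R ->
  measurable_fun [set: rT] G -> (forall x, 0 <= G x) ->
  \int[lebesgue_measure]_x G (a * x + c)%R =
  (`|a|^-1)%:E * \int[lebesgue_measure]_x G x.
Proof.
move=> a0 mG G0; have na0 : (0 < `|a|)%R by rewrite normr_gt0.
have ma := measurable_affine a c.
pose m : {measure set rT -> \bar R} :=
  mscale (NngNum (ltW na0))
    (measure_function_pushforward__canonical__measure_function_Measure
       lebesgue_measure ma).
have -> : \int[lebesgue_measure]_x G x = \int[m]_x G x.
  apply: eq_measure_integral => A mA _; apply: lebesgue_measure_unique => //.
  move=> _ [[b d]] /= bd <-.
  rewrite /m /mscale/= /pushforward.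
  (* For [a < 0] the preimage is closed on the left instead of on the right; endpoints have no mass,
     so its measure is the same. *)
  have -> : (fun x : R => a * x + c)%R @^-1` `]b, d] =
      if (0 < a)%R then `](a^-1 * (b - c))%R, (a^-1 * (d - c))%R]%classic
      else `[(a^-1 * (d - c))%R, (a^-1 * (b - c))%R[%classic.
    apply/seteqP; split => x /=; case: ifPn => a1; rewrite /= !in_itv/=.
    - rewrite (mulrC a^-1%R) ltr_pdivrMr// (mulrC a^-1%R) ler_pdivlMr// => /andP[? ?].
      by apply/andP; split; lra.
    - have a2 : (a < 0)%R by rewrite lt_neqAle a0 leNgt.
      rewrite (mulrC a^-1%R) ler_ndivrMr// (mulrC a^-1%R) ltr_ndivlMr// => /andP[? ?].
      by apply/andP; split; lra.
    - rewrite (mulrC a^-1%R) ltr_pdivrMr// (mulrC a^-1%R) ler_pdivlMr// => /andP[? ?].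
      by apply/andP; split; lra.
    - have a2 : (a < 0)%R by rewrite lt_neqAle a0 leNgt.
      rewrite (mulrC a^-1%R) ler_ndivrMr// (mulrC a^-1%R) ltr_ndivlMr// => /andP[? ?].
      by apply/andP; split; lra.
  rewrite lebesgue_measure_itv/= lte_fin.
  case: (boolP (0 < a)%R) => a1; rewrite lebesgue_measure_itv/= lte_fin.
    rewrite ltr_pM2l ?invr_gt0// ltrD2r; case: ifPn => _; last by rewrite mule0.
    rewrite -!EFinD -EFinM gtr0_norm//; congr EFin.
    by field.
  have a2 : (a < 0)%R by rewrite lt_neqAle a0 leNgt.
  rewrite ltr_nM2l ?invr_lt0// ltrD2r; case: ifPn => _; last by rewrite mule0.
  rewrite -!EFinD -EFinM ltr0_norm//; congr EFin.
  by field.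
rewrite /m ge0_integral_mscale//= ge0_integral_pushforward//.
rewrite preimage_setT muleA -EFinM mulVf ?mul1e//.
by rewrite gt_eqF.
Qed.

Lemma integral_leb_cons n (f : n.+1.-tuple rT -> \bar R) :
  measurable_fun setT f -> (forall t, 0 <= f t) ->
  \int[leb R n.+1]_t f t =
  \int[lebesgue_measure]_x \int[leb R n]_t f (cons_pair (x, t)).
Proof.
move=> mf f0.
have h := @ge0_integral_pushforward _ _ _ _ R _ (@measurable_cons_pair R n)
  (lebesgue_measure \x leb R n) setT f measurableT mf (fun t _ => f0 t).
rewrite [LHS]h preimage_setT fubini_tonelli1//; last first.
by move=> p; exact: f0.
by apply: measurableT_comp => //; exact: measurable_cons_pair.
Qed.

Definition affine_tuple n (a : R) (c t : n.-tuple rT) : n.-tuple rT :=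
  [tuple (a * tnth t i + tnth c i)%R | i < n].

Lemma measurable_affine_tuple n a (c : n.-tuple rT) :
  measurable_fun setT (affine_tuple a c).
Proof.
apply/measurable_fun_tnthP => i.
rewrite (_ : _ \o _ = fun t : n.-tuple rT => (a * tnth t i + tnth c i)%R : rT); last first.
  by apply/funext => t /=; rewrite tnth_mktuple.
by apply: (@measurableT_comp _ _ _ _ _ _ (fun x : rT => a * x + tnth c i)%R
  _ (fun t : n.-tuple rT => tnth t i)); [exact: measurable_affine|exact: measurable_tnth].
Qed.

(** Tonelli, one coordinate at a time: each contributes a factor [|a|^-1]. *)
Lemma ge0_integral_affine n a (c : n.-tuple rT) (f : n.-tuple rT -> \bar R) :
  a != 0%R -> measurable_fun setT f -> (forall t, 0 <= f t) ->
  \int[leb R n]_t f (affine_tuple a c t) =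
  (`|a| ^- n)%:E * \int[leb R n]_t f t.
Proof.
move=> a0; elim: n => [|n IH] in c f *.
  move=> mf f0; rewrite expr0 invr1 mul1e.
  by apply: eq_integral => t _; congr f; rewrite [LHS]tuple0 [RHS]tuple0.
move=> mf f0.
pose c' : n.-tuple rT := [tuple of behead c].
have cE (x : rT) t : affine_tuple a c (cons_pair (x, t)) =
    cons_pair ((a * x + thead c)%R, affine_tuple a c' t).
  apply: eq_from_tnth => i; rewrite tnth_mktuple.
  case: (unliftP ord0 i) => [j ->|->].
    rewrite !tnthS tnth_mktuple; congr (_ + _)%R; rewrite /c' tnth_behead.
    by congr tnth; apply/val_inj; rewrite /= inordK// ltnS ltn_ord.
  by rewrite !tnth0.
have mA := measurable_affine_tuple a c.
have mcp (x : rT) : measurable_fun setT (fun t => f (cons_pair (x, t))).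
  apply: measurableT_comp => //; apply: measurableT_comp => //.
    exact: measurable_cons_pair.
have mF : measurable_fun setT (fun x => \int[leb R n]_t f (cons_pair (x, t))).
  apply: (measurable_fun_fubini_tonelli_F (f \o @cons_pair R n)); last first.
    by move=> p; exact: f0.
  by apply: measurableT_comp => //; exact: measurable_cons_pair.
have mfA : measurable_fun setT (fun t => f (affine_tuple a c t)).
  by apply: measurableT_comp.
rewrite [LHS](integral_leb_cons mfA)//.
transitivity (\int[lebesgue_measure]_x ((`|a| ^- n)%:E *
    \int[leb R n]_t f (cons_pair ((a * x + thead c)%R, t)))).
  apply: eq_integral => x _; under eq_integral do rewrite cE.
  by rewrite (IH c' (fun t => f (cons_pair ((a * x + thead c)%R, t)))).
rewrite ge0_integralZl//; first last.
- by move=> x _; exact: integral_ge0.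
- exact: (measurableT_comp mF (measurable_affine a (thead c))).
rewrite (@lebesgue_affine _ _ (fun x => \int[leb R n]_t f (cons_pair (x, t))))//; last first.
  by move=> x; exact: integral_ge0.
rewrite muleA -EFinM -invfM -exprSr; congr (_ * _).
by rewrite -integral_leb_cons.
Qed.

End affine_change_of_variables.

(** * Isometries, balls and shells *)

Section lebesgue_rV.
Variables (R : realType) (n : nat).
Local Notation rT := (measurableTypeR R).
Local Notation tupR := (n.-tuple rT).
Local Notation Rn := 'rV[R]_n.
Local Notation mu := (leb R n).

Lemma vec_affine a (c : Rn) (t : tupR) :
  vec (affine_tuple a (unvec c) t) = a *: vec t + c.
Proof. by apply/rowP => i; rewrite !mxE !tnth_mktuple. Qed.

Definition shell (i : interval R) : set tupR := [set t | enorm (vec t) \in i].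

Lemma measurable_enorm_vec : measurable_fun [set: tupR] (fun t => enorm (vec t) : rT).
Proof. by apply: measurable_fun_vecT; exact: enorm_continuous. Qed.

Lemma measurable_shell i : measurable (shell i).
Proof.
rewrite -[X in measurable X]setTI.
exact: (measurable_enorm_vec measurableT (measurable_itv i)).
Qed.

Local Open Scope ereal_scope.

(** The formula for nonnegative functions is applied to the positive and negative parts of the
    extension by 0, which covers signed integrands, integrable or not. Only translations and point
    reflections occur. *)
Lemma integral_isometry a (c : Rn) (D : set Rn) (f : Rn -> \bar R) :
  `|a|%R = 1%R -> measurable (@vec R n @^-1` D) ->
  measurable_fun (@vec R n @^-1` D) (fun t => f (vec t)) ->
  \int[mu]_(t in [set t | D (a *: vec t + c)%R]) f (a *: vec t + c)%R =
  \int[mu]_(t in @vec R n @^-1` D) f (vec t).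
Proof.
move=> a1 mD mf; have a0 : a != 0%R by rewrite -normr_gt0 a1.
rewrite integral_mkcond [RHS]integral_mkcond.
have := mf; move/(measurable_restrictT _ mD).
set g := _ \_ _ => mg; set h := _ \_ _.
have hg : h = g \o affine_tuple a (unvec c).
  apply/funext => t; rewrite /h /g /patch /=.
  by rewrite (_ : (_ \in _) = (affine_tuple a (unvec c) t \in @vec R n @^-1` D))
   ?vec_affine//; apply/idP/idP; rewrite !inE /= vec_affine.
have P (k : tupR -> \bar R) : measurable_fun setT k -> (forall t, 0 <= k t) ->
   \int[mu]_t k (affine_tuple a (unvec c) t) = \int[mu]_t k t.
  move=> mk k0; rewrite ge0_integral_affine// a1 expr1n invr1 mul1e//.
rewrite hg integralE [RHS]integralE; congr (_ - _).
  rewrite funepos_comp; apply: (P (funepos g)) => [|t]; last exact: funepos_ge0.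
  exact: measurable_funepos.
rewrite funeneg_comp; apply: (P (funeneg g)) => [|t]; last exact: funeneg_ge0.
exact: measurable_funeneg.
Qed.

(** The value is never computed: finiteness, positivity and the scaling in [leb_ball] are all that
    the estimates use. *)
Definition unit_ball_vol : R := fine (mu (shell `[0, 1[%R)).

Lemma leb_unit_ball : mu (shell `[0, 1[%R) = unit_ball_vol%:E.
Proof.
rewrite /unit_ball_vol fineK// ge0_fin_numE//.
apply: (@le_lt_trans _ _ (mu [set t | forall i, tnth t i \in `[(-1)%R, 1%R]])).
  apply: le_measure; rewrite ?inE.
  - exact: measurable_shell.
  - rewrite (_ : [set t | _] = \bigcap_(i in [set: 'I_n])
     ((@tnth _ rT)^~ i @^-1` `[(-1)%R, 1%R])).
      apply: fin_bigcap_measurable => // i _.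
      by rewrite -[X in measurable X]setTI; apply: measurable_tnth.
    by apply/seteqP; split => t /= tB i; [move=> _|]; exact: tB.
  - move=> t; rewrite /shell /= in_itv/= => /andP[_ t1] i.
    have := ler_coord_enorm (vec t) i; rewrite mxE. rewrite in_itv/= -ler_norml.
    by move/le_trans; apply; exact: ltW.
by rewrite leb_box ?ltry// => i; rewrite (@le_trans _ _ 0%R).
Qed.

Lemma unit_ball_vol_gt0 : (0 < unit_ball_vol)%R.
Proof.
rewrite -lte_fin -leb_unit_ball.
pose c := (n.+1%:R^-1 : R)%R.
have c0 : (0 < c)%R by rewrite invr_gt0.
apply: (@lt_le_trans _ _ (mu [set t | forall i, tnth t i \in `[(- c)%R, c]])).
  rewrite leb_box; last by move=> i; lra.
  by rewrite lte_fin; apply: prodr_gt0 => i _; lra.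
apply: le_measure; rewrite ?inE.
- rewrite (_ : [set t | _] = \bigcap_(i in [set: 'I_n])
     ((@tnth _ rT)^~ i @^-1` `[(- c)%R, c])).
    apply: fin_bigcap_measurable => // i _.
    by rewrite -[X in measurable X]setTI; apply: measurable_tnth.
  by apply/seteqP; split => t /= tB i; [move=> _|]; exact: tB.
- exact: measurable_shell.
- move=> t /= tc; rewrite /shell /= in_itv/= enorm_ge0/=.
  apply: (le_lt_trans (enorm_le_normr _)).
  apply: (@le_lt_trans _ _ (n%:R * c)%R).
    rewrite ler_wpM2l// [leLHS]/Num.norm/= mx_normrE.
    apply/bigmax_leP; split => [|[j i] _ /=]; first exact: ltW.
    by rewrite mxE ler_norml; have := tc i; rewrite in_itv.
  by rewrite /c ltr_pdivrMr// mul1r ltr_nat.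
Qed.

Lemma leb_ball (d : R) : (0 < d)%R ->
  mu (shell `[0%R, d[) = (d ^+ n * unit_ball_vol)%:E.
Proof.
move=> d0; have d0' : (d^-1 != 0)%R by rewrite invr_eq0 gt_eqF.
have := @ge0_integral_affine _ n d^-1%R (unvec 0%R) (EFin \o \1_(shell `[0%R, 1%R[)) d0'.
have I i : \int[mu]_t (\1_(shell i) t)%:E = mu (shell i).
  by rewrite integral_indic ?setIT//; exact: measurable_shell.
rewrite I.
rewrite leb_unit_ball normfV gtr0_norm// -exprVn invrK -EFinM => <-.
- rewrite -I.
  apply: eq_integral => t _ /=; rewrite !indicE; congr (_%:R)%:E; congr nat_of_bool.
  apply/idP/idP; rewrite !inE /shell /= vec_affine addr0 enormZ !in_itv/= enorm_ge0.
    by rewrite mulr_ge0 ?enorm_ge0//= gtr0_norm ?invr_gt0// mulrC ltr_pdivrMr// mul1r.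
  by rewrite mulr_ge0 ?enorm_ge0//= gtr0_norm ?invr_gt0// mulrC ltr_pdivrMr// mul1r.
- apply/measurable_EFinP; apply: measurable_indic; exact: measurable_shell.
- by move=> t; rewrite lee_fin.
Qed.

Lemma leb_shell (a b : R) : (0 < a)%R -> (a <= b)%R ->
  mu (shell `[a, b[) = ((b ^+ n - a ^+ n) * unit_ball_vol)%:E.
Proof.
move=> a0 ab.
have -> : shell `[a, b[ = shell `[0%R, b[ `\` shell `[0%R, a[.
  apply/seteqP; split => t; rewrite /setD /shell /= !in_itv/= enorm_ge0/=.
    by move=> /andP[at_ tb]; split => //; apply/negP; rewrite -leNgt.
  by move=> [-> /negP]; rewrite -leNgt => ->.
rewrite measureD; [|exact: measurable_shell|exact: measurable_shell|].
  rewrite (_ : _ `&` _ = shell `[0%R, a[).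
    rewrite [X in X - _]leb_ball ?(lt_le_trans a0)// [X in _ - X]leb_ball//.
    by rewrite -EFinB -mulrBl.
  apply/seteqP; split => t; rewrite /setI /shell /= !in_itv/= enorm_ge0/=; first by case.
  by move=> ta; split => //; exact: lt_le_trans ta ab.
by rewrite [X in X < _]leb_ball ?(lt_le_trans a0)// ltry.
Qed.

Lemma measurable_translated_ball (x : Rn) (d : R) :
  measurable [set t : tupR | (enorm (x - vec t) < d)%R].
Proof.
rewrite (_ : [set t | _] = @vec R n @^-1` [set z | (enorm (x - z) < d)%R])//.
apply: measurable_vec_open; rewrite openE => z /= zd; apply: nbhs_enorm.
exists (d - enorm (x - z))%R; first by rewrite subr_gt0.
move=> y zy; have := ler_enormB (x - y)%R (x - z)%R.
have -> : (x - y - (x - z) = z - y)%R by rewrite opprB addrC addrA subrK.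
by move=> h /=; lra.
Qed.

Lemma leb_translated_ball (x : Rn) (d : R) : (0 < d)%R ->
  mu [set t | (enorm (x - vec t) < d)%R] = (d ^+ n * unit_ball_vol)%:E.
Proof.
move=> d0; rewrite -leb_ball//.
have mS : measurable (@vec R n @^-1` [set z | enorm z < d]%R).
  rewrite (_ : _ @^-1` _ = shell `[0%R, d[); first exact: measurable_shell.
  by apply/seteqP; split => t; rewrite /shell /= in_itv/= enorm_ge0.
have := @integral_isometry (-1)%R x [set z | enorm z < d]%R (cst 1%:E).
rewrite normrN1 => /(_ erefl mS (measurable_cst _)).
rewrite integral_cst// ?integral_cst// ?mul1e.
  rewrite (_ : [set t | _] = [set t | (enorm (x - vec t) < d)%R]); last first.
    by apply/seteqP; split => t /=; rewrite scaleN1r addrC.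
  move=> ->; congr (mu _).
  by apply/seteqP; split => t; rewrite /shell /= in_itv/= enorm_ge0.
rewrite (_ : [set t | _] = [set t | (enorm (x - vec t) < d)%R]).
  exact: measurable_translated_ball.
by apply/seteqP; split => t /=; rewrite scaleN1r addrC.
Qed.

(** A continuous function that exceeds [N] at one point does so on a ball, which has positive
    measure. *)
Lemma leb_essential_bound (f : Rn -> R) (N : R) : continuous f ->
  mu.-negligible [set t | ~ (f (vec t) <= N)%R] -> forall x, (f x <= N)%R.
Proof.
move=> cf [A [mA A0 sA]] x; rewrite leNgt; apply/negP => Nx.
have : \forall y \near x, (N < f y)%R by have /cvgr_gt := cf x; exact.
move=> /nbhs_enormP[d d0 dP].
have : mu [set t | (enorm (x - vec t) < d)%R] <= mu A.
  apply: le_measure; rewrite ?inE//; last first.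
    by move=> t /= /dP Nt; apply: sA => /=; apply/negP; rewrite -ltNge.
  exact: measurable_translated_ball.
rewrite A0 leb_translated_ball// lee_fin leNgt => /negP; apply.
by rewrite mulr_gt0 ?exprn_gt0// unit_ball_vol_gt0.
Qed.

End lebesgue_rV.

(** * Integrals over shells *)

Section power_limits.
Variable R : realType.
Implicit Types (C q e r rho : R).

Lemma powR_small C q e : 0 < q -> 0 < e ->
  exists2 r0, 0 < r0 & forall r, 0 < r -> r <= r0 -> C * r `^ q < e.
Proof.
move=> q0 e0.
have C1 : 0 < `|C| + 1 by rewrite ltr_pwDr.
have [r0 r00 H] : exists2 r0, 0 < r0 & forall r, 0 < r -> r < r0 -> r `^ q < e / (`|C| + 1).
  have /cvgrPdist_lt/(_ (e / (`|C| + 1))) := powR_cvg0 q0.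
  rewrite divr_gt0// => /(_ isT); rewrite near_withinE => -[r0 /= r00 H].
  exists r0 => // r r_gt0 rr0; have := H r.
  rewrite /ball_/= !sub0r normrN gtr0_norm// => /(_ rr0 r_gt0).
  by rewrite normrN ger0_norm ?powR_ge0.
exists (r0 / 2); first by rewrite divr_gt0.
move=> r r_gt0 rr0.
have {}rr0 : r < r0 by lra.
apply: (@le_lt_trans _ _ ((`|C| + 1) * r `^ q)).
  by rewrite ler_wpM2r ?powR_ge0// (le_trans (ler_norm C))// lerDl.
by rewrite mulrC -ltr_pdivlMr// H.
Qed.

Lemma powR_inv r q : 0 < r -> r^-1 `^ q = r `^ (- q).
Proof. by move=> r0; rewrite -(powR_inv1 (ltW r0)) -powRrM mulN1r. Qed.

Lemma powRN_small C q e : 0 < q -> 0 < e ->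
  exists2 r0, 0 < r0 & forall r, r0 <= r -> C * r `^ (- q) < e.
Proof.
move=> q0 e0; have [r0 r00 H] := powR_small C q0 e0.
exists r0^-1; first by rewrite invr_gt0.
move=> r rr; have r_gt0 : 0 < r by apply: lt_le_trans rr; rewrite invr_gt0.
by rewrite -powR_inv// H ?invr_gt0// -(invrK r0) lef_pV2 ?posrE ?invr_gt0.
Qed.

Lemma cvg_at_right_cauchy (g : R -> R) :
  (forall e, 0 < e -> exists2 r, 0 < r &
     forall r', 0 < r' -> r' <= r -> `|g r - g r'| < e) ->
  cvg (g r @[r --> 0^'+]).
Proof.
move=> H; apply/cauchy_cvgP/cauchy_exP => e e0.
have [r r0 Hr] := H e e0; exists (g r).
rewrite /= near_simpl; near=> r'; apply: Hr; near: r'.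
  exact: nbhs_right_gt.
exact: nbhs_right_le.
Unshelve. all: by end_near. Qed.

Lemma cvg_pinfty_cauchy (g : R -> R) :
  (forall e, 0 < e -> exists rho,
     forall rho', rho <= rho' -> `|g rho - g rho'| < e) ->
  cvg (g rho @[rho --> +oo]).
Proof.
move=> H; apply/cauchy_cvgP/cauchy_exP => e e0.
have [r Hr] := H e e0; exists (g r).
rewrite /= near_simpl; near=> r'; apply: Hr; near: r'.
by apply: nbhs_pinfty_ge; rewrite num_real.
Unshelve. all: by end_near. Qed.

End power_limits.

Section shell_integrals.
Variables (R : realType) (n : nat).
Local Notation rT := (measurableTypeR R).
Local Notation tupR := (n.-tuple rT).
Local Notation Rn := 'rV[R]_n.
Local Notation mu := (leb R n).
Implicit Types (f g : Rn -> R) (i j : interval R) (a b c r : R).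

(* The integral, the integrability and the measurability of f on {z | |z| \in i}. *)
Definition Ish i f : R := (\int[mu]_(t in @shell R n i) f (vec t))%R.

Definition ishell i f : Prop :=
  mu.-integrable (@shell R n i) (fun t => (f (vec t))%:E).

Definition mshell i f : Prop :=
  measurable_fun (@shell R n i) (fun t : tupR => f (vec t) : rT).

Lemma eq_Ish i f g : (forall z, enorm z \in i -> f z = g z) -> Ish i f = Ish i g.
Proof. by move=> fg; apply: eq_Rintegral => t; rewrite inE => /fg. Qed.

Lemma eq_ishell i f g : (forall z, enorm z \in i -> f z = g z) ->
  ishell i f -> ishell i g.
Proof.
move=> fg; apply: eq_integrable; first exact: measurable_shell.
by move=> t; rewrite inE => /fg ->.
Qed.

Lemma ishellD i f g : ishell i f -> ishell i g -> ishell i (fun z => f z + g z).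
Proof.
move=> fi gi; have := integrableD (@measurable_shell R n i) fi gi.
by apply: eq_integrable; first exact: measurable_shell.
Qed.

Lemma ishellB i f g : ishell i f -> ishell i g -> ishell i (fun z => f z - g z).
Proof.
move=> fi gi; have := integrableB (@measurable_shell R n i) fi gi.
by apply: eq_integrable; first exact: measurable_shell.
Qed.

Lemma ishellZ i f c : ishell i f -> ishell i (fun z => c * f z).
Proof.
move=> fi; have := integrableZl (@measurable_shell R n i) c fi.
by apply: eq_integrable; first exact: measurable_shell.
Qed.

Lemma ishellS i j f : {subset j <= i} -> ishell i f -> ishell j f.
Proof.
move=> ji; apply: integrableS; [exact: measurable_shell|exact: measurable_shell|].
by move=> t /ji.
Qed.

Lemma IshD i f g : ishell i f -> ishell i g ->
  Ish i (fun z => f z + g z) = Ish i f + Ish i g.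
Proof. by move=> fi gi; rewrite /Ish RintegralD//; exact: measurable_shell. Qed.

Lemma IshB i f g : ishell i f -> ishell i g ->
  Ish i (fun z => f z - g z) = Ish i f - Ish i g.
Proof. by move=> fi gi; rewrite /Ish RintegralB//; exact: measurable_shell. Qed.

Lemma IshZ i f c : ishell i f -> Ish i (fun z => c * f z) = c * Ish i f.
Proof. by move=> fi; rewrite /Ish RintegralZl//; exact: measurable_shell. Qed.

Lemma le_Ish i f g : ishell i f -> ishell i g ->
  (forall z, enorm z \in i -> f z <= g z) -> Ish i f <= Ish i g.
Proof.
move=> fi gi fg; apply: le_Rintegral => //; first exact: measurable_shell.
by move=> t /fg.
Qed.

Lemma Ish_ge0 i f : (forall z, enorm z \in i -> 0 <= f z) -> 0 <= Ish i f.
Proof. by move=> f0; apply: Rintegral_ge0 => t /f0. Qed.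

Lemma Ish_split i j k f : {subset j <= i} -> {subset k <= i} ->
  (forall x, x \in i -> (x \in j) || (x \in k)) ->
  (forall x, x \in j -> x \in k -> False) ->
  ishell i f -> Ish i f = Ish j f + Ish k f.
Proof.
move=> ji ki ijk jk fi.
have E : @shell R n i = @shell R n j `|` @shell R n k.
  apply/seteqP; split => t /=; first by move=> /ijk /orP[]; [left|right].
  by case => [/ji|/ki].
rewrite {1}/Ish E Rintegral_setU//; [exact: measurable_shell|exact: measurable_shell| |].
  by rewrite -E.
rewrite disj_set2E; apply/eqP/seteqP; split => // t [/=].
exact: jk.
Qed.

Lemma ishell_bounded i f (B b : R) : (forall x, x \in i -> x < b) -> mshell i f ->
  (forall z, enorm z \in i -> `|f z| <= B) -> ishell i f.
Proof.
move=> ib mf fB; apply: measurable_bounded_integrable => //.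
- exact: measurable_shell.
- have [b0|b0] := ltP 0 b.
    apply: (@le_lt_trans _ _ (mu (@shell R n `[0, b[))).
      apply: le_measure; rewrite ?inE; [exact: measurable_shell|exact: measurable_shell|].
      by move=> t /ib tb; rewrite /shell /= in_itv/= enorm_ge0.
    by rewrite leb_ball// ltry.
  rewrite (_ : @shell R n i = set0) ?measure0//.
  apply/seteqP; split => // t /ib tb.
  by have := lt_le_trans (le_lt_trans (enorm_ge0 _) tb) b0; rewrite ltxx.
- exists B; split; first exact: num_real.
  by move=> c Bc t /= /fB fBt; apply: le_trans fBt (ltW Bc).
Qed.

Lemma mshell_continuous (D : set Rn) i f : open D ->
  (forall z, enorm z \in i -> D z) -> {in D, continuous f} -> mshell i f.
Proof.
move=> oD iD cf; have := measurable_fun_vec oD cf; apply: measurable_funS.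
  exact: measurable_vec_open.
by move=> t /iD.
Qed.

Lemma bounded_on_shell (D : set Rn) f (a b : R) :
  (forall z, a <= enorm z <= b -> D z) -> {in D, continuous f} ->
  exists2 B, 0 <= B & forall z, a <= enorm z <= b -> `|f z| <= B.
Proof.
move=> abD cf.
have : compact (f @` [set z : Rn | a <= enorm z <= b]).
  apply: continuous_compact; last exact: compact_enorm_le.
  apply: continuous_in_subspaceT => z; rewrite inE => /abD Dz; apply: cf.
  by rewrite inE.
move=> /compact_bounded[M [_ HM]]; exists (`|M| + 1); first by rewrite addr_ge0.
move=> z zab; apply: HM; last by exists z.
by rewrite (le_lt_trans (ler_norm M))// ltrDl.
Qed.

Lemma ishell_continuous (D : set Rn) i f (a b : R) : open D ->
  {subset i <= `[a, b]} ->
  (forall z, a <= enorm z <= b -> D z) -> {in D, continuous f} -> ishell i f.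
Proof.
move=> oD iab abD cf; have [B B0 HB] := bounded_on_shell abD cf.
apply: (@ishell_bounded _ _ B (b + 1)).
- by move=> x /iab; rewrite in_itv/= => /andP[_ xb]; rewrite ltr_pwDr.
- by apply: mshell_continuous oD _ cf => z /iab; rewrite in_itv/= => /abD.
- by move=> z /iab; rewrite in_itv/= => /HB.
Qed.

End shell_integrals.

(** * Power-law bounds over dyadic shells, and parity *)

Section shell_estimates.
Variables (R : realType) (n : nat).
Local Notation Rn := 'rV[R]_n.
Local Notation mu := (leb R n).
Local Notation vol := (unit_ball_vol R n).
Implicit Types (f g : Rn -> R) (i j : interval R) (a b c r m q B : R).

Lemma ishell_norm i f : ishell i f -> ishell i (fun z => `|f z|).
Proof. by move=> fi; have := integrable_abse fi. Qed.

Lemma ler_norm_Ish i f g : ishell i f -> ishell i g ->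
  (forall z, enorm z \in i -> `|f z| <= g z) -> `|Ish i f| <= Ish i g.
Proof.
move=> fi gi fg; apply: (@le_trans _ _ (Ish i (fun z => `|f z|))).
  by apply: le_normr_Rintegral => //; exact: measurable_shell.
by apply: le_Ish => //; exact: ishell_norm.
Qed.

Lemma ishell_cst i a b c : 0 < a -> a <= b -> {subset i <= `[a, b[} ->
  @ishell R n i (fun=> c).
Proof.
move=> a0 ab ib.
apply: (@ishell_continuous _ _ setT _ _ a b) => //; first exact: openT.
  by move=> x /ib; rewrite !in_itv/= => /andP[-> /ltW].
by move=> z _; exact: cst_continuous.
Qed.

Lemma Ish_bound i f a b m : 0 < a -> a <= b -> {subset i <= `[a, b[} ->
  ishell i f -> 0 <= m -> (forall z, enorm z \in i -> `|f z| <= m) ->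
  `|Ish i f| <= m * ((b ^+ n - a ^+ n) * vol).
Proof.
move=> a0 ab iab fi m0 fm.
apply: (@le_trans _ _ (Ish i (fun=> m))).
  by apply: ler_norm_Ish => //; exact: ishell_cst ab iab.
rewrite /Ish Rintegral_cst; last exact: measurable_shell.
rewrite ler_wpM2l// -lee_fin -(leb_shell n a0 ab) fineK; last first.
  rewrite ge0_fin_numE//; apply: (@le_lt_trans _ _ (mu (@shell R n `[a, b[))).
    by apply: le_measure; rewrite ?inE; [exact: measurable_shell..|move=> t /iab].
  by rewrite leb_shell// ltry.
by apply: le_measure; rewrite ?inE; [exact: measurable_shell..|move=> t /iab].
Qed.

Lemma Ish_oc_bound f a b m : 0 < a -> a <= b -> ishell `]a, b] f -> 0 <= m ->
  (forall z, a < enorm z <= b -> `|f z| <= m) ->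
  `|Ish `]a, b] f| <= m * ((2 * b) ^+ n * vol).
Proof.
move=> a0 ab fi m0 fm.
have b0 : 0 < b by exact: lt_le_trans ab.
(* The measure of a shell is known for left-closed, right-open intervals; []a, b]] is placed inside
   [[a, 2 * b[]. *)
apply: (@le_trans _ _ (m * (((2 * b) ^+ n - a ^+ n) * vol))).
  apply: Ish_bound => //; first lra.
  by move=> x; rewrite !in_itv/= => /andP[? ?]; apply/andP; split; lra.
rewrite ler_wpM2l// ler_wpM2r ?(ltW (unit_ball_vol_gt0 _ _))//.
by rewrite gerBl exprn_ge0// ltW.
Qed.

Lemma Ish_co_bound f a b m : 0 < a -> a <= b -> ishell `[a, b[ f -> 0 <= m ->
  (forall z, a <= enorm z < b -> `|f z| <= m) ->
  `|Ish `[a, b[ f| <= m * (b ^+ n * vol).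
Proof.
move=> a0 ab fi m0 fm.
apply: (@le_trans _ _ (m * ((b ^+ n - a ^+ n) * vol))).
  by apply: Ish_bound.
rewrite ler_wpM2l// ler_wpM2r ?(ltW (unit_ball_vol_gt0 _ _))//.
by rewrite gerBl exprn_ge0// ltW.
Qed.

Definition dyadic_const q : R := 4 ^+ n * vol / (1 - (2 `^ q)^-1).

Lemma powR2_gt1 q : 0 < q -> 1 < 2 `^ q :> R.
Proof.
move=> q0; rewrite -[ltLHS](_ : 1 `^ q = 1); last by rewrite powR1.
by rewrite gt0_ltr_powR ?nnegrE// ltr1n.
Qed.

Lemma dyadic_const_gt0 q : 0 < q -> 0 < dyadic_const q.
Proof.
move=> q0; have q1 := powR2_gt1 q0.
rewrite divr_gt0 ?mulr_gt0 ?unit_ball_vol_gt0//.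
by rewrite subr_gt0 invf_lt1// (lt_trans ltr01).
Qed.

(** A geometric series is its first term plus a multiple of itself; this identity closes both dyadic
    inductions. *)
Let dyadic_step q : 0 < q ->
  4 ^+ n * vol + dyadic_const q * (2 `^ q)^-1 = dyadic_const q.
Proof.
move=> q0; have q1 := powR2_gt1 q0; have q2 := lt_trans ltr01 q1.
rewrite /dyadic_const; field; rewrite gt_eqF//=.
by rewrite gt_eqF// subr_gt0.
Qed.

Let powR_split (x p : R) : 0 < x -> x `^ (p - n%:R) = x `^ p / x ^+ n.
Proof.
move=> x0; rewrite powRD; last by rewrite (gt_eqF x0) implybT.
by rewrite powRN powR_mulrn// ltW.
Qed.

(* Each dyadic shell {d / 2 < |z| <= d} contributes at most B * 4 ^ n * vol * d `^ q. *)
Lemma Ish_near_bound f q B a b : 0 < q -> 0 <= B -> 0 < a -> a <= b ->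
  (forall c d, a <= c -> d <= b -> ishell `]c, d] f) ->
  (forall z, a < enorm z <= b -> `|f z| <= B * enorm z `^ (q - n%:R)) ->
  `|Ish `]a, b] f| <= B * (dyadic_const q * b `^ q).
Proof.
move=> q0 B0 a0 ab fi fB.
have [N aN] : exists N, b <= a * 2 ^+ N.
  exists (Num.truncn (b / a)).+1.
  rewrite mulrC -ler_pdivrMr// ltW//; apply: (@lt_le_trans _ _ (Num.truncn (b / a)).+1%:R).
    by rewrite truncnS_gt// divr_ge0 ?ltW// (lt_le_trans a0).
  by rewrite -natrX ler_nat ltnW// ltn_expl.
have step d c : a <= c -> c <= d -> d <= b -> d <= 2 * c ->
    `|Ish `]c, d] f| <= B * (4 ^+ n * vol * d `^ q).
  move=> ac cd db d2c.
  have c0 : 0 < c by exact: lt_le_trans ac.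
  have d0 : 0 < d by exact: lt_le_trans cd.
  apply: (@le_trans _ _ (B * (d `^ q / c ^+ n) * ((2 * d) ^+ n * vol))).
    apply: Ish_oc_bound => //; first exact: fi.
      by rewrite mulr_ge0// divr_ge0 ?powR_ge0// exprn_ge0// ltW.
    move=> z /andP[cz zd]; apply: (le_trans (fB _ _)).
      by rewrite (le_lt_trans ac)// (le_trans zd).
    have z0 : 0 < enorm z by exact: lt_trans cz.
    rewrite ler_wpM2l// powR_split//.
    rewrite ler_pM ?powR_ge0 ?invr_ge0 ?exprn_ge0 ?(ltW z0)//.
      by rewrite ge0_ler_powR ?nnegrE ?(ltW z0) ?(ltW d0) ?(ltW q0).
    by rewrite lef_pV2 ?posrE ?exprn_gt0// lerXn2r ?nnegrE ?ltW.
  have h : (2 * d) ^+ n <= 4 ^+ n * c ^+ n.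
    by rewrite -exprMn lerXn2r// ?nnegrE; lra.
  have -> : B * (d `^ q / c ^+ n) * ((2 * d) ^+ n * vol) =
      (B * vol * d `^ q) * ((2 * d) ^+ n / c ^+ n) by ring.
  have -> : B * (4 ^+ n * vol * d `^ q) = (B * vol * d `^ q) * 4 ^+ n by ring.
  rewrite ler_wpM2l ?mulr_ge0 ?powR_ge0 ?(ltW (unit_ball_vol_gt0 _ _))//.
  by rewrite ler_pdivrMr ?exprn_gt0.
have q1 := powR2_gt1 q0; have q2 := lt_trans ltr01 q1.
have C0 := dyadic_const_gt0 q0.
have le_step d : B * (4 ^+ n * vol * d `^ q) <= B * (dyadic_const q * d `^ q).
  rewrite ler_wpM2l// ler_wpM2r ?powR_ge0// -(dyadic_step q0) lerDl.
  by apply: mulr_ge0; rewrite ?invr_ge0; exact: ltW.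
elim: N b ab fi fB aN step => [|N IH] b ab fi fB aN step.
  apply: le_trans (le_step b); apply: step => //.
  by rewrite (le_trans aN)// expr0; lra.
have [b2a|b2a] := leP b (2 * a).
  by apply: le_trans (le_step b); apply: step.
have b0 : 0 < b by exact: lt_le_trans ab.
rewrite (@Ish_split _ _ _ `]a, b / 2] `](b / 2), b]) //; last first.
- exact: fi.
- by move=> x; rewrite !in_itv/= => /andP[_ x1] /andP[x2 _]; lra.
- move=> x; rewrite !in_itv/= => /andP[-> ->]; rewrite andbT/=.
  by have [] := leP x (b / 2).
- by move=> x; rewrite !in_itv/= => /andP[x1 ->]; rewrite andbT; lra.
- by move=> x; rewrite !in_itv/= => /andP[-> x1]/=; lra.
apply: (le_trans (ler_normD _ _)).
have b2b : b / 2 <= b by lra.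
apply: (@le_trans _ _ (B * (dyadic_const q * (b / 2) `^ q) +
    B * (4 ^+ n * vol * b `^ q))).
  apply: lerD.
    apply: IH => //; first lra.
    - by move=> c d ac db; apply: fi => //; exact: le_trans b2b.
    - by move=> z /andP[az zb]; apply: fB; rewrite az/= (le_trans zb).
    - by move: aN; rewrite exprS; lra.
    - by move=> d c ac cd db d2c; apply: step => //; exact: le_trans b2b.
  by apply: step => //; lra.
have -> : (b / 2) `^ q = b `^ q / 2 `^ q.
  by rewrite powRM ?invr_ge0 ?(ltW b0)// powR_inv// powRN.
rewrite le_eqVlt; apply/orP; left; apply/eqP.
by rewrite -[in RHS](dyadic_step q0); ring.
Qed.

(** The mirror image of [Ish_near_bound]: the innermost shell now dominates, so the induction peels
    it off and doubles [a]. *)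
Lemma Ish_far_bound f q B a b : 0 < q -> 0 <= B -> 0 < a -> a <= b ->
  (forall c d, a <= c -> d <= b -> ishell `[c, d[ f) ->
  (forall z, a <= enorm z < b -> `|f z| <= B * enorm z `^ (- q - n%:R)) ->
  `|Ish `[a, b[ f| <= B * (dyadic_const q * a `^ (- q)).
Proof.
move=> q0 B0 a0 ab fi fB.
have [N aN] : exists N, b <= a * 2 ^+ N.
  exists (Num.truncn (b / a)).+1.
  rewrite mulrC -ler_pdivrMr// ltW//; apply: (@lt_le_trans _ _ (Num.truncn (b / a)).+1%:R).
    by rewrite truncnS_gt// divr_ge0 ?ltW// (lt_le_trans a0).
  by rewrite -natrX ler_nat ltnW// ltn_expl.
have step c d : a <= c -> c <= d -> d <= b -> d <= 2 * c ->
    `|Ish `[c, d[ f| <= B * (4 ^+ n * vol * c `^ (- q)).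
  move=> ac cd db d2c.
  have c0 : 0 < c by exact: lt_le_trans ac.
  have d0 : 0 < d by exact: lt_le_trans cd.
  apply: (@le_trans _ _ (B * (c `^ (- q) / c ^+ n) * (d ^+ n * vol))).
    apply: Ish_co_bound => //; first exact: fi.
      by rewrite mulr_ge0// divr_ge0 ?powR_ge0// exprn_ge0// ltW.
    move=> z /andP[cz zd]; apply: (le_trans (fB _ _)).
      by rewrite (le_trans ac cz)/= (lt_le_trans zd db).
    have z0 : 0 < enorm z by exact: lt_le_trans cz.
    rewrite ler_wpM2l// powR_split//.
    rewrite ler_pM ?powR_ge0 ?invr_ge0 ?exprn_ge0 ?(ltW z0)//.
      rewrite !powRN lef_pV2 ?posrE ?powR_gt0//.
      by rewrite ge0_ler_powR ?nnegrE ?(ltW z0) ?(ltW c0) ?(ltW q0).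
    rewrite lef_pV2 ?posrE ?exprn_gt0// lerXn2r// ?nnegrE; exact: ltW.
  have h : d ^+ n <= 4 ^+ n * c ^+ n.
    by rewrite -exprMn lerXn2r// ?nnegrE; lra.
  have -> : B * (c `^ (- q) / c ^+ n) * (d ^+ n * vol) =
      (B * vol * c `^ (- q)) * (d ^+ n / c ^+ n) by ring.
  have -> : B * (4 ^+ n * vol * c `^ (- q)) = (B * vol * c `^ (- q)) * 4 ^+ n by ring.
  rewrite ler_wpM2l ?mulr_ge0 ?powR_ge0 ?(ltW (unit_ball_vol_gt0 _ _))//.
  by rewrite ler_pdivrMr ?exprn_gt0.
have q1 := powR2_gt1 q0; have q2 := lt_trans ltr01 q1.
have C0 := dyadic_const_gt0 q0.
have le_step d : B * (4 ^+ n * vol * d `^ (- q)) <= B * (dyadic_const q * d `^ (- q)).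
  rewrite ler_wpM2l// ler_wpM2r ?powR_ge0// -(dyadic_step q0) lerDl.
  by apply: mulr_ge0; rewrite ?invr_ge0; exact: ltW.
elim: N a a0 ab fi fB aN step => [|N IH] a a0 ab fi fB aN step.
  apply: le_trans (le_step a); apply: step => //.
  by rewrite (le_trans aN)// expr0; lra.
have [b2a|b2a] := leP b (2 * a).
  by apply: le_trans (le_step a); apply: step.
have b0 : 0 < b by exact: lt_le_trans ab.
rewrite (@Ish_split _ _ _ `[a, (2 * a)[ `[(2 * a), b[) //; last first.
- exact: fi.
- by move=> x; rewrite !in_itv/= => /andP[_ x1] /andP[x2 _]; lra.
- move=> x; rewrite !in_itv/= => /andP[-> ->]; rewrite andbT/=.
  by have [] := ltP x (2 * a).
- by move=> x; rewrite !in_itv/= => /andP[x1 ->]; rewrite andbT; lra.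
- by move=> x; rewrite !in_itv/= => /andP[-> x1]/=; lra.
apply: (le_trans (ler_normD _ _)).
apply: (@le_trans _ _ (B * (4 ^+ n * vol * a `^ (- q)) +
    B * (dyadic_const q * (2 * a) `^ (- q)))).
  have a2a : a <= 2 * a by lra.
  apply: lerD.
    by apply: step => //; lra.
  apply: IH => //; [lra|lra| | | |].
  - by move=> c d ac db; apply: fi => //; exact: le_trans ac.
  - by move=> z /andP[az zb]; apply: fB; rewrite zb andbT (le_trans _ az).
  - by move: aN; rewrite exprS; lra.
  - by move=> d c ac cd db d2c; apply: step => //; exact: le_trans ac.
have -> : (2 * a) `^ (- q) = (2 `^ q)^-1 * a `^ (- q).
  by rewrite powRM ?(ltW a0)// (powRN 2).
rewrite le_eqVlt; apply/orP; left; apply/eqP.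
by rewrite -[in RHS](dyadic_step q0); ring.
Qed.

Lemma Ish_opp i f : mshell i f -> Ish i (fun z => f (- z)) = Ish i f.
Proof.
move=> mf; have mD : measurable (@vec R n @^-1` [set z | enorm z \in i]).
  exact: measurable_shell.
have mf' : measurable_fun (@vec R n @^-1` [set z | enorm z \in i])
    (fun t => (f (vec t))%:E) by exact/measurable_EFinP.
have := @integral_isometry R n (-1) 0 [set z | enorm z \in i]
  (fun z => (f z)%:E) (normrN1 R) mD mf'.
rewrite /Ish /Rintegral => <-; congr fine.
rewrite (_ : [set t | _] = @shell R n i); last first.
  by apply/seteqP; split => t /=; rewrite scaleN1r addr0 enormN.
by apply: eq_integral => t _; rewrite scaleN1r addr0.
Qed.

Lemma Ish_odd i f : ishell i f -> (forall z, f (- z) = - f z) -> Ish i f = 0.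
Proof.
move=> fi fodd; have mf : mshell i f by apply/measurable_EFinP; case/integrableP : fi.
have := Ish_opp mf; rewrite (@eq_Ish _ _ _ _ (fun z => (-1) * f z)); last first.
  by move=> z _; rewrite fodd mulN1r.
rewrite IshZ//; lra.
Qed.

Lemma Ish_lower f p B a b : (0 < n)%N -> 0 < a -> (3 / 2) * a <= b -> p <= 0 ->
  0 <= B -> ishell `[a, b[ f -> (forall z, a <= enorm z < b -> 0 <= f z) ->
  (forall z, a <= enorm z < (3 / 2) * a -> B * enorm z `^ p <= f z) ->
  B * (((3 / 2) * a) `^ p * (a ^+ n * ((3 / 2) ^+ n - 1) * vol)) <= Ish `[a, b[ f.
Proof.
move=> n0 a0 ab p0 B0 fi f0 fB.
have a32 : a <= 3 / 2 * a by lra.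
have sub : {subset `[a, (3 / 2 * a)[ <= `[a, b[}.
  by move=> x; rewrite !in_itv/= => /andP[-> x1]/=; exact: lt_le_trans ab.
apply: (@le_trans _ _ (Ish `[a, (3 / 2 * a)[ f)); last first.
  rewrite (@Ish_split _ _ `[a, b[ `[a, (3 / 2 * a)[ `[(3 / 2 * a), b[) //.
  - rewrite lerDl; apply: Ish_ge0 => z; rewrite in_itv/= => /andP[z1 z2].
    by apply: f0; rewrite z2 andbT; lra.
  - by move=> x; rewrite !in_itv/= => /andP[x1 ->]; rewrite andbT; lra.
  - move=> x; rewrite !in_itv/= => /andP[-> ->]; rewrite andbT/=.
    by have [] := ltP x (3 / 2 * a).
  - by move=> x; rewrite !in_itv/= => /andP[_ x1] /andP[x2 _]; lra.
have {}fi := ishellS sub fi.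
apply: (@le_trans _ _ (Ish `[a, (3 / 2 * a)[ (fun=> B * (3 / 2 * a) `^ p))); last first.
  apply: le_Ish => //; first by apply: ishell_cst a0 a32 _.
  move=> z; rewrite in_itv/= => /[dup] /fB h /andP[az zb]; apply: le_trans h.
  rewrite ler_wpM2l// -(opprK p) !(powRN _ (- p)) lef_pV2 ?posrE ?powR_gt0//; last 2 first.
    lra.
    lra.
  rewrite ge0_ler_powR ?nnegrE ?oppr_ge0 ?enorm_ge0//; last exact: ltW.
  lra.
rewrite /Ish Rintegral_cst; last exact: measurable_shell.
rewrite (_ : fine _ = ((3 / 2 * a) ^+ n - a ^+ n) * vol); last first.
  exact: (congr1 fine (leb_shell n a0 a32)).
rewrite (exprMn _ (3 / 2) a); move: ((3 / 2) ^+ n) (_ `^ p) => X Y.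
by rewrite le_eqVlt; apply/orP; left; apply/eqP; ring.
Qed.
End shell_estimates.

(** * Directional derivatives and the boundary terms of integration by parts *)

Section directional_derivatives.
Variables (R : realType) (n : nat).
Local Notation rT := (measurableTypeR R).
Local Notation Rn := 'rV[R]_n.
Implicit Types (f : Rn -> R) (z e : Rn) (t s B : R).

Lemma line_is_derive f z e s : derivable f (z + s *: e) e ->
  is_derive s 1 (fun s => f (z + s *: e)) ('D_e f (z + s *: e)).
Proof.
move=> df; have E : (fun h : R => h^-1 *: (((fun s => f (z + s *: e)) \o shift s) (h *: 1)
     - f (z + s *: e))) =
   (fun h => h^-1 *: ((f \o shift (z + s *: e)) (h *: e) - f (z + s *: e))).
  apply/funext => h /=; rewrite [h *: 1]mulr1 scalerDl.
  by congr (_ *: (f _ - _)); rewrite addrCA.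
by apply: DeriveDef; rewrite /derivable /derive E.
Qed.

Lemma line_mvt f z e t : 0 <= t ->
  (forall s, 0 <= s <= t -> derivable f (z + s *: e) e) ->
  exists2 s, 0 <= s <= t & f (z + t *: e) - f z = 'D_e f (z + s *: e) * t.
Proof.
move=> t0 df.
have [] := @MVT_segment R (fun s => f (z + s *: e))
    (fun s => 'D_e f (z + s *: e)) 0 t t0.
- move=> s; rewrite in_itv/= => /andP[s0 st]; apply: line_is_derive; apply: df.
  by rewrite !ltW.
- apply: derivable_within_continuous => s; rewrite in_itv/= => st.
  by have [] := line_is_derive (df s st).
move=> c; rewrite in_itv/= => c01 E; exists c => //.
by move: E; rewrite scale0r addr0 subr0.
Qed.

Lemma line_lipschitz f z e t B : 0 <= t ->
  (forall s, 0 <= s <= t -> derivable f (z + s *: e) e) ->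
  (forall s, 0 <= s <= t -> `|'D_e f (z + s *: e)| <= B) ->
  `|f (z + t *: e) - f z| <= B * t.
Proof.
move=> t0 df dB; have [s st ->] := line_mvt t0 df.
by rewrite normrM (ger0_norm t0) ler_wpM2r// dB.
Qed.

Lemma cvg_difference_quotient f z e (u : R^nat) : derivable f z e ->
  (forall k, u k != 0) -> u k @[k --> \oo] --> 0 ->
  (u k)^-1 * (f (z + u k *: e) - f z) @[k --> \oo] --> 'D_e f z.
Proof.
move=> df u0 ucvg A /df[d /= d0 dA].
have /cvgrPdist_lt/(_ d d0) := ucvg; apply: filterS => k; rewrite sub0r normrN => ukd.
have := dA (u k); rewrite /ball_/= sub0r normrN => /(_ ukd (u0 k)).
by rewrite /= [_ *: e + z]addrC.
Qed.

Lemma continuous_shift f (v : Rn) : continuous f -> continuous (fun z => f (z + v)).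
Proof.
move=> cf z; apply: (@continuous_comp _ _ _ (fun z => z + v) f); last exact: cf.
by apply: (@cvgD R Rn Rn (nbhs z) _ id (fun=> v) z v); [exact: cvg_id|exact: cvg_cst].
Qed.

Lemma continuous_difference_quotient f (v : Rn) c : continuous f ->
  continuous (fun z => c * (f (z + v) - f z)).
Proof.
move=> cf z; apply: (@cvgM R Rn (nbhs z) _ (fun=> c)); first exact: cvg_cst.
by apply: (@cvgB R R Rn (nbhs z)); [exact: continuous_shift|exact: cf].
Qed.

(** The kernel is differentiable off the origin but its gradient may be discontinuous. Its
    directional derivative is still a pointwise limit of continuous difference quotients. *)
Lemma measurable_fun_derive f e : continuous f -> (forall z, derivable f z e) ->
  measurable_fun setT (fun t : n.-tuple rT => 'D_e f (vec t) : rT).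
Proof.
move=> cf df.
pose u k : R := k.+1%:R^-1.
apply: (measurable_fun_cvg (h := fun k (t : n.-tuple rT) =>
  (u k)^-1 * (f (vec t + u k *: e) - f (vec t)))); last first.
  move=> t _; apply: cvg_difference_quotient => //; last exact: cvg_harmonic.
  by move=> k; rewrite /u invr_eq0 pnatr_eq0.
move=> k; exact: (measurable_fun_vecT (@continuous_difference_quotient f
  (u k *: e) (u k)^-1 cf)).
Qed.

End directional_derivatives.

(** This makes the volume of a thin shell linear in its thickness, so that a difference quotient
    over it stays bounded. *)
Lemma subrXX_le (R : realType) (x y : R) n : 0 <= y -> y <= x ->
  x ^+ n.+1 - y ^+ n.+1 <= (x - y) * (n.+1%:R * x ^+ n).
Proof.
move=> y0 yx; elim: n => [|n IH]; first by rewrite expr0 !expr1 !mulr1.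
have x0 : 0 <= x by exact: le_trans yx.
have -> : x ^+ n.+2 - y ^+ n.+2 = x * (x ^+ n.+1 - y ^+ n.+1) + (x - y) * y ^+ n.+1.
  by rewrite !(exprS _ n.+1); ring.
have h1 := ler_wpM2l x0 IH.
have h2 : (x - y) * y ^+ n.+1 <= (x - y) * x ^+ n.+1.
  by rewrite ler_wpM2l ?subr_ge0// lerXn2r ?nnegrE.
apply: (le_trans (lerD h1 h2)).
rewrite le_eqVlt; apply/orP; left; apply/eqP.
rewrite (mulrS 1 n.+1) (exprS _ n). ring.
Qed.

Section divergence.
Variables (R : realType) (n : nat).
Local Notation rT := (measurableTypeR R).
Local Notation tupR := (n.-tuple rT).
Local Notation Rn := 'rV[R]_n.
Local Notation mu := (leb R n).
Local Notation vol := (unit_ball_vol R n).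

Lemma Ish_indic (i : interval R) (P : set Rn) (f : Rn -> R) :
  (forall z, P z -> enorm z \in i) ->
  (\int[mu]_(t in @vec R n @^-1` P) f (vec t))%R = Ish i (fun z => f z * \1_P z).
Proof.
move=> Pi; rewrite (_ : @vec R n @^-1` P = @shell R n i `&` @vec R n @^-1` P).
  rewrite Rintegral_mkcondr; apply: eq_Rintegral => t _.
  rewrite /patch indicE (_ : (t \in _) = (vec t \in P)); last first.
    by apply/idP/idP; rewrite !inE.
  by case: ifP => _; rewrite ?mulr1 ?mulr0.
by apply/seteqP; split => t /=; [move=> Pt; split => //; exact: Pi|case].
Qed.

Lemma ishell_indic (i : interval R) (P : set Rn) (f : Rn -> R) (b : R) :
  (forall x, x \in i -> x <= b) -> measurable (@vec R n @^-1` P) ->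
  continuous f -> ishell i (fun z => f z * \1_P z).
Proof.
move=> ib mP cf.
have [B B0 HB] := @bounded_on_shell R n setT f 0 b (fun _ _ => I) (fun z _ => cf z).
apply: (@ishell_bounded _ _ _ _ B (b + 1)).
- by move=> x /ib xb; lra.
- apply: measurable_funTS; apply: measurable_funM; first exact: measurable_fun_vecT.
  exact: (measurable_indic mP).
- move=> z /ib zb; rewrite normrM indicE.
  apply: (@le_trans _ _ (`|f z| * 1)); last by rewrite mulr1 HB// enorm_ge0.
  by rewrite ler_wpM2l//; case: (_ \in _); rewrite ?normr1// normr0.
Qed.

(* A ball and its translate by v differ inside the shell of width 2 t. *)
Lemma Ish_translate_ball (H : Rn -> R) (v : Rn) (rho t m : R) : continuous H ->
  0 <= m -> 0 < t -> t < rho -> enorm v <= t ->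
  (forall z, rho - t <= enorm z < rho + t -> `|H z| <= m) ->
  `|Ish `]-oo, rho[ (fun z => H (z + v)) - Ish `]-oo, rho[ H| <=
  m * (((rho + t) ^+ n - (rho - t) ^+ n) * vol).
Proof.
move=> cH m0 t0 trho vt Hm.
pose W := `]-oo, (rho + t)[ : interval R.
pose P1 := [set z : Rn | enorm (v - z) < rho].
pose P0 := [set z : Rn | enorm z < rho].
have mP1 : measurable (@vec R n @^-1` P1) by exact: measurable_translated_ball.
have mP0 : measurable (@vec R n @^-1` P0).
  have := @measurable_translated_ball R n 0 rho; congr (measurable _).
  by apply/seteqP; split => z /=; rewrite sub0r enormN.
have W1 z : P1 z -> enorm z \in W.
  rewrite /P1 /W /= in_itv/= => zr.
  have := ler_enormB z v; rewrite enormB; lra.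
have W0 z : P0 z -> enorm z \in W by rewrite /P0 /W /= in_itv/=; lra.
have E1 : Ish `]-oo, rho[ (fun z => H (z + v)) = Ish W (fun z => H z * \1_P1 z).
  rewrite -Ish_indic// /Ish /Rintegral; congr fine.
  have := @integral_isometry R n 1 v P1 (fun z => (H z)%:E) (normr1 _) mP1.
  rewrite (_ : [set t | _] = @shell R n `]-oo, rho[); last first.
    apply/seteqP; split => z /=; rewrite /P1 /shell /= in_itv/= scale1r opprD addrCA subrr addr0 enormN//.
  have mH : measurable_fun (@vec R n @^-1` P1) (fun t => (H (vec t))%:E).
    by apply/measurable_EFinP; exact: measurable_funTS (measurable_fun_vecT cH).
  move=> /(_ mH) <-.
  by apply: eq_integral => z _; rewrite scale1r.
have E0 : Ish `]-oo, rho[ H = Ish W (fun z => H z * \1_P0 z).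
  rewrite -Ish_indic// (_ : @vec R n @^-1` P0 = @shell R n `]-oo, rho[)//.
have Wb x : x \in W -> x <= rho + t by rewrite in_itv/= => /ltW.
have i1 := ishell_indic Wb mP1 cH; have i0 := ishell_indic Wb mP0 cH.
rewrite E1 E0 -IshB//; have i10 := ishellB i1 i0.
rewrite (@Ish_split _ _ W `]-oo, (rho - t)[ `[(rho - t), (rho + t)[) //; last 4 first.
- by move=> x; rewrite !in_itv/=; lra.
- by move=> x; rewrite !in_itv/= => /andP[].
- move=> x; rewrite !in_itv/= => ->; rewrite andbT.
  by have [] := ltP x (rho - t).
- by move=> x; rewrite !in_itv/= => x1 /andP[x2 _]; lra.
rewrite [X in X + _](_ : _ = 0) ?add0r; last first.
  rewrite (@eq_Ish _ _ _ _ (fun=> 0)); first by rewrite /Ish Rintegral_cst ?mul0r//; exact: measurable_shell.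
  move=> z; rewrite in_itv/= => zr.
  rewrite !indicE !mem_set ?subrr//; rewrite /P0 /P1 /=; first lra.
  have := ler_enormD v (- z); rewrite enormN; lra.
apply: Ish_bound => //; [lra|lra| |].
  by apply: ishellS i10 => x; rewrite !in_itv/= => /andP[].
move=> z zi; rewrite -mulrBr normrM.
apply: (@le_trans _ _ (`|H z| * 1)); last by rewrite mulr1 Hm// -[_ && _]/(enorm z \in _).
rewrite ler_wpM2l// !indicE; case: (_ \in _); case: (_ \in _);
  by rewrite ?subrr ?subr0 ?sub0r ?normrN ?normr1 ?normr0.
Qed.

(* The integral of the difference quotient (H(z + t e) - H z) / t over a ball is
   a difference of two integrals of H, over the translated and the original ball. *)
Lemma Ish_divergence_bound (H : Rn -> R) (e : Rn) (rho m B : R) : (0 < n)%N ->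
  continuous H -> (forall z, derivable H z e) -> enorm e = 1 -> 0 < rho ->
  (forall z, enorm z <= 2 * rho -> `|'D_e H z| <= B) -> 0 <= m ->
  (forall z, rho / 2 <= enorm z <= 2 * rho -> `|H z| <= m) ->
  `|Ish `]-oo, rho[ (fun z => 'D_e H z)| <= m * (4 ^+ n * n%:R * vol * rho ^+ n.-1).
Proof.
move=> n0 cH dH e1 rho0 dHB m0 Hm.
(* Steps of at most [rho / 2] keep the translation segments in the ball of radius [2 * rho], where
   [B] bounds the derivative, and the shell around the sphere between the radii [rho / 2] and
   [2 * rho], where [m] bounds [H]. *)
pose u k : R := rho / 2 * k.+1%:R^-1.
have u0 k : 0 < u k by rewrite mulr_gt0 ?invr_gt0// divr_gt0.
have urho k : u k <= rho / 2.
  by rewrite /u ler_piMr ?divr_ge0 ?(ltW rho0)// invf_le1// ler1n.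
have ucvg : u k @[k --> \oo] --> 0.
  rewrite -(mulr0 (rho / 2)); apply: cvgM; [exact: cvg_cst|exact: cvg_harmonic].
pose h k z := (u k)^-1 * (H (z + u k *: e) - H z).
have mh k : measurable_fun setT (fun t : tupR => h k (vec t) : rT).
  exact: (measurable_fun_vecT (@continuous_difference_quotient R n H (u k *: e)
    (u k)^-1 cH)).
have hB k z : enorm z < rho -> `|h k z| <= B.
  move=> zr; rewrite /h normrM gtr0_norm ?invr_gt0// mulrC ler_pdivrMr//.
  apply: line_lipschitz; [exact: ltW|by []|] => s /andP[s0 su]; apply: dHB.
  apply: (le_trans (ler_enormD _ _)); rewrite enormZ e1 ger0_norm// mulr1.
  have := urho k; lra.
have bound k : `|Ish `]-oo, rho[ (h k)| <= m * (4 ^+ n * n%:R * vol * rho ^+ n.-1).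
  have cHu := @continuous_shift R n H (u k *: e) cH.
  have iH g : continuous g -> @ishell R n `]-oo, rho[ g.
    move=> cg.
    have ig : @ishell R n `]-oo, rho[ (fun z => g z * \1_setT z).
      apply: (@ishell_indic _ setT g rho _ _ cg).
        by move=> x; rewrite in_itv/= => /ltW.
      by rewrite preimage_setT; exact: measurableT.
    by apply: eq_ishell ig => z _; rewrite indicT mulr1.
  rewrite [Ish _ _](@IshZ R n _ (fun z => H (z + u k *: e) - H z)); last first.
    by apply: ishellB; exact: iH.
  rewrite IshB; [|exact: iH|exact: iH].
  rewrite normrM gtr0_norm ?invr_gt0// mulrC ler_pdivrMr//.
  have ur := urho k; have uk := u0 k.
  apply: (le_trans (@Ish_translate_ball H (u k *: e) rho (u k) m _ _ _ _ _ _)) => //.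
  - lra.
  - by rewrite enormZ e1 mulr1 gtr0_norm.
  - by move=> z /andP[z1 z2]; apply: Hm; apply/andP; split; lra.
  rewrite -!mulrA ler_wpM2l//.
  have v0 := ltW (unit_ball_vol_gt0 R n).
  case: (n) n0 v0 => // N _ v0 /=.
  have h1 : (rho + u k) ^+ N.+1 - (rho - u k) ^+ N.+1 <=
      (2 * u k) * (N.+1%:R * (2 * rho) ^+ N).
    apply: (le_trans (subrXX_le _ _ _)); [lra|lra|].
    have -> : rho + u k - (rho - u k) = 2 * u k by ring.
    apply: ler_wpM2l; first lra.
    by apply: ler_wpM2l => //; apply: lerXn2r; rewrite ?nnegrE; lra.
  apply: (le_trans (ler_wpM2r v0 h1)).
  have h2 : (2 : R) * 2 ^+ N <= 4 ^+ N.+1.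
    by rewrite -exprS lerXn2r ?nnegrE//; lra.
  have -> : 2 * u k * (N.+1%:R * (2 * rho) ^+ N) * unit_ball_vol R N.+1 =
     (2 * 2 ^+ N) * (N.+1%:R * (unit_ball_vol R N.+1 * (rho ^+ N * u k))).
    by rewrite exprMn; ring.
  by rewrite ler_wpM2r// !mulr_ge0// ?exprn_ge0// ltW.
have rb : (0 <= B)%R.
  by apply: le_trans (dHB 0 _) => //; rewrite enorm0; lra.
have mD := measurable_fun_derive cH dH.
have fin : (mu (@shell R n `]-oo, rho[) < +oo)%E.
  rewrite (_ : shell _ = @shell R n `[0, rho[); first by rewrite leb_ball// ltry.
  by apply/seteqP; split => t; rewrite /shell /= !in_itv/= enorm_ge0.
have mS := @measurable_shell R n `]-oo, rho[.
have H1 k : measurable_fun (@shell R n `]-oo, rho[) (fun t => (h k (vec t))%:E).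
  by apply/measurable_EFinP; exact: measurable_funTS (mh k).
have H2 : measurable_fun (@shell R n `]-oo, rho[) (fun t => ('D_e H (vec t))%:E).
  by apply/measurable_EFinP; exact: measurable_funTS mD.
have H3 : {ae mu, forall t, @shell R n `]-oo, rho[ t ->
    (h k (vec t))%:E @[k --> \oo] --> ('D_e H (vec t))%:E}.
  apply: aeW => t _; apply: cvg_EFin; first by apply: nearW => k.
  apply: cvg_difference_quotient => // k.
  by rewrite gt_eqF.
have H4 : mu.-integrable (@shell R n `]-oo, rho[) (cst B%:E).
  apply/integrableP; split; first exact: measurable_cst.
  by rewrite /= integral_cst//= lte_mul_pinfty// ?lee_fin.
have H5 : {ae mu, forall t (k : nat), @shell R n `]-oo, rho[ t ->
    (`|(h k (vec t))%:E| <= cst B%:E t)%E}.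
  by apply: aeW => t k; rewrite /shell /= in_itv/= lee_fin => /hB.
(* [B] is only the dominating constant; the bound that passes to the limit involves [m] alone, the
   size of [H] near the sphere. *)
have [iD _ cvgI] := dominated_convergence mS H1 H2 H3 H4 H5.
have cvgn : `|Ish `]-oo, rho[ (h k)| @[k --> \oo] -->
    `|Ish `]-oo, rho[ (fun z => 'D_e H z)|.
  apply: cvg_norm; apply: fine_cvg; rewrite fineK; first exact: cvgI.
  exact: integrable_fin_num iD.
rewrite -(cvg_lim _ cvgn)//; apply: limr_le; first by apply/cvg_ex; eexists; exact: cvgn.
by apply: nearW => k; exact: bound.
Qed.
End divergence.

(** * Regularity classes *)

Section gradients.
Variables (R : realType) (n : nat).
Local Notation Rn := 'rV[R]_n.
Implicit Types (f g u eta : Rn -> R) (x y z e : Rn) (a b C B : R).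

Lemma differentiable_derivable f z e : differentiable f z -> derivable f z e.
Proof. exact: diff_derivable. Qed.

Lemma derive_dot f z e : differentiable f z -> 'D_e f z = dot (grad f z) e.
Proof.
move=> df; rewrite deriveE// [e in LHS]row_sum_delta linear_sum.
by apply: eq_bigr => i _; rewrite linearZ /= mxE /partial deriveE// mulrC.
Qed.

Lemma derive_le_grad f z e : differentiable f z ->
  `|'D_e f z| <= enorm (grad f z) * enorm e.
Proof. by move=> df; rewrite derive_dot//; exact: cauchy_schwarz. Qed.

Lemma dotBl x y z : dot (x - y) z = dot x z - dot y z.
Proof. by rewrite dotDl dotNl. Qed.

(** A sum of extended reals bounds each term once all terms are nonnegative. The last supremum runs
    over pairs of distinct points, whose existence takes a positive dimension. *)
Lemma C11_bounds eta : (0 < n)%N -> C11 eta ->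
  [/\ forall x, differentiable eta x,
      0 <= fine (C11_norm eta),
      forall x, `|eta x| <= fine (C11_norm eta) &
      forall x y, enorm (grad eta x - grad eta y) <=
        fine (C11_norm eta) * enorm (x - y)].
Proof.
move=> n0 [deta]; rewrite /C11_norm.
set A := ereal_sup _; set B := ereal_sup [set (enorm (grad eta x))%:E | x in setT].
set C := ereal_sup _ => ABC.
pose e0 : Rn := const_mx 1.
have e00 : e0 != 0.
  apply/eqP => /rowP /(_ (Ordinal n0)); rewrite !mxE => /eqP.
  by rewrite oner_eq0.
have A0 : (0 <= A)%E.
  apply: (@le_trans _ _ `|eta 0|%:E); first by rewrite lee_fin.
  by apply: ereal_sup_ubound; exists 0.
have B0 : (0 <= B)%E.
  apply: (@le_trans _ _ (enorm (grad eta 0))%:E); first by rewrite lee_fin enorm_ge0.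
  by apply: ereal_sup_ubound; exists 0.
have C0 : (0 <= C)%E.
  apply: (@le_trans _ _ (enorm (grad eta e0 - grad eta 0) / enorm (e0 - 0))%:E).
    by rewrite lee_fin divr_ge0 ?enorm_ge0.
  by apply: ereal_sup_ubound; exists e0, 0.
have finS : ((A + B + C)%E \is a fin_num).
  by rewrite ge0_fin_numE// !adde_ge0.
have AM : (A <= (fine (A + B + C))%:E)%E.
  by rewrite fineK// -addeA leeDl// adde_ge0.
have CM : (C <= (fine (A + B + C))%:E)%E.
  by rewrite fineK// leeDr// adde_ge0.
split => //.
- by rewrite fine_ge0// !adde_ge0.
- move=> x; rewrite -lee_fin; apply: le_trans AM.
  by apply: ereal_sup_ubound; exists x.
- move=> x y; have [->|xy] := eqVneq x y.
    by rewrite !subrr !enorm0 mulr0.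
  rewrite -ler_pdivrMr ?enorm_gt0 ?subr_eq0// -lee_fin; apply: le_trans CM.
  by apply: ereal_sup_ubound; exists x, y.
Qed.

Lemma C11_taylor eta M x y : (forall x, differentiable eta x) ->
  (forall x y, enorm (grad eta x - grad eta y) <= M * enorm (x - y)) -> 0 <= M ->
  `|eta (x + y) - eta x - dot (grad eta x) y| <= M * enorm y ^+ 2.
Proof.
move=> deta L M0.
have [] := @line_mvt R n eta x y 1 ler01 (fun s _ => differentiable_derivable (deta _)).
move=> s /andP[s0 s1]; rewrite scale1r mulr1 => ->.
rewrite derive_dot// -dotBl; apply: (le_trans (cauchy_schwarz _ _)).
rewrite expr2 mulrA ler_wpM2r ?enorm_ge0//; apply: (le_trans (L _ _)).
rewrite ler_wpM2l// addrC addKr enormZ ger0_norm//.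
by rewrite ler_piMl ?enorm_ge0.
Qed.

(** A gradient step of length [t * enorm G] with [t = 1 / (2 * M)] lowers [eta] by at least
    [enorm G ^+ 2 / (4 * M)], and [eta] must remain nonnegative. *)
Lemma C11_nonneg_grad eta M x : (forall x, differentiable eta x) ->
  (forall x y, enorm (grad eta x - grad eta y) <= M * enorm (x - y)) -> 0 < M ->
  (forall x, 0 <= eta x) -> enorm (grad eta x) ^+ 2 <= 4 * M * eta x.
Proof.
move=> deta L M0 eta0; set G := grad eta x; pose t := (2 * M)^-1.
have t0 : 0 < t by rewrite invr_gt0 mulr_gt0.
have := @C11_taylor eta M x ((- t) *: G) deta L (ltW M0).
rewrite dotZr -sqr_enorm enormZ (normrN t) (gtr0_norm t0) exprMn -/G => h.
have h2 := eta0 (x + - t *: G).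
have h3 := ler_norm (eta (x + - t *: G) - eta x - - t * enorm G ^+ 2).
have : t * enorm G ^+ 2 - M * (t ^+ 2 * enorm G ^+ 2) <= eta x by lra.
have -> : t * enorm G ^+ 2 - M * (t ^+ 2 * enorm G ^+ 2) = enorm G ^+ 2 / (4 * M).
  by rewrite /t; field; rewrite gt_eqF.
by rewrite ler_pdivrMr ?mulr_gt0// mulrC.
Qed.

End gradients.

(** * Local Hoelder classes and second differences *)

Section holder.
Variables (R : realType) (n : nat).
Local Notation Rn := 'rV[R]_n.
Implicit Types (f g u : Rn -> R) (x y z e : Rn) (a C : R).

Definition locally_holder a f := forall rho : R, exists C : R,
  forall x y, enorm x <= rho -> enorm y <= rho -> `|f x - f y| <= C * enorm (x - y) `^ a.

Lemma Ck_continuous k a f : Ck_holder_loc k a f -> continuous f.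
Proof.
by case: k => [[]//|k [df _]] z; exact: differentiable_continuous (df z).
Qed.

Lemma locally_holder_lin a c f g : locally_holder a f -> locally_holder a g ->
  locally_holder a (fun z => c * f z + g z).
Proof.
move=> hf hg rho; have [C1 H1] := hf rho; have [C2 H2] := hg rho.
exists (`|c| * C1 + C2) => x y xr yr.
have -> : c * f x + g x - (c * f y + g y) = c * (f x - f y) + (g x - g y) by ring.
rewrite (le_trans (ler_normD _ _))// normrM mulrDl lerD ?H2// -mulrA.
by rewrite ler_wpM2l// H1.
Qed.

Lemma Ck_lin k a c f g : Ck_holder_loc k a f -> Ck_holder_loc k a g ->
  Ck_holder_loc k a (fun z => c * f z + g z).
Proof.
elim: k f g => [|k IH] f g /= [cf hf] [cg hg].
  split; last exact: locally_holder_lin.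
  move=> z; apply: (@cvgD R R Rn (nbhs z)); last exact: cg.
  by apply: (@cvgM R Rn (nbhs z) _ (fun=> c)); [exact: cvg_cst|exact: cf].
split.
  move=> z; apply: (@differentiableD R Rn R (fun z => c * f z) g); last exact: cg.
  exact: (@differentiableZ R Rn R f c z (cf z)).
move=> i; rewrite (_ : partial i _ = fun z => c * partial i f z + partial i g z).
  exact: IH.
apply/funext => z; rewrite /partial.
have dcf : derivable (fun z => c * f z) z (delta_mx ord0 i).
  by apply: diff_derivable; exact: (@differentiableZ R Rn R f c z (cf z)).
rewrite (@deriveD R Rn R (fun z => c * f z) g)//; last exact: diff_derivable.
congr (_ + _); rewrite (@deriveZ R Rn R f c)//; exact: diff_derivable.
Qed.

Lemma Ck_const0 k a : Ck_holder_loc k a (fun _ : Rn => 0 : R).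
Proof.
elim: k => [|k IH] /=.
  split; first exact: cst_continuous.
  by move=> rho; exists 0 => x y _ _; rewrite subrr normr0 mul0r.
split=> [z|i]; first exact: (@differentiable_cst R Rn R 0 z).
rewrite (_ : partial i _ = fun=> 0)//.
by apply/funext => z; rewrite /partial derive_cst.
Qed.

(** The class is defined through partial derivatives, of which a directional derivative is a linear
    combination. *)
Lemma Ck_derive k a f e : Ck_holder_loc k.+1 a f -> Ck_holder_loc k a ('D_e f).
Proof.
move=> [df pf].
rewrite (_ : 'D_e f = fun z => \sum_(i < n) e ord0 i * partial i f z); last first.
  apply/funext => z; rewrite derive_dot//; apply: eq_bigr => i _.
  by rewrite mxE mulrC.
elim: (index_enum _) => [|i l IH].
  rewrite (_ : (fun _ => _) = fun=> 0); first exact: Ck_const0.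
  by apply/funext => z; rewrite big_nil.
rewrite (_ : (fun _ => _) = fun z => e ord0 i * partial i f z +
    \sum_(j <- l) e ord0 j * partial j f z).
  exact: (@Ck_lin k a (e ord0 i) (partial i f) _ (pf i) IH).
by apply/funext => z; rewrite big_cons.
Qed.

Lemma Ck_lipschitz k a f : Ck_holder_loc k.+1 a f -> locally_holder 1 f.
Proof.
move=> [df pf] rho.
have H i : exists B, 0 <= B /\ forall z, 0 <= enorm z <= rho -> `|partial i f z| <= B.
  have [B B0 HB] := @bounded_on_shell R n setT (partial i f) 0 rho
    (fun _ _ => Logic.I) (fun z _ => Ck_continuous (pf i) (x:=z)).
  by exists B.
have [B HB] := choice H.
exists (\sum_(i < n) B i) => x y xr yr; rewrite powRr1 ?enorm_ge0//.
have [] := @line_mvt R n f y (x - y) 1 ler01 (fun s _ => differentiable_derivable (df _)).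
move=> s /andP[s0 s1]; rewrite scale1r mulr1 (addrC y (x - y)) subrK => ->.
have zr : enorm (y + s *: (x - y)) <= rho.
  have -> : y + s *: (x - y) = (1 - s) *: y + s *: x.
    by rewrite scalerBr scalerBl scale1r addrCA addrC.
  apply: (le_trans (ler_enormD _ _)); rewrite !enormZ !ger0_norm ?subr_ge0//.
  have h1 : (1 - s) * enorm y <= (1 - s) * rho by rewrite ler_wpM2l// subr_ge0.
  have h2 : s * enorm x <= s * rho by rewrite ler_wpM2l.
  lra.
rewrite derive_dot// /dot (le_trans (ler_norm_sum _ _ _))// mulr_suml.
apply: ler_sum => i _; rewrite normrM mxE ler_pM//; last exact: ler_coord_enorm.
by apply: (HB i).2; rewrite enorm_ge0.
Qed.

Lemma second_difference f x a : 0 <= a -> (forall z, differentiable f z) ->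
  (forall i, locally_holder a (partial i f)) ->
  exists C, forall z, enorm z <= 1 ->
    `|f (x + z) + f (x - z) - 2 * f x| <= C * enorm z `^ (1 + a).
Proof.
move=> a0 df pf.
have [C HC] := choice (fun i => pf i (enorm x + 1)).
exists (2 `^ a * \sum_(i < n) `|C i|) => z z1.
have [] := @MVT_segment R (fun s => f (x + s *: z) + f (x + s *: (- z)))
    (fun s => 'D_z f (x + s *: z) + 'D_(- z) f (x + s *: (- z))) 0 1 ler01.
- move=> s _; apply: is_deriveD; apply: line_is_derive; exact: differentiable_derivable.
- apply: derivable_within_continuous => s _; apply: derivableD.
    by have [] := line_is_derive (@differentiable_derivable R n f _ z (df (x + s *: z))).
  by have [] := line_is_derive (@differentiable_derivable R n f _ (- z) (df (x + s *: (- z)))).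
move=> s; rewrite in_itv/= => /andP[s0 s1].
rewrite !scale1r !scale0r !addr0 subr0 mulr1 scalerN.
have -> : f x + f x = 2 * f x by ring.
move=> ->; rewrite !derive_dot// dotNr -dotBl /dot.
rewrite (le_trans (ler_norm_sum _ _ _))// powRD; last first.
  by rewrite gt_eqF// ltr_pwDl.
rewrite powRr1 ?enorm_ge0//.
rewrite (_ : _ * _ * _ = \sum_(i < n) `|C i| * (2 `^ a * enorm z `^ a) * enorm z).
  2: by rewrite mulr_sumr mulr_suml; apply: eq_bigr => i _; ring.
have sz w : enorm w = enorm z -> enorm (x + s *: w) <= enorm x + 1.
  move=> wz; rewrite (le_trans (ler_enormD _ _))// lerD2l enormZ wz ger0_norm//.
  by rewrite mulr_ile1// enorm_ge0.
have E : x + s *: z - (x - s *: z) = (2 * s) *: z.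
  by rewrite opprD opprK addrACA subrr add0r -scalerDl; congr (_ *: _); ring.
apply: ler_sum => i _; rewrite normrM !mxE.
rewrite ler_pM//; last exact: ler_coord_enorm.
have := HC i (x + s *: z) (x - s *: z) (sz _ erefl).
rewrite -scalerN => /(_ (sz _ (enormN _)))/le_trans; apply.
rewrite (le_trans (ler_wpM2r (powR_ge0 _ _) (ler_norm _)))// ler_wpM2l//.
rewrite scalerN E enormZ -powRM ?enorm_ge0// ge0_ler_powR ?nnegrE ?mulr_ge0 ?enorm_ge0//.
rewrite ler_wpM2r ?enorm_ge0// ger0_norm ?mulr_ge0//; lra.
Qed.

(** For [k = 0] the Hoelder bound on [f] itself suffices; for [k = 1] that on the gradient; for
    larger [k] the gradient is locally Lipschitz, which gives the exponent 2, above [2 * s] because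
    [s < 1]. *)
Lemma Ck_second_difference k a s f x : 0 <= a -> s < 1 ->
  Ck_holder_loc k a f -> 2 * s < k%:R + a ->
  exists C b, 2 * s < b /\ forall z, enorm z <= 1 ->
    `|f (x + z) + f (x - z) - 2 * f x| <= C * enorm z `^ b.
Proof.
move=> a0 s1; case: k => [|[|k]] fk sk.
- have [_ /(_ (enorm x + 1))[C HC]] := fk.
  exists (2 * C), a; split; first by move: sk; rewrite add0r.
  move=> z z1.
  have -> : f (x + z) + f (x - z) - 2 * f x =
    (f (x + z) - f x) + (f (x - z) - f x) by ring.
  have xz w : enorm w = enorm z -> `|f (x + w) - f x| <= C * enorm z `^ a.
    move=> wz; have := HC (x + w) x.
    have -> : x + w - x = w by rewrite addrAC subrr add0r.
    rewrite wz; apply.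
      by rewrite (le_trans (ler_enormD _ _))// lerD2l wz.
    by rewrite lerDl.
  rewrite (le_trans (ler_normD _ _))//.
  have h1 := xz z erefl; have h2 := xz (- z) (enormN z); lra.
- have [df pf] := fk.
  have [C HC] := second_difference x a0 df (fun i => (pf i).2).
  by exists C, (1 + a).
have [df pf] := fk.
have [C HC] := second_difference x ler01 df (fun i => Ck_lipschitz (pf i)).
by exists C, (1 + 1); split => //; lra.
Qed.

End holder.

(** * Kernels and cutoffs *)

Section kernels.
Variables (R : realType) (n : nat) (s lam Lam : R) (K : 'rV[R]_n -> \bar R).
Hypotheses (lam0 : 0 < lam) (hK : kernel_class s lam Lam K).
Local Notation Rn := 'rV[R]_n.
Implicit Types (x y z e : Rn).

(** [K] is finite off the origin; a value [+oo] at the origin becomes 0, which no integral below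
    sees. *)
Definition rkernel z : R := fine (K z).
Local Notation k := rkernel.

Lemma kernelE z : z != 0 -> K z = (k z)%:E.
Proof.
move=> z0; have [K0 _ Kb _ _] := hK; rewrite /rkernel fineK//.
rewrite ge0_fin_numE//; have /andP[_] := Kb z z0.
by move/le_lt_trans; apply; rewrite ltry.
Qed.

Lemma rkernel_lo z : z != 0 -> lam * enorm z `^ (- (n%:R + 2 * s)) <= k z.
Proof.
by move=> z0; have [_ _ /(_ z z0)/andP[+ _] _ _] := hK; rewrite kernelE.
Qed.

Lemma rkernel_hi z : z != 0 -> k z <= Lam * enorm z `^ (- (n%:R + 2 * s)).
Proof.
by move=> z0; have [_ _ /(_ z z0)/andP[_ +] _ _] := hK; rewrite kernelE.
Qed.

Lemma rkernel_ge0 z : 0 <= k z.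
Proof. by have [K0 _ _ _ _] := hK; exact: fine_ge0. Qed.

Lemma rkernelN z : k (- z) = k z.
Proof. by have [_ KN _ _ _] := hK; rewrite /rkernel KN. Qed.

Lemma rkernel_differentiable z : z != 0 -> differentiable k z.
Proof. by have [_ _ _ + _] := hK; apply. Qed.

Lemma open_neq0 : open [set z : Rn | z != 0].
Proof.
rewrite openE => z /= z0; apply: nbhs_enorm; exists (enorm z).
  by rewrite enorm_gt0.
by move=> y zy; apply: contraTneq zy => ->; rewrite subr0 ltxx.
Qed.

Lemma rkernel_continuous : {in [set z : Rn | z != 0], continuous k}.
Proof.
by move=> z; rewrite inE /= => z0; exact: differentiable_continuous (rkernel_differentiable z0).
Qed.

Lemma rkernel_derive z e : z != 0 -> enorm e = 1 ->
  `|'D_e k z| <= Lam / enorm z * k z.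
Proof.
move=> z0 e1; have [_ _ _ _ /(_ z z0)] := hK.
rewrite kernelE// -EFinM lee_fin; apply: le_trans.
by rewrite (le_trans (derive_le_grad e (rkernel_differentiable z0)))// e1 mulr1.
Qed.

End kernels.

(** * First-order expansions with quadratic error *)

Section quadratic_expansions.
Variables (R : realType) (n : nat).
Local Notation Rn := 'rV[R]_n.
Implicit Types (f : R -> R) (F : Rn -> R) (l t : R).

(** A form of derivability at 0 that survives composition with affine maps and with [sqpos]. It
    avoids differentiating the maximum in [sqpos] at its corner. *)
Definition quadratic_expansion f l :=
  exists C : R, forall h, `|h| <= 1 -> `|f h - f 0 - l * h| <= C * h ^+ 2.

Definition sqpos t : R := Num.max t 0 ^+ 2.

Lemma sqpos_expansion t h :
  `|sqpos (t + h) - sqpos t - 2 * Num.max t 0 * h| <= h ^+ 2.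
Proof.
rewrite /sqpos; have [t0|t0] := leP t 0; have [h0|h0] := leP (t + h) 0;
  rewrite ler_norml; apply/andP; split; nra.
Qed.

Lemma quadratic_expansion_sqpos f l : quadratic_expansion f l ->
  quadratic_expansion (fun h => sqpos (f h)) (2 * Num.max (f 0) 0 * l).
Proof.
move=> [C HC]; set m := Num.max (f 0) 0.
have m0 : 0 <= m by rewrite le_max lexx orbT.
exists ((`|l| + `|C|) ^+ 2 + 2 * m * C) => h h1.
have h2 := sqpos_expansion (f 0) (f h - f 0); rewrite (addrC (f 0)) subrK -/m in h2.
have hh : h ^+ 2 = `|h| ^+ 2 by rewrite real_normK ?num_real.
have hC := HC h h1.
have h3 : `|f h - f 0| <= (`|l| + `|C|) * `|h|.
  have -> : f h - f 0 = (f h - f 0 - l * h) + l * h by ring.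
  rewrite (le_trans (ler_normD _ _))// normrM addrC mulrDl lerD2l.
  rewrite (le_trans hC)// (le_trans (ler_wpM2r (sqr_ge0 h) (ler_norm C)))//.
  by rewrite hh ler_wpM2l// expr2 ler_piMl.
have h4 : (f h - f 0) ^+ 2 <= (`|l| + `|C|) ^+ 2 * h ^+ 2.
  rewrite hh -exprMn -(real_normK (num_real (f h - f 0))).
  by apply: lerXn2r => //; rewrite nnegrE ?mulr_ge0 ?addr_ge0.
have -> : sqpos (f h) - sqpos (f 0) - 2 * m * l * h =
  (sqpos (f h) - sqpos (f 0) - 2 * m * (f h - f 0)) + 2 * m * (f h - f 0 - l * h).
  by ring.
rewrite (le_trans (ler_normD _ _))// [leRHS]mulrDl; apply: lerD.
  exact: le_trans h2 h4.
by rewrite normrM ger0_norm ?mulr_ge0// -[leRHS]mulrA ler_wpM2l ?mulr_ge0.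
Qed.

Lemma quadratic_expansion_affine f l a b : quadratic_expansion f l ->
  quadratic_expansion (fun h => a + b * f h) (b * l).
Proof.
move=> [C HC]; exists (`|b| * C) => h /HC hC.
have -> : a + b * f h - (a + b * f 0) - b * l * h = b * (f h - f 0 - l * h) by ring.
by rewrite normrM -mulrA ler_wpM2l.
Qed.

Lemma quadratic_expansion_derive F z e l :
  quadratic_expansion (fun h => F (z + h *: e)) l ->
  is_derive z e F l.
Proof.
move=> [C HC].
suff H : (fun h => h^-1 *: ((F \o shift z) (h *: e) - F z)) @ 0^' --> l.
  by apply: DeriveDef; [apply/cvg_ex; exists l|exact: cvg_lim H].
apply/cvgrPdist_le => /= eps eps0.
have C1 : 0 < `|C| + 1 by rewrite ltr_pwDr.
rewrite near_withinE; near=> h => h0.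
have h1 : `|h| <= 1.
  by near: h; apply/nbhs_normP; exists 1 => //= y /=; rewrite sub0r normrN => /ltW.
have h2 : `|h| <= eps / (`|C| + 1).
  near: h; apply/nbhs_normP; exists (eps / (`|C| + 1)) => /=; first by rewrite divr_gt0.
  by move=> y; rewrite /= sub0r normrN => /ltW.
have := HC h h1; rewrite scale0r addr0 [h *: e + z]addrC.
set D := F (z + h *: e) - F z => hD.
have -> : l - h^-1 *: D = - (h^-1 * (D - l * h)).
  by rewrite -[h^-1 *: D]/(h^-1 * D); field.
rewrite normrN normrM normfV mulrC ler_pdivrMr ?normr_gt0//.
apply: (le_trans hD); rewrite -real_normK ?num_real// expr2 mulrA.
rewrite ler_wpM2r// (le_trans (ler_wpM2r (normr_ge0 h) (ler_norm C)))//.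
rewrite ler_pdivlMr// in h2; rewrite (le_trans _ h2)// mulrC.
by rewrite ler_wpM2l// lerDl.
Unshelve. all: by end_near. Qed.

Lemma sqpos_continuous : continuous sqpos.
Proof.
move=> t; apply/cvgrPdist_le => /= eps eps0.
pose m := Num.max t 0.
have m0 : 0 <= m by rewrite le_max lexx orbT.
near=> y.
have h1 : `|y - t| <= 1.
  rewrite distrC; near: y; apply/nbhs_normP; exists 1 => //= w /=; exact: ltW.
have h2 : `|y - t| <= eps / (1 + 2 * m).
  rewrite distrC; near: y; apply/nbhs_normP; exists (eps / (1 + 2 * m)) => /=.
    by rewrite divr_gt0// ltr_wpDr// mulr_ge0.
  by move=> w /=; exact: ltW.
have := sqpos_expansion t (y - t); rewrite (addrC t) subrK -/m => h3.
rewrite distrC.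
have -> : sqpos y - sqpos t = (sqpos y - sqpos t - 2 * m * (y - t)) + 2 * m * (y - t) by ring.
rewrite (le_trans (ler_normD _ _))// normrM (ger0_norm (mulr_ge0 _ m0))//.
rewrite ler_pdivlMr in h2; last by rewrite ltr_wpDr// mulr_ge0.
have h4 : (y - t) ^+ 2 <= `|y - t|.
  by rewrite -real_normK ?num_real// expr2 ler_piMl.
lra.
Unshelve. all: by end_near. Qed.

Lemma near0_derivable F z e (d : R) : 0 < d ->
  (forall y, enorm (z - y) < d -> F y = 0) -> enorm e = 1 -> is_derive z e F 0.
Proof.
move=> d0 Fd e1.
suff H : (fun h => h^-1 *: ((F \o shift z) (h *: e) - F z)) @ 0^' --> (0 : R).
  by apply: DeriveDef; [apply/cvg_ex; exists 0|exact: cvg_lim H].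
apply/cvgrPdist_le => /= eps eps0; rewrite near_withinE; near=> h => h0.
have hd : `|h| < d by near: h; apply/nbhs_normP; exists d => //= y /=; rewrite sub0r normrN.
rewrite !Fd ?subrr ?enorm0// ?scaler0 ?subr0 ?normr0 ?(ltW eps0)//.
have -> : z - (h *: e + z) = - (h *: e) by rewrite opprD addrCA subrr addr0.
by rewrite enormN enormZ e1 mulr1.
Unshelve. all: by end_near. Qed.

End quadratic_expansions.

(** * The squared cutoff *)

Section cutoff.
Variables (R : realType) (n : nat) (d : R).
Hypothesis d0 : 0 < d.
Local Notation Rn := 'rV[R]_n.
Implicit Types (z e : Rn).

(* The cutoff is 0 for |z| <= d / 2 and 1 for |z| >= d.  It is the square of the
   Lipschitz function [cutoff_root], so that |D cutoff| <= 11 cutoff_root / |z|: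
   this lets its derivative be absorbed by Young's inequality. *)
Definition cutoff_arg z : R := (4 * dot z z / d ^+ 2 - 1) / 3.

Definition cutoff_root z : R := Num.max (1 - sqpos (1 - cutoff_arg z)) 0.

Definition cutoff z : R := cutoff_root z ^+ 2.

Lemma sqpos_le0 (t : R) : t <= 0 -> sqpos t = 0.
Proof. by move=> t0; rewrite /sqpos max_r// expr0n. Qed.

Lemma cutoff_root_ge0 z : 0 <= cutoff_root z.
Proof. by rewrite le_max lexx orbT. Qed.

Lemma cutoff_root_le1 z : cutoff_root z <= 1.
Proof. by rewrite ge_max ler01 andbT gerBl sqr_ge0. Qed.

Lemma cutoff_arg_ge1 z : d <= enorm z -> 1 <= cutoff_arg z.
Proof.
move=> dz; rewrite /cutoff_arg -sqr_enorm ler_pdivlMr// mul1r lerBrDr.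
rewrite ler_pdivlMr ?exprn_gt0//.
have : d ^+ 2 <= enorm z ^+ 2 by rewrite lerXn2r ?nnegrE ?enorm_ge0// ltW.
lra.
Qed.

Lemma cutoff_root1 z : d <= enorm z -> cutoff_root z = 1.
Proof.
move=> /cutoff_arg_ge1 h; rewrite /cutoff_root sqpos_le0; last lra.
by rewrite subr0 max_l.
Qed.

Lemma cutoff_root0 z : enorm z <= d / 2 -> cutoff_root z = 0.
Proof.
move=> zd; rewrite /cutoff_root max_r//.
have : cutoff_arg z <= 0.
  rewrite /cutoff_arg -sqr_enorm ler_pdivrMr// mul0r subr_le0 ler_pdivrMr ?exprn_gt0//.
  have : enorm z ^+ 2 <= (d / 2) ^+ 2.
    by rewrite lerXn2r ?nnegrE ?enorm_ge0// divr_ge0// ltW.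
  lra.
rewrite /sqpos => h; rewrite max_l; last lra.
rewrite subr_le0 -[leLHS](expr1n _ 2) lerXn2r ?nnegrE//; lra.
Qed.

Lemma cutoff_ge0 z : 0 <= cutoff z. Proof. exact: sqr_ge0. Qed.

Lemma cutoff_le1 z : cutoff z <= 1.
Proof. by rewrite exprn_ile1 ?cutoff_root_ge0 ?cutoff_root_le1. Qed.

Lemma cutoff1 z : d <= enorm z -> cutoff z = 1.
Proof. by move=> /cutoff_root1 h; rewrite /cutoff h expr1n. Qed.

Lemma cutoff0 z : enorm z <= d / 2 -> cutoff z = 0.
Proof. by move=> /cutoff_root0 h; rewrite /cutoff h expr0n. Qed.

Lemma cutoffN z : cutoff (- z) = cutoff z.
Proof. by rewrite /cutoff /cutoff_root /cutoff_arg dotNl dotNr opprK. Qed.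

(** The root has a corner where it reaches 0, which squaring removes; at the outer radius the inner
    [sqpos] already makes the slope vanish. Both operations are [sqpos] after an affine map, which
    is how [cutoff] gets differentiated. *)
Lemma cutoffE z : cutoff z = sqpos (1 - sqpos (1 - cutoff_arg z)).
Proof. by []. Qed.

Lemma dot_continuous : continuous (fun z => dot z z).
Proof.
move=> z; rewrite (_ : (fun z => _) = fun z => enorm z * enorm z).
  by apply: (@cvgM R Rn (nbhs z)); exact: enorm_continuous.
by apply/funext => y; rewrite -sqr_enorm expr2.
Qed.

Lemma cutoff_continuous : continuous cutoff.
Proof.
move=> z; rewrite (_ : cutoff = @sqpos R \o (fun t => 1 - sqpos (1 - t)) \o cutoff_arg)//.
apply: (@continuous_comp _ _ _ cutoff_arg (@sqpos R \o (fun t => 1 - sqpos (1 - t)))).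
  apply: (@cvgM R Rn (nbhs z)); last exact: cvg_cst.
  apply: (@cvgB R R Rn (nbhs z)); last exact: cvg_cst.
  apply: (@cvgM R Rn (nbhs z)); last exact: cvg_cst.
  apply: (@cvgM R Rn (nbhs z)); first exact: cvg_cst.
  exact: dot_continuous.
have c1 (g : R -> R) : continuous g -> continuous (fun t => 1 - g t).
  by move=> cg t; apply: cvgB; [exact: cvg_cst|exact: cg].
have c2 : continuous (fun t : R => sqpos (1 - t)).
  move=> t; apply: (@continuous_comp R R R (fun t => 1 - t) (@sqpos R)); last exact: sqpos_continuous.
  by apply: c1 => y; exact: cvg_id.
apply: (@continuous_comp R R R (fun t => 1 - sqpos (1 - t)) (@sqpos R)); last exact: sqpos_continuous.
exact: c1.
Qed.

Lemma cutoff_is_derive z e : is_derive z e cutoff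
  (2 * cutoff_root z * (- 1 * (2 * Num.max (1 - cutoff_arg z) 0 *
    (- 1 * (8 / (3 * d ^+ 2) * dot z e))))).
Proof.
apply: quadratic_expansion_derive.
have E0 : z + 0 *: e = z by rewrite scale0r addr0.
have h1 : quadratic_expansion (fun h => cutoff_arg (z + h *: e))
    (8 / (3 * d ^+ 2) * dot z e).
  exists (4 / (3 * d ^+ 2) * dot e e) => h _.
  rewrite E0 /cutoff_arg dotDl !dotDr !dotZl !dotZr (dotC e z).
  have dn : d != 0 by rewrite gt_eqF.
  set X := dot z e; set Y := dot e e; set Z := dot z z.
  rewrite (_ : _ - _ * h = 4 / (3 * d ^+ 2) * Y * h ^+ 2); last by field.
  rewrite ger0_norm// mulr_ge0 ?sqr_ge0// mulr_ge0 ?dot_ge0//.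
  by rewrite divr_ge0// mulr_ge0// sqr_ge0.
have h2 := quadratic_expansion_sqpos (quadratic_expansion_affine 1 (-1) h1).
have := quadratic_expansion_sqpos (quadratic_expansion_affine 1 (-1) h2).
rewrite /= !E0 !mulN1r.
rewrite (_ : (fun h => _) = fun h => cutoff (z + h *: e)) ?mulN1r//.
by apply/funext => h; rewrite cutoffE !mulN1r.
Qed.

Lemma cutoff_derive_le z e : enorm e = 1 ->
  `|'D_e cutoff z| * enorm z <= 11 * cutoff_root z.
Proof.
move=> e1; have /@derive_val -> := cutoff_is_derive z e.
set w := cutoff_root z; have w0 : 0 <= w by exact: cutoff_root_ge0.
have d20 : 0 < d ^+ 2 by rewrite exprn_gt0.
have [zd|zd] := leP d (enorm z).
  have := cutoff_arg_ge1 zd => h.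
  by rewrite (max_r (y := 0)) ?mulr0 ?mul0r ?mulr0 ?normr0 ?mul0r ?mulr_ge0//; lra.
have [t0|t0] := leP 0 (cutoff_arg z); last first.
  have -> : w = 0.
    rewrite /w /cutoff_root max_r// /sqpos max_l; last lra.
    rewrite subr_le0 -[leLHS](expr1n _ 2) lerXn2r ?nnegrE//; lra.
  by rewrite !(mulr0, mul0r) normr0 mul0r.
rewrite max_l; last first.
  rewrite subr_ge0 /cutoff_arg -sqr_enorm ler_pdivrMr// mul1r lerBlDr ler_pdivrMr//.
  have : enorm z ^+ 2 <= d ^+ 2 by rewrite lerXn2r ?nnegrE ?enorm_ge0// ltW.
  lra.
set t := cutoff_arg z; rewrite -/t in t0.
have zz : enorm z * enorm z <= d ^+ 2.
  by rewrite -expr2 lerXn2r ?nnegrE ?enorm_ge0// ltW.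
have ze : `|dot z e| <= enorm z by rewrite (le_trans (cauchy_schwarz _ _))// e1 mulr1.
have t1 : t <= 1.
  rewrite /t /cutoff_arg -sqr_enorm ler_pdivrMr// mul1r lerBlDr ler_pdivrMr//.
  by rewrite expr2; lra.
(* The numerical factor is [2 * 2 * 8 / 3 = 32 / 3], which the conclusion rounds up to 11. *)
have -> : 2 * w * (-1 * (2 * (1 - t) * (-1 * (8 / (3 * d ^+ 2) * dot z e)))) =
    (w * (1 - t) * (32 / 3)) * (dot z e / d ^+ 2).
  by field; rewrite gt_eqF.
rewrite normrM ger0_norm; last by rewrite !mulr_ge0// subr_ge0.
rewrite normrM normfV (gtr0_norm d20).
have h1 : `|dot z e| / d ^+ 2 * enorm z <= 1.
  rewrite mulrAC ler_pdivrMr// mul1r (le_trans _ zz)//.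
  by rewrite ler_wpM2r ?enorm_ge0.
have X0 : 0 <= w * (1 - t) * (32 / 3) by rewrite !mulr_ge0// subr_ge0.
rewrite -[X in X <= _]mulrA; apply: (le_trans (ler_wpM2l X0 h1)).
rewrite mulr1.
have : w * (1 - t) <= w * 1 by rewrite ler_wpM2l//; lra.
lra.
Qed.

End cutoff.

(** * Convergence of the principal values *)

Lemma ishell_ball (R : realType) n (i : interval R) (f : 'rV[R]_n -> R) (b : R) :
  (forall x, x \in i -> x <= b) -> continuous f -> ishell i f.
Proof.
move=> ib cf.
have [B B0 HB] := @bounded_on_shell R n setT f 0 b (fun _ _ => Logic.I) (fun z _ => cf z).
apply: (@ishell_bounded _ _ _ _ B (b + 1)).
- by move=> x /ib xb; lra.
- by apply: measurable_funTS; exact: measurable_fun_vecT.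
- by move=> z /ib zb; rewrite HB// enorm_ge0.
Qed.

Lemma ishell_punctured (R : realType) n (i : interval R) (f : 'rV[R]_n -> R) (a b : R) :
  0 < a -> {subset i <= `[a, b]} ->
  {in [set z : 'rV[R]_n | z != 0], continuous f} -> ishell i f.
Proof.
move=> a0 iab cf; apply: (ishell_continuous (@open_neq0 R n) iab _ cf) => z /andP[az _] /=.
by rewrite -enorm_gt0 (lt_le_trans a0).
Qed.

Lemma derive_reflect (R : realType) n (u : 'rV[R]_n -> R) (x z e : 'rV[R]_n) :
  differentiable u (x - z) ->
  is_derive z e (fun z => u (x - z)) (- 'D_e u (x - z)).
Proof.
move=> du.
have dg : is_diff z (fun z : 'rV[R]_n => x - z) (fun h => - h).
  have := is_diffB (is_diff_cst x z) (is_diff_id z).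
  by rewrite (_ : 0 - _ = fun h => - h)//; apply/funext => h; rewrite /= sub0r.
have dgz : differentiable (fun z : 'rV[R]_n => x - z) z by exact: ex_diff.
have h1 := differentiable_comp dgz du.
split; first exact: (@differentiable_derivable R n _ z e h1).
rewrite deriveE//; have -> : 'd (fun z => u (x - z)) z = 'd u (x - z) \o 'd (fun z : 'rV[R]_n => x - z) z :> (_ -> _).
  exact: (diff_comp dgz du).
by rewrite /= diff_val linearN deriveE.
Qed.

Section kernel_integrals.
Variables (R : realType) (n : nat) (s lam Lam : R) (K : 'rV[R]_n -> \bar R).
Hypotheses (n0 : (0 < n)%N) (s0 : 0 < s) (s1 : s < 1) (lam0 : 0 < lam)
  (lamLam : lam <= Lam) (hK : kernel_class s lam Lam K).
Local Notation Rn := 'rV[R]_n.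
Local Notation k := (rkernel K).
Implicit Types (x y z e : Rn) (f : Rn -> R).

Let Lam0 : 0 < Lam. Proof. exact: lt_le_trans lamLam. Qed.

Lemma enorm_neq0 z (a : R) : 0 <= a -> a < enorm z -> z != 0.
Proof. by move=> a0 az; rewrite -enorm_gt0 (le_lt_trans a0). Qed.

(** The substitution [z = x - y] centres the annulus at the origin. Away from the origin the
    integrand is continuous, so the truncated integral is finite and one may compute with reals. *)
Lemma integral_annulus f x (r rho : R) : continuous f -> 0 < r ->
  (\int[leb R n]_(t in annulus x r rho) ((f x - f (vec t))%:E * K (x - vec t)%R))%E
  = (Ish `]r, rho[ (fun z => (f x - f (x - z)) * k z))%:E.
Proof.
move=> cf r0; set F := fun z => (f x - f (x - z)) * k z.
have cF : {in [set z : Rn | z != 0], continuous F}.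
  move=> z z0; apply: (@cvgM R Rn (nbhs z)); last exact: rkernel_continuous hK _ z0.
  apply: (@cvgB R R Rn (nbhs z)); first exact: cvg_cst.
  apply: (@continuous_comp _ _ _ (fun z => x - z) f); last exact: cf.
  by apply: (@cvgB R Rn Rn (nbhs z)); [exact: cvg_cst|exact: cvg_id].
have iF : ishell `]r, rho[ F.
  apply: (ishell_punctured (b := rho) r0 _ cF) => y; rewrite !in_itv/= => /andP[ry yrho].
  by rewrite !ltW.
have mF : measurable_fun (@vec R n @^-1` [set z | enorm z \in `]r, rho[])
   (fun t => (F (vec t))%:E) by case/integrableP : iF.
have := @integral_isometry R n (-1) x [set z | enorm z \in `]r, rho[]
  (fun z => (F z)%:E) (normrN1 R) (@measurable_shell R n _) mF.
rewrite /Ish /Rintegral fineK; last exact: (integrable_fin_num (@measurable_shell R n _) iF).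
move=> <-.
rewrite (_ : [set t | _] = annulus x r rho); last first.
  by apply/seteqP; split => t /=; rewrite /annulus /= scaleN1r addrC in_itv.
apply: eq_integral => t; rewrite inE /annulus /= => /andP[rt _].
rewrite scaleN1r [- _ + x]addrC (kernelE hK (enorm_neq0 (ltW r0) rt)) -EFinM.
by rewrite /F (_ : x - (x - vec t) = vec t)// opprB addrC subrK.
Qed.

(** The inner limits [g r] are extended reals because those of the left-hand side of the theorem may
    be [-oo]. The outer limit only sees small [r]. *)
Lemma pv_op_cvg f x (r0 : R) (g : R -> \bar R) (l : \bar R) : continuous f -> 0 < r0 ->
  (forall r, 0 < r -> r < r0 ->
    (Ish `]r, rho[ (fun z => (f x - f (x - z)) * k z))%:E @[rho --> +oo] --> g r) ->
  g r @[r --> 0^'+] --> l -> pv_op K f x = l.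
Proof.
move=> cf r00 H gl; rewrite /pv_op; apply: cvg_lim => //.
apply: cvg_trans gl; apply: near_eq_cvg; near=> r; symmetry; apply: cvg_lim => //.
have r_gt0 : 0 < r by near: r; exact: nbhs_right_gt.
under eq_fun do rewrite integral_annulus//.
by apply: H => //; near: r; exact: nbhs_right_lt.
Unshelve. all: by end_near. Qed.

Section symmetric_integral.
Variable F : Rn -> R.
Hypothesis cF : {in [set z : Rn | z != 0], continuous F}.

Lemma ishell_annulus (i : interval R) (a b : R) : 0 < a -> {subset i <= `[a, b]} ->
  ishell i F.
Proof. by move=> a0 iab; exact: ishell_punctured iab cF. Qed.

Lemma Ish_split_far (r rho rho' : R) : 0 < r -> r < rho -> rho <= rho' ->
  Ish `]r, rho'[ F = Ish `]r, rho[ F + Ish `[rho, rho'[ F.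
Proof.
move=> r_gt0 rrho rr; apply: Ish_split.
- by move=> y; rewrite !in_itv/= => /andP[-> y1]/=; lra.
- by move=> y; rewrite !in_itv/= => /andP[y1 ->]; rewrite andbT; lra.
- by move=> y; rewrite !in_itv/= => /andP[-> ->]; rewrite andbT/=; have [] := ltP y rho.
- by move=> y; rewrite !in_itv/= => /andP[_ y1] /andP[y2 _]; lra.
- apply: (ishell_annulus r_gt0 (b := rho')) => y; rewrite !in_itv/= => /andP[y1 y2].
  by rewrite !ltW.
Qed.

Lemma Ish_split_near (r r' rho : R) : 0 < r' -> r' <= r -> r < rho ->
  Ish `]r', rho[ F = Ish `]r', r] F + Ish `]r, rho[ F.
Proof.
move=> r_gt0 rrho rr; apply: Ish_split.
- by move=> y; rewrite !in_itv/= => /andP[-> y1]/=; lra.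
- by move=> y; rewrite !in_itv/= => /andP[y1 ->]; rewrite andbT; lra.
- by move=> y; rewrite !in_itv/= => /andP[-> ->]; rewrite andbT/=; have [] := leP y r.
- by move=> y; rewrite !in_itv/= => /andP[_ y1] /andP[y2 _]; lra.
- apply: (ishell_annulus r_gt0 (b := rho)) => y; rewrite !in_itv/= => /andP[y1 y2].
  by rewrite !ltW.
Qed.

(** The Cauchy criterion twice: the tail at infinity gives the inner limit [J r], and [J r' - J r]
    is the integral over the shell between [r'] and [r], whatever the tail is. *)
Lemma Ish_cvg :
  (forall e : R, 0 < e -> exists2 r, 0 < r <= 1 & forall r', 0 < r' -> r' <= r ->
     `|Ish `]r', r] F| < e) ->
  (forall e : R, 0 < e -> exists2 rho, 1 < rho & forall rho', rho <= rho' ->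
     `|Ish `[rho, rho'[ F| < e) ->
  exists (J : R -> R) (l : R),
    (forall r, 0 < r -> r < 1 -> Ish `]r, rho[ F @[rho --> +oo] --> J r) /\
    J r @[r --> 0^'+] --> l.
Proof.
move=> near0 far.
have cv r : 0 < r -> r <= 1 -> cvg (Ish `]r, rho[ F @[rho --> +oo]).
  move=> r_gt0 r1; apply: cvg_pinfty_cauchy => e e0.
  have [rho rho1 H] := far e e0; exists rho => rho' rr.
  rewrite (@Ish_split_far r rho rho')//; last exact: le_lt_trans rho1.
  by rewrite opprD addrA subrr add0r normrN H.
pose J r : R := lim (Ish `]r, rho[ F @[rho --> +oo]).
have JE r' r : 0 < r' -> r' <= r -> r <= 1 -> J r' = Ish `]r', r] F + J r.
  move=> r'0 rr r1; have r_gt0 := lt_le_trans r'0 rr.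
  apply: cvg_lim => //.
  apply: (@cvg_trans _ (Ish `]r', r] F + Ish `]r, rho[ F @[rho --> +oo])).
    apply: near_eq_cvg; near=> rho; symmetry; apply: Ish_split_near => //.
    near: rho; apply: nbhs_pinfty_gt; exact: num_real.
  by apply: cvgD; [exact: cvg_cst|exact: cv].
have Jcv : cvg (J r @[r --> 0^'+]).
  apply: cvg_at_right_cauchy => e e0; have [r /andP[r_gt0 r1] H] := near0 e e0.
  exists r => // r' r'0 rr; rewrite (JE r' r)// opprD addrCA subrr addr0 normrN.
  exact: H.
exists J, (lim (J r @[r --> 0^'+])); split => // r r_gt0 r1.
by apply: cv => //; exact: ltW.
Unshelve. all: by end_near. Qed.

End symmetric_integral.

Lemma continuous_reflect f x : continuous f -> continuous (fun z => f (x - z)).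
Proof.
move=> cf z; apply: (@continuous_comp _ _ _ (fun z => x - z) f); last exact: cf.
by apply: (@cvgB R Rn Rn (nbhs z)); [exact: cvg_cst|exact: cvg_id].
Qed.

Lemma continuous_increment f x : continuous f ->
  {in [set z : Rn | z != 0], continuous (fun z => (f x - f (x - z)) * k z)}.
Proof.
move=> cf z z0; apply: (@cvgM R Rn (nbhs z)); last exact: rkernel_continuous hK _ z0.
apply: (@cvgB R R Rn (nbhs z)); first exact: cvg_cst.
exact: continuous_reflect.
Qed.

Lemma rkernel_hi_q z (q : R) : z != 0 ->
  enorm z `^ q * k z <= Lam * enorm z `^ (q - 2 * s - n%:R).
Proof.
move=> z0; rewrite (le_trans (ler_wpM2l (powR_ge0 _ _) (rkernel_hi hK z0)))//.
rewrite mulrCA -powRD; last by rewrite enorm_eq0 (negbTE z0) implybT.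
by rewrite opprD addrA addrAC.
Qed.

Lemma near_increment f x (C b : R) : continuous f -> 2 * s < b ->
  (forall z, enorm z <= 1 -> `|f (x + z) + f (x - z) - 2 * f x| <= C * enorm z `^ b) ->
  forall e : R, 0 < e -> exists2 r, 0 < r <= 1 & forall r', 0 < r' -> r' <= r ->
     `|Ish `]r', r] (fun z => (f x - f (x - z)) * k z)| < e.
Proof.
move=> cf sb HC e e0; set F := fun z => (f x - f (x - z)) * k z.
have cF := @continuous_increment f x cf; rewrite -/F in cF.
have q0 : 0 < b - 2 * s by rewrite subr_gt0.
have [r r_gt0 H] := powR_small (`|C| * Lam * dyadic_const n (b - 2 * s)) q0 e0.
exists (Num.min r 1); first by rewrite lt_min r_gt0 ltr01/= ge_min lexx orbT.
set rr := Num.min r 1 => r' r'0 r'r.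
have rr1 : rr <= 1 by rewrite ge_min lexx orbT.
have rr0 : 0 < rr by rewrite lt_min r_gt0 ltr01.
have sub (c d : R) : r' <= c -> {subset `]c, d] <= `[r', d]}.
  by move=> rc y; rewrite !in_itv/= => /andP[y1 ->]; rewrite andbT; lra.
have cFN : {in [set z : Rn | z != 0], continuous (fun z => F (- z))}.
  move=> z; rewrite inE /= => z0; apply: (@continuous_comp _ _ _ (fun z => - z) F).
    exact: opp_continuous.
  by apply: cF; rewrite inE /= oppr_eq0.
have iF c d : r' <= c -> ishell `]c, d] F.
  by move=> rc; exact: (ishell_annulus cF r'0 (sub _ _ rc)).
have iFN c d : r' <= c -> ishell `]c, d] (fun z => F (- z)).
  by move=> rc; exact: (ishell_annulus cFN r'0 (sub _ _ rc)).
have E : Ish `]r', rr] F = 2^-1 * Ish `]r', rr] (fun z => F z + F (- z)).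
  rewrite IshD; [|exact: iF|exact: iFN].
  rewrite Ish_opp; first by field.
  by apply/measurable_EFinP; case/integrableP : (iF r' rr (lexx _)).
have q1 : `|Ish `]r', rr] (fun z => F z + F (- z))| <=
    `|C| * Lam * (dyadic_const n (b - 2 * s) * rr `^ (b - 2 * s)).
  apply: Ish_near_bound => //; first by rewrite mulr_ge0// ltW.
    by move=> c d rc dr; apply: ishellD; [exact: iF|exact: iFN].
  move=> z /andP[r'z zr].
  have z0 := enorm_neq0 (ltW r'0) r'z.
  rewrite /F (rkernelN hK) -mulrDl normrM (ger0_norm (rkernel_ge0 hK _)) opprK.
  have -> : f x - f (x - z) + (f x - f (x + z)) = - (f (x + z) + f (x - z) - 2 * f x) by ring.
  rewrite normrN; have := HC z (le_trans zr rr1) => h.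
  rewrite (le_trans (ler_wpM2r (rkernel_ge0 hK _) h))//.
  rewrite -!mulrA (le_trans (ler_wpM2r _ (ler_norm C)))//.
    by rewrite mulr_ge0 ?powR_ge0 ?(rkernel_ge0 hK).
  by rewrite ler_wpM2l// rkernel_hi_q.
have h1 := H rr rr0; rewrite ge_min lexx/= in h1; have {}h1 := h1 isT.
rewrite mulrA in q1; rewrite E normrM ger0_norm ?invr_ge0//.
have := normr_ge0 (Ish `]r', rr] (fun z => F z + F (- z))).
lra.
Qed.

Lemma far_bounded (G : Rn -> R) (B q : R) : 0 < q -> 0 <= B ->
  (forall c d, 1 <= c -> ishell `[c, d[ G) ->
  (forall z, 1 <= enorm z -> `|G z| <= B * enorm z `^ (- q - n%:R)) ->
  forall e : R, 0 < e -> exists2 rho0, 1 < rho0 & forall rho rho', rho0 <= rho -> rho <= rho' ->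
     `|Ish `[rho, rho'[ G| < e.
Proof.
move=> q0 B0 iG GB e e0.
have [r0 r00 H] := powRN_small (B * dyadic_const n q) q0 e0.
exists (r0 + 1); first by rewrite ltrDr.
move=> rho rho' r0rho rr.
have rho1 : 1 <= rho by rewrite (le_trans _ r0rho)// lerDr ltW.
apply: le_lt_trans (H rho _); last by rewrite (le_trans _ r0rho)// lerDl.
rewrite -mulrA; apply: Ish_far_bound => //.
- exact: lt_le_trans rho1.
- by move=> c d c1 _; apply: iG; exact: le_trans c1.
- by move=> z /andP[z1 _]; apply: GB; exact: le_trans z1.
Qed.

End kernel_integrals.

(** * Integration by parts against the truncated kernel *)

Section cutoff_kernel.
Variables (R : realType) (n : nat) (s lam Lam : R) (K : 'rV[R]_n -> \bar R).
Hypotheses (n0 : (0 < n)%N) (s0 : 0 < s) (s1 : s < 1) (lam0 : 0 < lam)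
  (lamLam : lam <= Lam) (hK : kernel_class s lam Lam K).
Local Notation Rn := 'rV[R]_n.
Local Notation k := (rkernel K).
Local Notation vol := (unit_ball_vol R n).
Variables (d : R) (e : Rn).
Hypotheses (d0 : 0 < d) (e1 : enorm e = 1).
Implicit Types (x y z : Rn).

Let Lam0 : 0 < Lam. Proof. exact: lt_le_trans lamLam. Qed.

(** Vanishing near the origin, it is continuous and derivable along [e] on the whole space, so that
    integration by parts on a ball has no inner boundary. *)
Definition cutoff_kernel z : R := cutoff d z * k z.
Local Notation kappa := cutoff_kernel.

Lemma cutoff_kernel0 z : enorm z <= d / 2 -> kappa z = 0.
Proof. by move=> zd; rewrite /cutoff_kernel (cutoff0 d0 zd) mul0r. Qed.

Lemma cutoff_kernel1 z : d <= enorm z -> kappa z = k z.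
Proof. by move=> zd; rewrite /cutoff_kernel (cutoff1 d0 zd) mul1r. Qed.

Lemma cutoff_kernel_ge0 z : 0 <= kappa z.
Proof. by rewrite mulr_ge0 ?(rkernel_ge0 hK) ?cutoff_ge0. Qed.

Lemma cutoff_kernel_le z : kappa z <= k z.
Proof. by rewrite ler_piMl ?(rkernel_ge0 hK) ?cutoff_le1. Qed.

Let near0_le z : enorm z < d / 2 -> forall y, enorm (z - y) < d / 2 - enorm z ->
  kappa y = 0.
Proof.
move=> zd y zy; apply: cutoff_kernel0.
have := ler_enormB y z; rewrite enormB; lra.
Qed.

Lemma cutoff_kernel_continuous : continuous kappa.
Proof.
move=> z; have [->|z0] := eqVneq z 0.
  have h := near0_le (z := 0); rewrite enorm0 subr0 in h.
  have d2 : 0 < d / 2 by rewrite divr_gt0.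
  have k0 : kappa 0 = 0 by apply: cutoff_kernel0; rewrite enorm0 ltW.
  rewrite /continuous_at k0; apply: (@cvg_near_cst _ _ (0 : R) kappa (nbhs (0 : Rn))).
  by apply: nbhs_enorm; exists (d / 2) => // y; exact: h.
apply: (@cvgM R Rn (nbhs z)); first exact: cutoff_continuous.
by apply: (rkernel_continuous hK); rewrite inE.
Qed.

Lemma cutoff_kernel_derivable z : derivable kappa z e.
Proof.
have [->|z0] := eqVneq z 0.
  have h := near0_le (z := 0); rewrite enorm0 subr0 in h.
  have d2 : 0 < d / 2 by rewrite divr_gt0.
  by have [] := near0_derivable d2 (h d2) e1.
apply: (@derivableM R Rn (cutoff d) k); first by have [] := cutoff_is_derive d0 z e.
exact: (@differentiable_derivable R n _ z e (rkernel_differentiable hK z0)).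
Qed.

(** Product rule: the derivative of the cutoff contributes 11 and that of the kernel [Lam]. One
    factor [cutoff_root] is given away in the kernel term so that both carry the same weight. *)
Lemma cutoff_kernel_derive_le z : z != 0 ->
  `|'D_e kappa z| * enorm z <= (11 + Lam) * cutoff_root d z * k z.
Proof.
move=> z0.
have d1 : derivable (cutoff d) z e by have [] := cutoff_is_derive d0 z e.
have d2 : derivable k z e.
  exact: (@differentiable_derivable R n _ z e (rkernel_differentiable hK z0)).
have -> : 'D_e kappa z = cutoff d z * 'D_e k z + k z * 'D_e (cutoff d) z.
  exact: (@deriveM R Rn (cutoff d) k z e d1 d2).
have h1 := cutoff_derive_le d0 z e1.
have h2 := rkernel_derive hK z0 e1.
have zp : 0 < enorm z by rewrite enorm_gt0.
have k0 := rkernel_ge0 hK z.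
have w0 := cutoff_root_ge0 d z; have w1 := cutoff_root_le1 d z.
rewrite mulrAC ler_pdivlMr// in h2.
rewrite (le_trans (ler_wpM2r (ltW zp) (ler_normD _ _)))// mulrDl.
rewrite (normrM (cutoff d z)) (normrM (k z)) (ger0_norm k0) (ger0_norm (cutoff_ge0 _ _)).
have h3 : cutoff d z * `|'D_e k z| * enorm z <= Lam * cutoff_root d z * k z.
  rewrite -mulrA (le_trans (ler_wpM2l (cutoff_ge0 _ _) h2))//.
  rewrite [leRHS]mulrAC mulrC ler_wpM2l ?mulr_ge0 ?(ltW Lam0)//.
  by rewrite /cutoff expr2 ler_piMl.
have h4 : k z * `|'D_e (cutoff d) z| * enorm z <= 11 * cutoff_root d z * k z.
  by rewrite -mulrA [leRHS]mulrC ler_wpM2l.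
by rewrite (le_trans (lerD h3 h4))// -!mulrDl addrC.
Qed.

Lemma rkernel_hi_far z (a : R) : 0 < a -> a <= enorm z ->
  k z <= Lam * a `^ (- (n%:R + 2 * s)).
Proof.
move=> a0 az; have z0 : z != 0 by rewrite -enorm_gt0 (lt_le_trans a0).
rewrite (le_trans (rkernel_hi hK z0))// ler_wpM2l ?(ltW Lam0)//.
rewrite !(powRN _ (n%:R + 2 * s)) lef_pV2 ?posrE ?powR_gt0 ?(lt_le_trans a0)//.
rewrite ge0_ler_powR ?nnegrE ?enorm_ge0 ?(ltW a0)//.
by rewrite addr_ge0// mulr_ge0// ltW.
Qed.

Lemma cutoff_kernel_derive0 z : enorm z <= d / 2 -> 'D_e kappa z = 0.
Proof.
move=> zd; have [->|z0] := eqVneq z 0.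
  have h := near0_le (z := 0); rewrite enorm0 subr0 in h.
  have d2 : 0 < d / 2 by rewrite divr_gt0.
  by have [] := near0_derivable d2 (h d2) e1.
have := cutoff_kernel_derive_le z0; rewrite (cutoff_root0 d0 zd) mulr0 mul0r.
rewrite pmulr_lle0 ?enorm_gt0// normr_le0 => /eqP //.
Qed.

Lemma cutoff_kernel_derive_bounded : exists2 B, 0 <= B & forall z, `|'D_e kappa z| <= B.
Proof.
have d2 : 0 < d / 2 by rewrite divr_gt0.
have A0 : 0 <= 11 + Lam by rewrite addr_ge0// ltW.
have P0 : 0 <= Lam * (d / 2) `^ (- (n%:R + 2 * s)) by rewrite mulr_ge0 ?powR_ge0 ?ltW.
exists ((11 + Lam) * (Lam * (d / 2) `^ (- (n%:R + 2 * s))) / (d / 2)).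
  by rewrite divr_ge0 ?(ltW d2)// mulr_ge0.
move=> z; have [zd|zd] := leP (enorm z) (d / 2).
  by rewrite cutoff_kernel_derive0// normr0 divr_ge0 ?(ltW d2)// mulr_ge0.
have z0 := enorm_neq0 (ltW d2) zd.
rewrite ler_pdivlMr// (le_trans (ler_wpM2l (normr_ge0 _) (ltW zd)))//.
rewrite (le_trans (cutoff_kernel_derive_le z0))// ler_pM ?(rkernel_ge0 hK)//.
- by rewrite mulr_ge0// cutoff_root_ge0.
- by rewrite ler_piMr// cutoff_root_le1.
- by rewrite rkernel_hi_far// ltW.
Qed.

Section parts.
Variables (u : Rn -> R) (x : Rn) (N : R).
Hypotheses (du : forall z, differentiable u z) (cv : continuous ('D_e u))
  (uN : forall z, `|u z| <= N).

Let W z : R := u (x - z) - u x.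
Let V z : R := 'D_e u (x - z).
Let H z : R := kappa z * W z.

Let cu : continuous u.
Proof. by move=> z; exact: differentiable_continuous (du z). Qed.

Let N0 : 0 <= N. Proof. exact: le_trans (uN 0). Qed.

Let W_le z : `|W z| <= 2 * N.
Proof.
rewrite (le_trans (ler_normB _ _))//; have := uN (x - z); have := uN x; lra.
Qed.

Let W_continuous : continuous W.
Proof.
move=> z; apply: (@cvgB R R Rn (nbhs z)); last exact: cvg_cst.
exact: (@continuous_reflect R n u x cu z).
Qed.

Let V_continuous : continuous V.
Proof. exact: (@continuous_reflect R n _ x cv). Qed.

Let H_continuous : continuous H.
Proof.
by move=> z; apply: (@cvgM R Rn (nbhs z)); [exact: cutoff_kernel_continuous|exact: W_continuous].
Qed.

Let W_derive z : is_derive z e W (- V z).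
Proof.
have := derive_reflect e (du (x - z)) => h.
have := @is_deriveB R Rn R (fun z => u (x - z)) (fun=> u x) z e _ _ h (is_derive_cst (u x) z e).
by rewrite subr0.
Qed.

Let H_derivable z : derivable H z e.
Proof.
apply: (@derivableM R Rn kappa W); first exact: cutoff_kernel_derivable.
by have [] := W_derive z.
Qed.

Let H_derive z : 'D_e H z = 'D_e kappa z * W z - kappa z * V z.
Proof.
have dW : derivable W z e by have [] := W_derive z.
have -> : 'D_e H z = kappa z * 'D_e W z + W z * 'D_e kappa z.
  exact: (@deriveM R Rn kappa W z e (@cutoff_kernel_derivable z) dW).
by have /@derive_val -> := W_derive z; ring.
Qed.

Let ball_le (rho y : R) : y \in `]-oo, rho[ -> y <= rho.
Proof. by rewrite in_itv/= => /ltW. Qed.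

Lemma ishell_kappaV (rho : R) :
  ishell `]-oo, rho[ (fun z => kappa z * 'D_e u (x - z)).
Proof.
apply: (ishell_ball (@ball_le rho)) => z.
by apply: (@cvgM R Rn (nbhs z)); [exact: cutoff_kernel_continuous|exact: V_continuous].
Qed.

Lemma ishell_DkappaW (rho : R) :
  ishell `]-oo, rho[ (fun z => 'D_e kappa z * (u (x - z) - u x)).
Proof.
have [B B0 HB] := cutoff_kernel_derive_bounded.
apply: (@ishell_bounded _ _ _ _ (B * (2 * N)) rho).
- by move=> y; rewrite in_itv.
- apply: measurable_funTS; apply: measurable_funM.
    by apply: measurable_fun_derive; [exact: cutoff_kernel_continuous|exact: cutoff_kernel_derivable].
  exact: measurable_fun_vecT W_continuous.
- by move=> z _; rewrite normrM ler_pM// W_le.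
Qed.

(** The integrated product rule; the reflection [x - z] reverses the usual sign. The total
    derivative is left as a volume integral, which [Ish_parts_boundary] shows to be small. *)
Lemma Ish_parts (rho : R) :
  Ish `]-oo, rho[ (fun z => kappa z * 'D_e u (x - z)) =
  Ish `]-oo, rho[ (fun z => 'D_e kappa z * (u (x - z) - u x)) -
  Ish `]-oo, rho[ (fun z => 'D_e (fun z => kappa z * (u (x - z) - u x)) z).
Proof.
have i1 := ishell_kappaV rho; have i2 := ishell_DkappaW rho.
rewrite (@eq_Ish _ _ _ (fun z => 'D_e (fun z => kappa z * (u (x - z) - u x)) z)
  (fun z => 'D_e kappa z * (u (x - z) - u x) - kappa z * 'D_e u (x - z))); last first.
  by move=> z _; exact: H_derive.
by rewrite IshB// opprB addrC subrK.
Qed.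

Lemma Ish_parts_boundary : exists2 C, 0 <= C & forall rho : R, 0 < rho ->
  `|Ish `]-oo, rho[ (fun z => 'D_e (fun z => kappa z * (u (x - z) - u x)) z)|
   <= C * rho `^ (- (1 + 2 * s)).
Proof.
have [B B0 HB] := cutoff_kernel_derive_bounded.
pose A := 2 * N * Lam * 2 `^ (n%:R + 2 * s).
have A0 : 0 <= A by rewrite !mulr_ge0 ?powR_ge0// ltW.
exists (A * (4 ^+ n * n%:R * vol)).
  by rewrite mulr_ge0// !mulr_ge0 ?exprn_ge0// ltW// unit_ball_vol_gt0.
move=> rho rho0; have rho2 : 0 < rho / 2 by rewrite divr_gt0.
have setV : forall z, 0 <= enorm z <= 2 * rho -> [set: Rn] z by [].
(* [B1] depends on [rho] without harm: a bound on the derivative does not enter the estimate of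
   [Ish_divergence_bound]. *)
have [B1 _ HB1] := @bounded_on_shell R n setT (fun z => kappa z * V z) 0 (2 * rho) setV
  (fun z _ => (@cvgM R Rn (nbhs z) _ _ _ _ _ (@cutoff_kernel_continuous z) (@V_continuous z))).
have := @Ish_divergence_bound R n H e rho (2 * N * (Lam * (rho / 2) `^ (- (n%:R + 2 * s))))
  (B * (2 * N) + B1) n0 H_continuous H_derivable e1 rho0.
move=> /(_ _ _ _)/le_trans; apply.
- move=> z zr; rewrite H_derive (le_trans (ler_normB _ _))// lerD//.
    by rewrite normrM ler_pM// W_le.
  by apply: HB1; rewrite enorm_ge0.
- by rewrite !mulr_ge0 ?powR_ge0// ltW.
- move=> z /andP[z1 _]; rewrite /H (normrM (kappa z)) [leLHS]mulrC.
  apply: ler_pM => //.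
  rewrite ger0_norm ?cutoff_kernel_ge0// (le_trans (cutoff_kernel_le z))//.
  exact: rkernel_hi_far.
have -> : (rho / 2) `^ (- (n%:R + 2 * s)) =
    2 `^ (n%:R + 2 * s) * rho `^ (- (1 + 2 * s)) / rho ^+ n.-1.
  rewrite powRM ?invr_ge0 ?(ltW rho0)// powR_inv// opprK mulrC -mulrA; congr (_ * _).
  rewrite -powR_mulrn ?(ltW rho0)// -powRN -powRD; last by rewrite (gt_eqF rho0) implybT.
  congr (_ `^ _); rewrite -subn1 natrB//; ring.
rewrite le_eqVlt; apply/orP; left; apply/eqP; rewrite /A; field.
by rewrite gt_eqF// exprn_gt0.
Qed.

End parts.
End cutoff_kernel.

(** * Existence of the principal values of [u] and of its derivative *)

Section convergence.
Variables (R : realType) (n : nat) (s lam Lam : R) (K : 'rV[R]_n -> \bar R).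
Hypotheses (n0 : (0 < n)%N) (s0 : 0 < s) (s1 : s < 1) (lam0 : 0 < lam)
  (lamLam : lam <= Lam) (hK : kernel_class s lam Lam K).
Local Notation Rn := 'rV[R]_n.
Local Notation k := (rkernel K).
Implicit Types (x y z : Rn).

Let Lam0 : 0 < Lam. Proof. exact: lt_le_trans lamLam. Qed.

Lemma Ish_ball_split (f : Rn -> R) (rho rho' : R) : rho <= rho' ->
  ishell `]-oo, rho'[ f ->
  Ish `]-oo, rho'[ f = Ish `]-oo, rho[ f + Ish `[rho, rho'[ f.
Proof.
move=> rr fi; apply: Ish_split => //.
- by move=> y; rewrite !in_itv/=; lra.
- by move=> y; rewrite !in_itv/= => /andP[].
- by move=> y; rewrite !in_itv/= => ->; rewrite andbT; have [] := ltP y rho.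
- by move=> y; rewrite !in_itv/= => y1 /andP[y2 _]; lra.
Qed.

Lemma ishell_co (f : Rn -> R) (a b : R) : 0 < a ->
  {in [set z : Rn | z != 0], continuous f} -> ishell `[a, b[ f.
Proof.
move=> a0 cf; apply: (ishell_punctured (b := b) a0 _ cf) => y.
by rewrite !in_itv/= => /andP[-> /ltW].
Qed.

Lemma rkernel_far_small (eps : R) : 0 < eps ->
  exists2 rho0, 1 < rho0 & forall rho rho', rho0 <= rho -> rho <= rho' ->
     `|Ish `[rho, rho'[ k| < eps.
Proof.
move=> eps0; have q0 : 0 < 2 * s by rewrite mulr_gt0.
apply: (@far_bounded R n k Lam (2 * s) q0 (ltW Lam0)) => //.
  move=> c d c1; apply: ishell_co; first exact: lt_le_trans c1.
  exact: rkernel_continuous hK.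
move=> z z1; have z0 : z != 0 by rewrite -enorm_gt0 (lt_le_trans _ z1).
by rewrite ger0_norm ?(rkernel_ge0 hK)// (le_trans (rkernel_hi hK z0))// opprD addrC.
Qed.

Lemma bounded_far_small (f : Rn -> R) x (N : R) : continuous f ->
  (forall z, `|f z| <= N) -> forall eps : R, 0 < eps ->
  exists2 rho, 1 < rho & forall rho', rho <= rho' ->
     `|Ish `[rho, rho'[ (fun z => (f x - f (x - z)) * k z)| < eps.
Proof.
move=> cf fN eps eps0; have q0 : 0 < 2 * s by rewrite mulr_gt0.
have N0 : 0 <= N by exact: le_trans (fN 0).
have B0 : 0 <= 2 * N * Lam by rewrite !mulr_ge0// ltW.
have [|z z1|rho rho1 H] := @far_bounded R n (fun z => (f x - f (x - z)) * k z)
  (2 * N * Lam) (2 * s) q0 B0 _ _ eps eps0; last first.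
- by exists rho => // rho'; exact: H.
- have z0 : z != 0 by rewrite -enorm_gt0 (lt_le_trans _ z1).
  rewrite normrM -mulrA ler_pM//.
    rewrite (le_trans (ler_normB _ _))//; have := fN x; have := fN (x - z); lra.
  by rewrite ger0_norm ?(rkernel_ge0 hK)// (le_trans (rkernel_hi hK z0))// opprD addrC.
- move=> c d c1; apply: ishell_co; first exact: lt_le_trans c1.
  exact: (@continuous_increment R n s lam Lam K hK f x cf).
Qed.

(** The derivative may be unbounded, so its tail is integrated by parts with a cutoff at radius 1.
    Four quantities remain, each below [eps / 4]: the tail of the kernel times the value at [x], the
    tail with the differentiated kernel, and the boundary terms at [rho] and [rho']. *)
Lemma derivative_far_small (u : Rn -> R) (e x : Rn) (N : R) : enorm e = 1 ->
  (forall z, differentiable u z) -> continuous ('D_e u) -> (forall z, `|u z| <= N) ->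
  forall eps : R, 0 < eps -> exists2 rho, 1 < rho & forall rho', rho <= rho' ->
     `|Ish `[rho, rho'[ (fun z => ('D_e u x - 'D_e u (x - z)) * k z)| < eps.
Proof.
move=> e1 du cv uN eps eps0.
have N0 : 0 <= N by exact: le_trans (uN 0).
pose a := `|'D_e u x| + 1; have a0 : 0 < a by rewrite ltr_pwDr.
have eps1 : 0 < eps / 4 / a by rewrite !divr_gt0.
have eps4 : 0 < eps / 4 by rewrite divr_gt0.
have [rho1 rho11 H1] := rkernel_far_small eps1.
have q2 : 0 < 1 + 2 * s by rewrite addr_gt0// mulr_gt0.
have B2 : 0 <= (11 + Lam) * Lam * (2 * N).
  by rewrite !mulr_ge0 ?addr_ge0// ltW.
pose D := fun z => 'D_e (cutoff_kernel K 1) z * (u (x - z) - u x).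
have [rho2 rho21 H2] : exists2 rho0, 1 < rho0 & forall rho rho', rho0 <= rho -> rho <= rho' ->
     `|Ish `[rho, rho'[ D| < eps / 4.
  apply: (@far_bounded R n D ((11 + Lam) * Lam * (2 * N)) (1 + 2 * s) q2 B2) => //.
    move=> c d c1.
    have := @ishell_DkappaW R n s lam Lam K s0 lam0 lamLam hK 1 e ltr01 e1 u x N du uN d.
    by apply: ishellS => y; rewrite !in_itv/= => /andP[].
  move=> z z1; have z0 : z != 0 by rewrite -enorm_gt0 (lt_le_trans _ z1).
  have zp : 0 < enorm z by rewrite enorm_gt0.
  rewrite /D normrM mulrAC ler_pM//.
    rewrite -(ler_pM2r zp) (le_trans (cutoff_kernel_derive_le lam0 lamLam hK ltr01 e1 z0))//.
    rewrite -!mulrA ler_wpM2l ?addr_ge0 ?(ltW Lam0)//.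
    apply: (@le_trans _ _ (1 * k z)).
      by rewrite ler_wpM2r ?(rkernel_ge0 hK)// cutoff_root_le1.
    rewrite mul1r (le_trans (rkernel_hi hK z0))// ler_wpM2l ?(ltW Lam0)//.
    have -> : enorm z `^ (- (1 + 2 * s) - n%:R) * enorm z =
        enorm z `^ (- (1 + 2 * s) - n%:R) * enorm z `^ 1 by rewrite powRr1// ltW.
    rewrite -powRD; last by rewrite (gt_eqF zp) implybT.
    by rewrite le_eqVlt; apply/orP; left; apply/eqP; congr (_ `^ _); ring.
  rewrite (le_trans (ler_normB _ _))//; have := uN x; have := uN (x - z); lra.
have [C C0 HC] := @Ish_parts_boundary R n s lam Lam K n0 s0 lam0 lamLam hK 1 e ltr01 e1 u x N du cv uN.
have [rho3 rho31 H3] := powRN_small C q2 eps4.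
pose rho := Num.max (Num.max rho1 rho2) rho3.
have r1 : rho1 <= rho by rewrite !le_max lexx.
have r2 : rho2 <= rho by rewrite !le_max lexx orbT.
have r3 : rho3 <= rho by rewrite !le_max lexx orbT.
have rho_gt1 : 1 < rho by exact: lt_le_trans r1.
have rho0 : 0 < rho by exact: lt_trans rho_gt1.
exists rho => // rho' rr.
have ck := rkernel_continuous hK.
have ik : ishell `[rho, rho'[ k by apply: ishell_co.
have iV : ishell `[rho, rho'[ (fun z => cutoff_kernel K 1 z * 'D_e u (x - z)).
  have := @ishell_kappaV R n s lam Lam K hK 1 e ltr01 u x cv rho'.
  by apply: ishellS => y; rewrite !in_itv/= => /andP[].
rewrite (@eq_Ish _ _ _ _ (fun z => 'D_e u x * k z - cutoff_kernel K 1 z * 'D_e u (x - z))); last first.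
  move=> z; rewrite in_itv/= => /andP[rz _].
  by rewrite cutoff_kernel1//; [ring|rewrite (le_trans (ltW rho_gt1))].
rewrite IshB//; last exact: ishellZ.
rewrite IshZ//.
have E : Ish `[rho, rho'[ (fun z => cutoff_kernel K 1 z * 'D_e u (x - z)) =
   Ish `[rho, rho'[ D -
   (Ish `]-oo, rho'[ (fun z => 'D_e (fun z => cutoff_kernel K 1 z * (u (x - z) - u x)) z) -
    Ish `]-oo, rho[ (fun z => 'D_e (fun z => cutoff_kernel K 1 z * (u (x - z) - u x)) z)).
  have p1 := @Ish_parts R n s lam Lam K s0 lam0 lamLam hK 1 e ltr01 e1 u x N du cv uN rho.
  have p2 := @Ish_parts R n s lam Lam K s0 lam0 lamLam hK 1 e ltr01 e1 u x N du cv uN rho'.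
  have i1 := @ishell_kappaV R n s lam Lam K hK 1 e ltr01 u x cv rho'.
  have i2 := @ishell_DkappaW R n s lam Lam K s0 lam0 lamLam hK 1 e ltr01 e1 u x N du uN rho'.
  rewrite (Ish_ball_split rr i1) (Ish_ball_split rr i2) in p2.
  rewrite -/D in p1 p2; lra.
rewrite E.
have b1 := H1 _ _ r1 rr; have b2 := H2 _ _ r2 rr.
have b3 := le_lt_trans (HC rho rho0) (H3 rho r3).
have b4 := le_lt_trans (HC rho' (lt_le_trans rho0 rr)) (H3 rho' (le_trans r3 rr)).
have b5 : `|'D_e u x * Ish `[rho, rho'[ k| < eps / 4.
  rewrite normrM; apply: (@le_lt_trans _ _ (a * `|Ish `[rho, rho'[ k|)).
    by rewrite ler_wpM2r// lerDl.
  by rewrite mulrC -ltr_pdivlMr.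
move: b2 b3 b4 b5.
set A1 := Ish _ D; set A2 := Ish `]-oo, rho[ _; set A3 := Ish `]-oo, rho'[ _.
set A4 := _ * Ish _ k.
rewrite !ltr_norml => /andP[? ?] /andP[? ?] /andP[? ?] /andP[? ?].
by apply/andP; split; lra.
Qed.

(** The inner limits [J] are kept explicit because the one-sided comparison is first made at a fixed
    inner radius. *)
Definition pv_limit (f : Rn -> R) x (J : R -> R) (l : R) :=
  (forall r, 0 < r -> r < 1 ->
    Ish `]r, rho[ (fun z => (f x - f (x - z)) * k z) @[rho --> +oo] --> J r) /\
  J r @[r --> 0^'+] --> l.

Lemma pv_limitE f x J l : continuous f -> pv_limit f x J l -> pv_op K f x = l%:E.
Proof.
move=> cf [H1 H2]; apply: (pv_op_cvg hK cf ltr01 (g := EFin \o J)).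
  by move=> r r0 r1; apply: cvg_EFin; [exact: nearW|exact: H1].
by apply: cvg_EFin; [exact: nearW|exact: H2].
Qed.

Lemma pv_limit_function (u : Rn -> R) x (N C b : R) : continuous u ->
  (forall z, `|u z| <= N) -> 2 * s < b ->
  (forall z, enorm z <= 1 -> `|u (x + z) + u (x - z) - 2 * u x| <= C * enorm z `^ b) ->
  exists J l, pv_limit u x J l.
Proof.
move=> cu uN sb HC; apply: Ish_cvg.
- exact: (@continuous_increment R n s lam Lam K hK u x cu).
- exact: (@near_increment R n s lam Lam K lam0 lamLam hK u x C b cu sb HC).
- exact: bounded_far_small uN.
Qed.

Lemma pv_limit_derivative (u : Rn -> R) (e x : Rn) (N C b : R) : enorm e = 1 ->
  (forall z, differentiable u z) -> continuous ('D_e u) ->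
  (forall z, `|u z| <= N) -> 2 * s < b ->
  (forall z, enorm z <= 1 ->
     `|'D_e u (x + z) + 'D_e u (x - z) - 2 * 'D_e u x| <= C * enorm z `^ b) ->
  exists J l, pv_limit ('D_e u) x J l.
Proof.
move=> e1 du cv uN sb HC; apply: Ish_cvg.
- exact: (@continuous_increment R n s lam Lam K hK _ x cv).
- exact: (@near_increment R n s lam Lam K lam0 lamLam hK _ x C b cv sb HC).
- exact: derivative_far_small uN.
Qed.

End convergence.

(** * Passage to the limit in a one-sided bound *)

Section one_sided_limit.
Variables (R : realType) (n : nat) (s lam Lam : R) (K : 'rV[R]_n -> \bar R).
Hypotheses (n0 : (0 < n)%N) (s0 : 0 < s) (s1 : s < 1) (lam0 : 0 < lam)
  (lamLam : lam <= Lam) (hK : kernel_class s lam Lam K).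
Local Notation Rn := 'rV[R]_n.
Local Notation k := (rkernel K).
Implicit Types (z : Rn).
(** [G] is the error in expanding the increment of [F]. Near the origin it lies below [P], whose
    integrals converge; over a whole annulus its integral is at most a term that vanishes as the
    outer radius grows. *)
Variables (F u v G P : Rn -> R) (x : Rn) (a b lu lv d1 C q : R) (Ju Jv : R -> R).
Hypotheses (cF : continuous F) (F0 : forall y, 0 <= F y)
  (cu : continuous u) (cv : continuous v)
  (cG : {in [set z : Rn | z != 0], continuous G})
  (cP : {in [set z : Rn | z != 0], continuous P}).
Hypothesis decomposition : forall z, z != 0 ->
  (F x - F (x - z)) * k z =
  a * ((v x - v (x - z)) * k z) + b * ((u x - u (x - z)) * k z) + G z.
Hypotheses (d10 : 0 < d1) (d11 : d1 < 1)
  (GP : forall z, 0 < enorm z <= d1 -> G z <= P z)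
  (Pcvg : cvg (Ish `]r, d1] P @[r --> 0^'+]))
  (q0 : 0 < q)
  (Gbound : forall r rho, 0 < r -> r < d1 -> 1 < rho ->
     Ish `]r, rho[ G <= C * rho `^ (- q))
  (Lu : pv_limit K u x Ju lu) (Lv : pv_limit K v x Jv lv).

Let inc (f : Rn -> R) z := (f x - f (x - z)) * k z.

Let cinc f : continuous f -> {in [set z : Rn | z != 0], continuous (inc f)}.
Proof. by move=> cf; exact: (@continuous_increment R n s lam Lam K hK f x cf). Qed.

Let iann (f : Rn -> R) (i : interval R) (r rho : R) : 0 < r -> {subset i <= `[r, rho]} ->
  {in [set z : Rn | z != 0], continuous f} -> ishell i f.
Proof. by move=> r0 sub cf; exact: ishell_punctured sub cf. Qed.

Let ioc (f : Rn -> R) (r rho : R) : 0 < r ->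
  {in [set z : Rn | z != 0], continuous f} -> ishell `]r, rho] f.
Proof.
move=> r0; apply: (iann (r := r) (rho := rho)) => // y.
by rewrite !in_itv/= => /andP[/ltW -> ->].
Qed.

Let ioo (f : Rn -> R) (r rho : R) : 0 < r ->
  {in [set z : Rn | z != 0], continuous f} -> ishell `]r, rho[ f.
Proof.
move=> r0; apply: (iann (r := r) (rho := rho)) => // y.
by rewrite !in_itv/= => /andP[/ltW -> /ltW ->].
Qed.

Let decomposition_Ish (i : interval R) (r rho : R) : 0 < r -> {subset i <= `[r, rho]} ->
  Ish i (inc F) = a * Ish i (inc v) + b * Ish i (inc u) + Ish i G.
Proof.
move=> r0 sub; have iv := iann r0 sub (cinc cv); have iu := iann r0 sub (cinc cu).
have iG := iann r0 sub cG.
rewrite -!IshZ// -IshD; [|exact: ishellZ|exact: ishellZ].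
rewrite -IshD//; last by apply: ishellD; exact: ishellZ.
apply: eq_Ish => z /sub; rewrite in_itv/= => /andP[rz _].
by rewrite /inc decomposition// -enorm_gt0 (lt_le_trans r0).
Qed.

Let FK z := F (x - z) * k z.

Let cFK : {in [set z : Rn | z != 0], continuous FK}.
Proof.
move=> z z0; apply: (@cvgM R Rn (nbhs z)); last exact: rkernel_continuous hK _ z0.
exact: (@continuous_reflect R n F x cF).
Qed.

Let ck := rkernel_continuous hK.

Let FK0 z : 0 <= FK z. Proof. by rewrite mulr_ge0// (rkernel_ge0 hK). Qed.

Let Ish_empty (f : Rn -> R) (rho : R) : rho <= d1 -> Ish `]d1, rho[ f = 0.
Proof.
move=> rd; rewrite /Ish (_ : @shell R n `]d1, rho[ = set0) ?Rintegral_set0//.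
apply/seteqP; split => // t; rewrite /shell /= in_itv/= => /andP[? ?].
lra.
Qed.

Let Phi_mono : nondecreasing_fun (fun rho => (Ish `]d1, rho[ FK)%:E).
Proof.
move=> rho rho' rr; rewrite lee_fin; have [rd|rd] := leP rho d1.
  by rewrite (Ish_empty _ rd); apply: Ish_ge0.
rewrite (@Ish_split_far _ _ _ cFK d1 rho rho')// lerDl.
by apply: Ish_ge0.
Qed.

Let kcvg : cvg (Ish `]d1, rho[ k @[rho --> +oo]).
Proof.
apply: cvg_pinfty_cauchy => e e0.
have [rho rho1 H] := rkernel_far_small s0 lam0 lamLam hK e0; exists rho => rho' rr.
rewrite (@Ish_split_far _ _ _ ck d1 rho rho')//; last exact: lt_trans rho1.
by rewrite opprD addrA subrr add0r normrN H.
Qed.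

(** The part of [F] outside [d1] is [F x] times the tail of the kernel minus an increasing integral.
    The latter may be infinite, and then [S'] is [-oo]; only [+oo] is excluded. *)
Let S := ereal_sup (range (fun rho => (Ish `]d1, rho[ FK)%:E)).
Let k1 := lim (Ish `]d1, rho[ k @[rho --> +oo]).
Let S' : \bar R := ((F x * k1)%:E - S)%E.

Let S'lt : (S' < +oo)%E.
Proof.
have : (0 <= S)%E.
  by apply: ereal_sup_ubound; exists 0 => //; rewrite Ish_empty// ltW.
by rewrite /S'; case: S => [t _| _|//]; rewrite ?ltry.
Qed.

Let JF (r : R) : \bar R := ((Ish `]r, d1] (inc F))%:E + S')%E.

Let JF_cvg r : 0 < r -> r < d1 ->
  (Ish `]r, rho[ (inc F))%:E @[rho --> +oo] --> JF r.
Proof.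
move=> r0 rd.
have H1 : (F x * Ish `]d1, rho[ k)%:E @[rho --> +oo] --> (F x * k1)%:E.
  apply: cvg_EFin; first exact: nearW.
  by apply: cvgM; [exact: cvg_cst|exact: kcvg].
have H2 := nondecreasing_cvge Phi_mono.
have H3 : ((F x * Ish `]d1, rho[ k)%:E - (Ish `]d1, rho[ FK)%:E)%E @[rho --> +oo] --> S'.
  apply: (cvgeB _ H1 H2); exact: fin_num_adde_defr.
have H4 : ((Ish `]r, d1] (inc F))%:E + ((F x * Ish `]d1, rho[ k)%:E - (Ish `]d1, rho[ FK)%:E))%E
     @[rho --> +oo] --> JF r.
  apply: (cvgeD _ _ H3); last exact: cvg_cst.
  exact: fin_num_adde_defr.
apply: cvg_trans H4; apply: near_eq_cvg; near=> rho.
have drho : d1 < rho by near: rho; apply: nbhs_pinfty_gt; exact: num_real.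
have ii := @ioo k d1 rho d10 ck; have iF := @ioo FK d1 rho d10 cFK.
rewrite (@Ish_split_near _ _ _ (cinc cF) d1 r rho)//; last exact: ltW.
rewrite EFinD; congr (_ + _)%E; rewrite -EFinB; congr EFin.
rewrite -IshZ// -IshB//; last exact: ishellZ.
by apply: eq_Ish => z _; rewrite /inc /FK mulrBl.
Unshelve. all: by end_near. Qed.

(* The truncated integral of F is a convergent part minus the integral of
   P - G >= 0, hence has a limit, possibly -oo, without any regularity of F at x. *)
Let mono_part (r : R) : \bar R := (- (Ish `]r, d1] (fun z => P z - G z)))%:E.

Let cPG : {in [set z : Rn | z != 0], continuous (fun z => P z - G z)}.
Proof. by move=> z z0; apply: (@cvgB R R Rn (nbhs z)); [exact: cP|exact: cG]. Qed.

Let mono_cvg : cvg (mono_part r @[r --> 0^'+]).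
Proof.
apply: nondecreasing_at_right_is_cvge; near=> y.
have yd : y < d1 by near: y; exact: nbhs_right_lt.
move=> r r'; rewrite !in_itv/= => /andP[r0 ry] /andP[r'0 r'y] rr.
rewrite lee_fin lerN2 [leRHS](@Ish_split _ _ _ `]r, r'] `]r', d1]).
- rewrite lerDr; apply: Ish_ge0 => z; rewrite in_itv/= => /andP[rz zr].
  rewrite subr_ge0 GP// (lt_trans r0)//= (le_trans zr)//.
  exact: ltW (lt_trans r'y yd).
- by move=> t; rewrite !in_itv/= => /andP[-> t1]/=; lra.
- by move=> t; rewrite !in_itv/= => /andP[t1 ->]; rewrite andbT; lra.
- by move=> t; rewrite !in_itv/= => /andP[-> ->]; rewrite andbT/=; have [] := leP t r'.
- by move=> t; rewrite !in_itv/= => /andP[_ t1] /andP[t2 _]; lra.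
- exact: ioc.
Unshelve. all: by end_near. Qed.

Let J_near (f : Rn -> R) J l r : continuous f -> pv_limit K f x J l -> 0 < r -> r < d1 ->
  Ish `]r, d1] (inc f) = J r - J d1.
Proof.
move=> cf [H1 H2] r0 rd; apply/eqP; rewrite eq_sym subr_eq; apply/eqP.
have h1 := H1 r r0 (lt_trans rd d11).
have h2 : (Ish `]r, d1] (inc f) + Ish `]d1, rho[ (inc f)) @[rho --> +oo] -->
    Ish `]r, d1] (inc f) + J d1.
  by apply: cvgD; [exact: cvg_cst|exact: H1].
apply: (cvg_unique _ h1) => //; apply: cvg_trans h2; apply: near_eq_cvg; near=> rho.
symmetry; apply: (Ish_split_near (cinc cf)) => //; first exact: ltW.
by near: rho; apply: nbhs_pinfty_gt; exact: num_real.
Unshelve. all: by end_near. Qed.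

Let JF_limit : exists L : \bar R, JF r @[r --> 0^'+] --> L.
Proof.
pose p r := a * (Jv r - Jv d1) + b * (Ju r - Ju d1) + Ish `]r, d1] P.
have pcvg : p r @[r --> 0^'+] --> a * (lv - Jv d1) + b * (lu - Ju d1) +
    lim (Ish `]r, d1] P @[r --> 0^'+]).
  apply: cvgD; last exact: Pcvg.
  apply: cvgD; (apply: cvgM; first exact: cvg_cst); apply: cvgB; try exact: cvg_cst.
    by have [] := Lv.
  by have [] := Lu.
set pl := _ + lim _ in pcvg.
have pcvgE : (p r)%:E @[r --> 0^'+] --> pl%:E by apply: cvg_EFin; [exact: nearW|exact: pcvg].
have M0 : (lim (mono_part r @[r --> 0^'+]) <= 0)%E.
  apply: lime_le; first exact: mono_cvg.
  near=> r; rewrite lee_fin oppr_le0; apply: Ish_ge0 => z.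
  rewrite in_itv/= => /andP[rz zd]; rewrite subr_ge0 GP// zd andbT (lt_trans _ rz)//.
have H1 : ((p r)%:E + mono_part r)%E @[r --> 0^'+] -->
    (pl%:E + lim (mono_part r @[r --> 0^'+]))%E.
  apply: cvgeD; [exact: fin_num_adde_defr|exact: pcvgE|exact: mono_cvg].
exists ((pl%:E + lim (mono_part r @[r --> 0^'+])) + S')%E.
have H2 : (((p r)%:E + mono_part r) + S')%E @[r --> 0^'+] -->
    ((pl%:E + lim (mono_part r @[r --> 0^'+])) + S')%E.
  (* The sum of the limits is defined: [pl] is finite, and neither [S'] nor the limit of
     [mono_part], which is at most 0, is [+oo]. *)
  apply: cvgeD; [|exact: H1|exact: cvg_cst].
  move: M0 S'lt; case: (lim _) => [t _| // | _]; case: S' => [t'||]//.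
apply: cvg_trans H2; apply: near_eq_cvg; near=> r.
have r0 : 0 < r by near: r; exact: nbhs_right_gt.
have rd : r < d1 by near: r; exact: nbhs_right_lt.
rewrite /JF; congr (_ + _)%E; rewrite /mono_part -EFinD; congr EFin.
rewrite (@decomposition_Ish `]r, d1] r d1)//; last first.
  by move=> t; rewrite !in_itv/= => /andP[/ltW -> ->].
rewrite (J_near cv Lv r0 rd) (J_near cu Lu r0 rd) /p IshB; [ring|exact: ioc|exact: ioc].
Unshelve. all: by end_near. Qed.

Lemma pv_op_le : (pv_op K F x <= (a * lv + b * lu)%:E)%E.
Proof.
have [L JL] := JF_limit.
have -> : pv_op K F x = L.
  by apply: (pv_op_cvg hK cF d10 _ JL) => r r0 rd; exact: JF_cvg.
have H : (a * Jv r + b * Ju r)%:E @[r --> 0^'+] --> (a * lv + b * lu)%:E.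
  apply: cvg_EFin; first exact: nearW.
  by apply: cvgD; (apply: cvgM; first exact: cvg_cst); [have [] := Lv|have [] := Lu].
apply: (lee_cvg_to JL H); near=> r.
have r0 : 0 < r by near: r; exact: nbhs_right_gt.
have rd : r < d1 by near: r; exact: nbhs_right_lt.
have r1 := lt_trans rd d11.
have h1 := Lv.1 r r0 r1; have h2 := Lu.1 r r0 r1.
have h3 : C * rho `^ (- q) @[rho --> +oo] --> 0.
  apply/cvgrPdist_lt => e e0.
  have [rho0 _ Hr] := powRN_small `|C| q0 e0.
  near=> rho; rewrite sub0r normrN normrM (ger0_norm (powR_ge0 _ _)).
  by apply: Hr; near: rho; apply: nbhs_pinfty_ge; exact: num_real.
have h4 : (a * Ish `]r, rho[ (inc v) + b * Ish `]r, rho[ (inc u) + C * rho `^ (- q))%:E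
   @[rho --> +oo] --> (a * Jv r + b * Ju r)%:E.
  apply: cvg_EFin; first exact: nearW.
  rewrite -[X in _ --> X]addr0; apply: cvgD => //.
  by apply: cvgD; (apply: cvgM; first exact: cvg_cst).
apply: (lee_cvg_to (JF_cvg r0 rd) h4); near=> rho.
rewrite lee_fin (@decomposition_Ish `]r, rho[ r rho)//; last first.
  by move=> t; rewrite !in_itv/= => /andP[/ltW -> /ltW ->].
by rewrite lerD2l Gbound//; near: rho; apply: nbhs_pinfty_gt; exact: num_real.
Unshelve. all: by end_near. Qed.

End one_sided_limit.

(** * The Bernstein inequality *)

(** After multiplication by [b ^+ 2], the square of [b ^+ 2 * q - a ^+ 2 * p] carries all of [q].
    What is left is a quadratic form in [a] and [h = b - a], positive for [h >= - a / 2], as its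
    expansion in powers of [h + a / 2] shows; the coefficient 10 leaves room for this. *)
Lemma quad_near (R : realType) (a b p q : R) : 0 < a -> a / 2 <= b ->
  - (a ^+ 2 * p ^+ 2) - b ^+ 2 * q ^+ 2 + 2 * a ^+ 2 * p * q <=
  p ^+ 2 * (- (2 * a * (b - a)) + 10 * (b - a) ^+ 2).
Proof.
move=> a0 ab; have b0 : 0 < b by lra.
rewrite -(ler_pM2l (exprn_gt0 2 b0)) -subr_ge0.
set h := b - a; have hE : b = a + h by rewrite /h; ring.
have -> : b ^+ 2 * (p ^+ 2 * (- (2 * a * h) + 10 * h ^+ 2)) -
  b ^+ 2 * (- (a ^+ 2 * p ^+ 2) - b ^+ 2 * q ^+ 2 + 2 * a ^+ 2 * p * q) =
  (b ^+ 2 * q - a ^+ 2 * p) ^+ 2 +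
  p ^+ 2 * (h ^+ 2 * (7 * a ^+ 2 + 18 * a * h + 10 * h ^+ 2)).
  by rewrite hE; ring.
rewrite addr_ge0 ?sqr_ge0// mulr_ge0 ?sqr_ge0// mulr_ge0 ?sqr_ge0//.
have t0 : 0 <= h + a / 2 by rewrite hE in ab; lra.
have -> : 7 * a ^+ 2 + 18 * a * h + 10 * h ^+ 2 =
  2^-1 * a ^+ 2 + 8 * (a * (h + a / 2)) + 10 * (h + a / 2) ^+ 2 by field.
by rewrite !addr_ge0 ?mulr_ge0 ?sqr_ge0// ltW.
Qed.

(** Young's inequality from the square of [|p| * w - 2 * B * |y|], balanced so as to use up half of
    the negative term [a ^+ 2 * p ^+ 2] and leave the other half. *)
Lemma young_weighted (R : realType) (a p y w B k D sigma : R) :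
  0 <= k -> 0 <= w -> `|D| <= w * B * k -> 2 * a ^+ 2 * B ^+ 2 <= sigma ->
  2 * a ^+ 2 * p * (D * y) <= 2^-1 * a ^+ 2 * p ^+ 2 * (w ^+ 2 * k) + sigma * y ^+ 2 * k.
Proof.
move=> k0 w0 DB Bs.
have h1 : p * (D * y) <= `|p| * `|y| * (w * B * k).
  rewrite (le_trans (ler_norm _))// !normrM.
  have -> : `|p| * (`|D| * `|y|) = `|p| * `|y| * `|D| by ring.
  by rewrite ler_wpM2l ?mulr_ge0.
have h2 : 2 * a ^+ 2 * (p * (D * y)) <= 2 * a ^+ 2 * (`|p| * `|y| * (w * B * k)).
  by rewrite ler_wpM2l// mulr_ge0// sqr_ge0.
have np : `|p| ^+ 2 = p ^+ 2 by rewrite real_normK ?num_real.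
have ny : `|y| ^+ 2 = y ^+ 2 by rewrite real_normK ?num_real.
have h3 : 0 <= a ^+ 2 * k * (2^-1 * (`|p| * w - 2 * B * `|y|) ^+ 2).
  by apply: mulr_ge0; apply: mulr_ge0; rewrite ?sqr_ge0 ?invr_ge0.
have h4 : 2 * a ^+ 2 * B ^+ 2 * (y ^+ 2 * k) <= sigma * (y ^+ 2 * k).
  by rewrite ler_wpM2r// mulr_ge0 ?sqr_ge0.
have h5 : a ^+ 2 * k * (2^-1 * (`|p| * w - 2 * B * `|y|) ^+ 2) =
  2^-1 * a ^+ 2 * p ^+ 2 * (w ^+ 2 * k) + 2 * a ^+ 2 * B ^+ 2 * (y ^+ 2 * k) -
  2 * a ^+ 2 * (`|p| * `|y| * (w * B * k)).
  by rewrite -np -ny; field.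
rewrite h5 in h3.
have -> : 2 * a ^+ 2 * p * (D * y) = 2 * a ^+ 2 * (p * (D * y)) by ring.
rewrite -(mulrA sigma); lra.
Qed.

Section bernstein.
Variables (R : realType) (n : nat) (s lam Lam : R) (K : 'rV[R]_n -> \bar R).
Hypotheses (n0 : (0 < n)%N) (s0 : 0 < s) (s1 : s < 1) (lam0 : 0 < lam)
  (lamLam : lam <= Lam) (hK : kernel_class s lam Lam K).
Local Notation Rn := 'rV[R]_n.
Local Notation k := (rkernel K).
Local Notation vol := (unit_ball_vol R n).
Implicit Types (z : Rn).

Let Lam0 : 0 < Lam. Proof. exact: lt_le_trans lamLam. Qed.

Definition far_const : R := (3 / 2) `^ (- (n%:R + 2 * s)) * ((3 / 2) ^+ n - 1) * vol.

Lemma far_const_gt0 : 0 < far_const.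
Proof.
rewrite !mulr_gt0 ?powR_gt0 ?unit_ball_vol_gt0// subr_gt0.
by rewrite exprn_egt1 ?gtn_eqF//; lra.
Qed.

Let sq z := enorm z ^+ 2 * k z.

Let csq : {in [set z : Rn | z != 0], continuous sq}.
Proof.
move=> z z0; apply: (@cvgM R Rn (nbhs z)); last exact: rkernel_continuous hK _ z0.
by apply: (@cvgM R Rn (nbhs z)); exact: enorm_continuous.
Qed.

Let q2 : 0 < 2 - 2 * s. Proof. by rewrite subr_gt0 gtr_pMr. Qed.

Lemma sq_kernel_near_bound (a b : R) : 0 < a -> a <= b ->
  Ish `]a, b] sq <= Lam * (dyadic_const n (2 - 2 * s) * b `^ (2 - 2 * s)).
Proof.
move=> a0 ab; rewrite (le_trans (ler_norm _))//; apply: Ish_near_bound => //.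
- exact: ltW.
- move=> c d ac db; apply: (ishell_punctured (b := d) a0 _ csq) => y.
  by rewrite !in_itv/= => /andP[cy ->]; rewrite (le_trans ac (ltW cy)).
- move=> z /andP[az _]; have z0 := enorm_neq0 (ltW a0) az.
  rewrite ger0_norm; last by rewrite mulr_ge0 ?sqr_ge0// (rkernel_ge0 hK).
  by have := rkernel_hi_q hK 2 z0; rewrite /sq -(powR_mulrn 2 (enorm_ge0 z)).
Qed.

Variables (eta u : Rn -> R) (e x : Rn) (N M c1 sigma : R).
Hypotheses (deta : forall y, differentiable eta y) (eta0 : forall y, 0 <= eta y)
  (M0 : 0 < M)
  (etaL : forall y w, enorm (grad eta y - grad eta w) <= M * enorm (y - w)).
Hypotheses (e1 : enorm e = 1) (du : forall y, differentiable u y)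
  (cv : continuous ('D_e u)) (uN : forall y, `|u y| <= N).

Let v := 'D_e u.
Let E0 := eta x.
Let V0 := v x.
Let g0 := grad eta x.
Let W z := u (x - z) - u x.
Let V z := v (x - z).
Let E z := eta (x - z).
Let Q z := - (E0 ^+ 2 * V0 ^+ 2) - E z ^+ 2 * V z ^+ 2 + 2 * E0 ^+ 2 * V0 * V z.
Let G z := (Q z - sigma * W z ^+ 2) * k z.
Let F y := eta y ^+ 2 * v y ^+ 2 + sigma * u y ^+ 2.

Let cu : continuous u.
Proof. by move=> z; exact: differentiable_continuous (du z). Qed.

Let ceta : continuous eta.
Proof. by move=> z; exact: differentiable_continuous (deta z). Qed.

Let csqr (f : Rn -> R) : continuous f -> continuous (fun z => f z ^+ 2).
Proof. by move=> cf z; apply: (@cvgM R Rn (nbhs z)); exact: cf. Qed.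

Let ccst (c : R) : continuous (fun _ : Rn => c).
Proof. exact: cst_continuous. Qed.

Let cM (f g : Rn -> R) : continuous f -> continuous g -> continuous (fun z => f z * g z).
Proof. by move=> cf cg z; apply: (@cvgM R Rn (nbhs z)); [exact: cf|exact: cg]. Qed.

Let cD (f g : Rn -> R) : continuous f -> continuous g -> continuous (fun z => f z + g z).
Proof. by move=> cf cg z; apply: (@cvgD R R Rn (nbhs z)); [exact: cf|exact: cg]. Qed.

Let cB (f g : Rn -> R) : continuous f -> continuous g -> continuous (fun z => f z - g z).
Proof. by move=> cf cg z; apply: (@cvgB R R Rn (nbhs z)); [exact: cf|exact: cg]. Qed.

Let ckM (f : Rn -> R) : continuous f ->
  {in [set z : Rn | z != 0], continuous (fun z => f z * k z)}.
Proof.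
move=> cf z z0; apply: (@cvgM R Rn (nbhs z)); first exact: cf.
exact: rkernel_continuous hK _ z0.
Qed.

Let cF : continuous F.
Proof. by apply: cD; apply: cM => //; apply: csqr. Qed.

Let cE : continuous E. Proof. exact: (@continuous_reflect R n eta x ceta). Qed.
Let cV : continuous V. Proof. exact: (@continuous_reflect R n v x cv). Qed.
Let cW : continuous W.
Proof. by apply: cB => //; exact: (@continuous_reflect R n u x cu). Qed.

Let cdot : continuous (fun z => dot g0 z).
Proof.
rewrite (_ : (fun z => _) = fun z => 4^-1 *
    (enorm (g0 + z) ^+ 2 - enorm (z - g0) ^+ 2)); last first.
  apply/funext => z; rewrite !sqr_enorm !dotDl !dotDr !dotNl !dotNr (dotC z g0).
  by field.
apply: cM => //; apply: cB; apply: csqr.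
  move=> z; apply: (@continuous_comp _ _ _ (fun z => g0 + z) (@enorm R n)).
    by apply: (@cvgD R Rn Rn (nbhs z)); [exact: cvg_cst|exact: cvg_id].
  exact: enorm_continuous.
move=> z; apply: (@continuous_comp _ _ _ (fun z => z - g0) (@enorm R n)).
  by apply: (@cvgB R Rn Rn (nbhs z)); [exact: cvg_id|exact: cvg_cst].
exact: enorm_continuous.
Qed.

Let cG : {in [set z : Rn | z != 0], continuous G}.
Proof.
apply: ckM; apply: cB; last by apply: cM => //; exact: csqr.
apply: cD; last exact: cM.
apply: cB => //; apply: cM; exact: csqr.
Qed.

Let decomposition z : z != 0 ->
  (F x - F (x - z)) * k z =
  2 * E0 ^+ 2 * V0 * ((v x - v (x - z)) * k z) +
  2 * sigma * u x * ((u x - u (x - z)) * k z) + G z.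
Proof. by move=> _; rewrite /G /Q /F /W /V /E /E0 /V0; ring. Qed.

Hypothesis sigma0 : 0 <= sigma.

Let F0 y : 0 <= F y.
Proof. by apply: addr_ge0; apply: mulr_ge0 => //; exact: sqr_ge0. Qed.

Variables (Ju Jv : R -> R) (lu lv : R).
Hypotheses (Lu : pv_limit K u x Ju lu) (Lv : pv_limit K v x Jv lv).

(** With [E0 = 0] only the negative squares remain in [G], so [P = 0] and [C = 0] serve in
    [pv_op_le], with an arbitrary radius. *)
Lemma bernstein_degenerate : E0 = 0 ->
  (pv_op K F x <= (2 * E0 ^+ 2 * V0 * lv + 2 * sigma * u x * lu)%:E)%E.
Proof.
move=> E00.
have GP z : G z <= 0.
  have -> : G z = - ((E z ^+ 2 * V z ^+ 2 + sigma * W z ^+ 2) * k z).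
    by rewrite /G /Q E00; ring.
  rewrite oppr_le0 mulr_ge0 ?(rkernel_ge0 hK)//.
  by apply: addr_ge0; apply: mulr_ge0 => //; exact: sqr_ge0.
apply: (@pv_op_le R n s lam Lam K s0 lam0 lamLam hK F u v G (fun=> 0) x
  (2 * E0 ^+ 2 * V0) (2 * sigma * u x) lu lv (1 / 2) 0 1 Ju Jv) => //; try lra.
- rewrite (_ : (fun r : R => _) = fun=> 0); first exact: is_cvg_cst.
  by apply/funext => r; rewrite /Ish Rintegral_cst ?mul0r//; exact: measurable_shell.
- move=> r rho r0 rd rho1; rewrite mul0r -oppr_ge0.
  have iG : ishell `]r, rho[ G.
    apply: (ishell_punctured (b := rho) r0 _ cG) => y.
    by rewrite !in_itv/= => /andP[/ltW -> /ltW ->].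
  rewrite -mulN1r -IshZ//; apply: Ish_ge0 => z _.
  by rewrite mulN1r oppr_ge0.
Qed.

(** [c1M] makes the Taylor remainder at most [E0 / 64] within the gluing radius [d] and, with [EM],
    gives [d <= 1 / 8]. [c1C] lets the far negative term dominate the near one. [c1s] lets [sigma]
    pay for Young's inequality. *)
Hypotheses (E0_gt0 : 0 < E0) (c10 : 0 < c1) (c1M : 64 * M * c1 <= 1)
  (c1C : 184 * M * Lam * dyadic_const n (2 - 2 * s) * c1 <= lam * far_const)
  (EM : E0 <= M) (c1s : 8 * (11 + Lam) ^+ 2 * E0 <= c1 * sigma).

Let d := Num.sqrt (c1 * E0).

Let d0 : 0 < d. Proof. by rewrite sqrtr_gt0 mulr_gt0. Qed.

Let dd : d ^+ 2 = c1 * E0.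
Proof. by rewrite sqr_sqrtr// ltW// mulr_gt0. Qed.

Let d8 : d <= 1 / 8.
Proof.
rewrite -(@ler_pXn2r _ 2%N) ?nnegrE ?(ltW d0) ?divr_ge0//.
rewrite dd; have : c1 * E0 <= c1 * M by rewrite ler_wpM2l// ltW.
have -> : (1 / 8 : R) ^+ 2 = 1 / 64 by field.
by move: c1M; lra.
Qed.

(** [quad_near] with [h ^+ 2 <= 9 * M * E0 * y]: the Taylor remainder in its linear term costs
    [2 * M * E0 * y] and its quadratic term 10 times the bound on [h ^+ 2], in total 92. *)
Let near_Q z : enorm z <= d ->
  Q z <= V0 ^+ 2 * (2 * E0 * dot g0 z + 92 * M * E0 * enorm z ^+ 2).
Proof.
move=> zd; pose h := E z - E0; set y := enorm z ^+ 2.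
have y0 : 0 <= y by exact: sqr_ge0.
have yd : y <= c1 * E0 by rewrite -dd lerXn2r ?nnegrE ?enorm_ge0// ltW.
have ht : `|h + dot g0 z| <= M * y.
  have := @C11_taylor R n eta M x (- z) deta etaL (ltW M0).
  by rewrite dotNr opprK enormN.
have gg : dot g0 z ^+ 2 <= 4 * M * E0 * y.
  have := C11_nonneg_grad x deta etaL M0 eta0; rewrite -/g0 -/E0 => hg.
  have := cauchy_schwarz g0 z => cs.
  apply: (@le_trans _ _ ((enorm g0 * enorm z) ^+ 2)).
    rewrite -real_normK ?num_real// lerXn2r ?nnegrE ?mulr_ge0 ?enorm_ge0//.
  by rewrite exprMn ler_wpM2r// sqr_ge0.
have My : M * y <= E0 / 64.
  have h1 : M * y <= M * (c1 * E0) by rewrite ler_wpM2l// ltW.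
  have h2 : (64 * M * c1) * E0 <= 1 * E0 by rewrite ler_wpM2r// ltW.
  lra.
have My2 : (M * y) ^+ 2 <= M * y * (E0 / 64).
  by rewrite expr2 ler_wpM2l// mulr_ge0// ltW.
have hh : h ^+ 2 <= 9 * M * E0 * y.
  have : (h + dot g0 z) ^+ 2 <= (M * y) ^+ 2.
    by rewrite -real_normK ?num_real// lerXn2r ?nnegrE// mulr_ge0// ltW.
  (* Equivalent to [h ^+ 2 <= 2 * (h + dot g0 z) ^+ 2 + 2 * dot g0 z ^+ 2]; the right-hand side is
     at most [(2 / 64 + 8) * M * E0 * y]. *)
  have : 0 <= (h + 2 * dot g0 z) ^+ 2 by exact: sqr_ge0.
  have : 0 <= M * y * E0 by rewrite mulr_ge0 ?(ltW E0_gt0)// mulr_ge0// ltW.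
  rewrite !sqrrD; lra.
have hE : h ^+ 2 <= (E0 / 2) ^+ 2.
  have : M * y * E0 <= E0 / 64 * E0 by rewrite ler_wpM2r// ltW.
  have : 0 <= E0 * E0 by rewrite mulr_ge0 ?(ltW E0_gt0).
  rewrite (expr2 (E0 / 2)); lra.
have hlo : E0 / 2 <= E z.
  have : `|h| <= E0 / 2.
    by rewrite -(@ler_pXn2r _ 2%N) ?nnegrE ?divr_ge0 ?(ltW E0_gt0)// real_normK ?num_real.
  by rewrite ler_norml /h => /andP[? _]; lra.
rewrite (le_trans (quad_near V0 (V z) E0_gt0 hlo))// -/h.
rewrite ler_wpM2l ?sqr_ge0//.
have : - (dot g0 z) - M * y <= h by move: ht; rewrite ler_norml => /andP[? _]; lra.
move=> /(ler_wpM2l (ltW E0_gt0)); lra.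
Qed.

Let P z := V0 ^+ 2 * (2 * E0 * dot g0 z + 92 * M * E0 * enorm z ^+ 2) * k z.

Let cP : {in [set z : Rn | z != 0], continuous P}.
Proof.
apply: ckM; apply: cM => //; apply: cD; apply: cM => //.
by apply: csqr; exact: enorm_continuous.
Qed.

(** Below this radius the cutoff vanishes, so for an inner radius [r < d1] integrals of [kappa] over
    an annulus and over the full ball agree. *)
Let d1 := d / 2.

Let d10 : 0 < d1. Proof. by rewrite divr_gt0. Qed.

Let d1d : d1 < d. Proof. by rewrite /d1; have := d0; lra. Qed.

Let ioo (f : Rn -> R) (r rho : R) : 0 < r ->
  {in [set z : Rn | z != 0], continuous f} -> ishell `]r, rho[ f.
Proof.
move=> r0 cf; apply: (ishell_punctured (b := rho) r0 _ cf) => y.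
by rewrite !in_itv/= => /andP[/ltW -> /ltW ->].
Qed.

Let ioc (f : Rn -> R) (r rho : R) : 0 < r ->
  {in [set z : Rn | z != 0], continuous f} -> ishell `]r, rho] f.
Proof.
move=> r0 cf; apply: (ishell_punctured (b := rho) r0 _ cf) => y.
by rewrite !in_itv/= => /andP[/ltW -> ->].
Qed.

Let coef := V0 ^+ 2 * (92 * M * E0).

Let coef0 : 0 <= coef.
Proof. by rewrite mulr_ge0 ?sqr_ge0// mulr_ge0 ?(ltW E0_gt0)// mulr_ge0// ltW. Qed.

(** The gradient term is odd and cancels on every shell, although it need not be absolutely
    integrable near 0; the second moment of the kernel is what remains. *)
Let Ish_P (r rho : R) : 0 < r -> Ish `]r, rho] P = coef * Ish `]r, rho] sq.
Proof.
move=> r0; pose o z := V0 ^+ 2 * (2 * E0 * dot g0 z) * k z.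
have co : {in [set z : Rn | z != 0], continuous o}.
  by apply: ckM; apply: cM => //; exact: cM.
rewrite (@eq_Ish _ _ _ _ (fun z => o z + coef * sq z)); last first.
  by move=> z _; rewrite /P /o /coef /sq; ring.
rewrite IshD; [|exact: ioc|by apply: ishellZ; exact: ioc].
rewrite IshZ; last exact: ioc.
rewrite Ish_odd ?add0r//; first exact: ioc.
by move=> z; rewrite /o dotNr (rkernelN hK); ring.
Qed.

Let P_cvg : cvg (Ish `]r, d1] P @[r --> 0^'+]).
Proof.
apply: cvg_at_right_cauchy => eps eps0.
have [r0 r00 H] := powR_small (coef * (Lam * dyadic_const n (2 - 2 * s))) q2 eps0.
pose r := Num.min r0 d1; have r_gt0 : 0 < r by rewrite lt_min r00 d10.
have rr0 : r <= r0 by rewrite ge_min lexx.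
have rd1 : r <= d1 by rewrite ge_min lexx orbT.
exists r => // r' r'0 r'r.
rewrite [X in _ - X](@Ish_split _ _ _ `]r', r] `]r, d1]).
- rewrite opprD addrCA subrr addr0 normrN Ish_P// ger0_norm; last first.
    rewrite mulr_ge0//; apply: Ish_ge0 => z _.
    by rewrite mulr_ge0 ?sqr_ge0// (rkernel_ge0 hK).
  apply: le_lt_trans (H r r_gt0 rr0); rewrite -[leRHS]mulrA ler_wpM2l//.
  by rewrite -[leRHS]mulrA; exact: sq_kernel_near_bound.
- by move=> t; rewrite !in_itv/= => /andP[-> t1]/=; lra.
- by move=> t; rewrite !in_itv/= => /andP[t1 ->]; rewrite andbT; lra.
- by move=> t; rewrite !in_itv/= => /andP[-> ->]; rewrite andbT/=; have [] := leP t r.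
- by move=> t; rewrite !in_itv/= => /andP[_ t1] /andP[t2 _]; lra.
- exact: ioc.
Qed.

Let GP z : 0 < enorm z <= d1 -> G z <= P z.
Proof.
move=> /andP[_ zd]; rewrite /G /P ler_wpM2r ?(rkernel_ge0 hK)//.
have := near_Q (le_trans zd (ltW d1d)).
have : 0 <= sigma * W z ^+ 2 by rewrite mulr_ge0 ?sqr_ge0.
lra.
Qed.

Local Notation kappa := (cutoff_kernel K d).

Let ckappa : continuous kappa.
Proof. exact: (cutoff_kernel_continuous hK d0). Qed.

Let DW z := 'D_e kappa z * W z.
Let O z := (1 - cutoff d z) * (V0 ^+ 2 * (2 * E0 * dot g0 z)) * k z.
Let SQ z := (1 - cutoff d z) * enorm z ^+ 2 * k z.
(** Once integrated: [O] is odd and gives 0; [SQ] is a second moment inside radius [d]; the third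
    term is the half of the far negative term that Young's inequality leaves; the last is minus a
    total derivative, hence a boundary term. *)
Let Y z := O z + coef * SQ z - 2^-1 * E0 ^+ 2 * V0 ^+ 2 * kappa z +
  2 * E0 ^+ 2 * V0 * (kappa z * V z - DW z).

Let far_Q z : Q z <= - (E0 ^+ 2 * V0 ^+ 2) + 2 * E0 ^+ 2 * V0 * V z.
Proof.
have : 0 <= E z ^+ 2 * V z ^+ 2 by rewrite mulr_ge0 ?sqr_ge0.
by rewrite /Q; lra.
Qed.

Let G_le_Y z : z != 0 -> G z <= Y z.
Proof.
move=> z0; have k0 := rkernel_ge0 hK z.
have zp : 0 < enorm z by rewrite enorm_gt0.
set w := cutoff_root d z; have w0 : 0 <= w by exact: cutoff_root_ge0.
have chi0 := cutoff_ge0 d z; have chi1 := cutoff_le1 d z.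
(* A convex combination of the near and the far bound; beyond [d], where only the far one is
   available, its weight is 1. *)
have Qle : Q z <= (1 - cutoff d z) *
    (V0 ^+ 2 * (2 * E0 * dot g0 z + 92 * M * E0 * enorm z ^+ 2)) +
    cutoff d z * (- (E0 ^+ 2 * V0 ^+ 2) + 2 * E0 ^+ 2 * V0 * V z).
  have fQ := far_Q z; have [zd|zd] := leP (enorm z) d; last first.
    by rewrite (cutoff1 d0 (ltW zd)) subrr mul0r add0r mul1r.
  have nQ := near_Q zd; have chi10 : 0 <= 1 - cutoff d z by rewrite subr_ge0.
  have h1 := ler_wpM2l chi10 nQ; have h2 := ler_wpM2l chi0 fQ.
  move: h1 h2; set A1 := _ * (_ * _ + _); set A2 := (_ + 2 * E0 ^+ 2 * V0 * V z).
  move: (cutoff d z) (Q z) A1 A2 => X1 X2 X3 X4; lra.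
(* The derivative lives where [enorm z > d / 2], so [1 / enorm z] costs at most [2 / d]. *)
have DB : `|'D_e kappa z| <= w * ((11 + Lam) * 2 / d) * k z.
  have [zd|zd] := leP (enorm z) (d / 2).
    rewrite (cutoff_kernel_derive0 lam0 lamLam hK d0 e1 zd) normr0.
    rewrite mulr_ge0// mulr_ge0// divr_ge0 ?(ltW d0)// mulr_ge0// addr_ge0//.
    exact: ltW.
  have h1 := cutoff_kernel_derive_le lam0 lamLam hK d0 e1 z0.
  have h2 := le_trans (ler_wpM2l (normr_ge0 ('D_e kappa z)) (ltW zd)) h1.
  rewrite -ler_pdivlMr in h2; last by rewrite divr_gt0.
  apply: (le_trans h2); rewrite le_eqVlt; apply/orP; left; apply/eqP.
  by rewrite /w; field; rewrite gt_eqF.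
(* With [d ^+ 2 = c1 * E0] one factor [E0] cancels and this becomes exactly [c1s]. *)
have Bs : 2 * E0 ^+ 2 * ((11 + Lam) * 2 / d) ^+ 2 <= sigma.
  have -> : 2 * E0 ^+ 2 * ((11 + Lam) * 2 / d) ^+ 2 = 8 * (11 + Lam) ^+ 2 * E0 / c1.
    have -> : ((11 + Lam) * 2 / d) ^+ 2 = 4 * (11 + Lam) ^+ 2 / d ^+ 2.
      by field; rewrite gt_eqF.
    by rewrite dd; field; rewrite !gt_eqF.
  by rewrite ler_pdivrMr// [leRHS]mulrC.
(* [DW] is subtracted in [Y]; adding it back is what Young's inequality and the term in [sigma] pay
   for. *)
have yg := young_weighted V0 (W z) k0 w0 DB Bs.
have := ler_wpM2r k0 Qle.
rewrite /G /Y /O /SQ /DW /coef /cutoff_kernel.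
rewrite -/(cutoff_kernel K d).
move: yg; rewrite -[w ^+ 2]/(cutoff d z).
lra.
Qed.

Let vanish_ball (f : Rn -> R) (r rho : R) : r < rho -> ishell `]-oo, rho[ f ->
  (forall z, enorm z <= r -> f z = 0) -> Ish `]-oo, rho[ f = Ish `]r, rho[ f.
Proof.
move=> rr fi f0; rewrite (@Ish_split _ _ _ `]-oo, r] `]r, rho[ f) //.
- rewrite (@eq_Ish _ _ _ f (fun=> 0)); last by move=> z; rewrite in_itv/= => /f0.
  by rewrite {1}/Ish Rintegral_cst ?mul0r ?add0r//; exact: measurable_shell.
- by move=> t; rewrite !in_itv/=; lra.
- by move=> t; rewrite !in_itv/= => /andP[].
- by move=> t; rewrite !in_itv/= => ->; rewrite andbT; have [] := leP t r.
- by move=> t; rewrite !in_itv/= => t1 /andP[t2 _]; lra.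
Qed.

Let SQ_bound (r rho : R) : 0 < r -> r < d -> d < rho ->
  Ish `]r, rho[ SQ <= Lam * (dyadic_const n (2 - 2 * s) * d `^ (2 - 2 * s)).
Proof.
move=> r0 rd drho.
have c1chi : continuous (fun z => 1 - cutoff d z).
  by apply: cB => //; exact: cutoff_continuous.
have cSQ : {in [set z : Rn | z != 0], continuous SQ}.
  by apply: ckM; apply: cM => //; apply: csqr; exact: enorm_continuous.
rewrite (@Ish_split_near _ _ _ cSQ d r rho)//; last exact: ltW.
rewrite [X in _ + X](_ : _ = 0) ?addr0; last first.
  rewrite (@eq_Ish _ _ _ _ (fun=> 0)); last first.
    move=> z; rewrite in_itv/= => /andP[dz _].
    by rewrite /SQ (cutoff1 d0 (ltW dz)) subrr !mul0r.
  by rewrite /Ish Rintegral_cst ?mul0r//; exact: measurable_shell.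
rewrite (le_trans _ (sq_kernel_near_bound r0 (ltW rd)))//.
apply: le_Ish; [exact: ioc|exact: ioc|] => z _.
rewrite /SQ /sq ler_wpM2r ?(rkernel_ge0 hK)// ler_piMl ?sqr_ge0//.
by rewrite gerBl cutoff_ge0.
Qed.

Let kappa_bound (r rho : R) : 0 < r -> r < d -> (3 / 2) * d <= rho ->
  lam * (far_const * d `^ (- (2 * s))) <= Ish `]r, rho[ kappa.
Proof.
move=> r0 rd drho; have drho' : d <= rho by have := d0; lra.
have ckap : {in [set z : Rn | z != 0], continuous kappa}.
  by move=> z _; exact: ckappa.
rewrite (@Ish_split_far _ _ _ ckap r d rho)//.
have i1 : ishell `[d, rho[ kappa.
  by apply: ishell_co.
have := @Ish_lower R n kappa (- (n%:R + 2 * s)) lam d rho n0 d0 drho _ (ltW lam0) i1.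
have p0 : - (n%:R + 2 * s) <= 0 by rewrite oppr_le0 addr_ge0// mulr_ge0// ltW.
move=> /(_ p0) h.
have : lam * ((3 / 2 * d) `^ (- (n%:R + 2 * s)) * (d ^+ n * ((3 / 2) ^+ n - 1) * vol))
   <= Ish `[d, rho[ kappa.
  apply: h => z /andP[dz _]; first exact: cutoff_kernel_ge0 hK d z.
  have z0 : z != 0 by rewrite -enorm_gt0 (lt_le_trans d0).
  by rewrite cutoff_kernel1// (rkernel_lo hK).
have -> : (3 / 2 * d) `^ (- (n%:R + 2 * s)) * (d ^+ n * ((3 / 2) ^+ n - 1) * vol) =
   far_const * d `^ (- (2 * s)).
  rewrite powRM ?(ltW d0)// /far_const.
  have -> : d `^ (- (n%:R + 2 * s)) = d `^ (- (2 * s)) / d ^+ n.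
    rewrite -powR_mulrn ?(ltW d0)// -powRN -powRD; last by rewrite (gt_eqF d0) implybT.
    by congr (_ `^ _); ring.
  move: ((3 / 2) `^ _) ((3 / 2) ^+ n) (d `^ _) => X1 X2 X3.
  by field; rewrite expf_neq0// gt_eqF.
move=> hh; rewrite (le_trans hh)// lerDr; apply: Ish_ge0 => z _.
exact: cutoff_kernel_ge0 hK d z.
Qed.

Let constants_balance :
  coef * (Lam * (dyadic_const n (2 - 2 * s) * d `^ (2 - 2 * s))) <=
  2^-1 * E0 ^+ 2 * V0 ^+ 2 * (lam * (far_const * d `^ (- (2 * s)))).
Proof.
have -> : d `^ (2 - 2 * s) = d ^+ 2 * d `^ (- (2 * s)).
  rewrite -powR_mulrn ?(ltW d0)// -powRD//.
  by rewrite (gt_eqF d0) implybT.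
rewrite dd /coef; set X := d `^ _; have X0 : 0 <= X by exact: powR_ge0.
have h : 0 <= 2^-1 * E0 ^+ 2 * V0 ^+ 2 * X.
  by rewrite mulr_ge0// mulr_ge0 ?sqr_ge0// mulr_ge0 ?sqr_ge0// invr_ge0.
have := ler_wpM2l h c1C.
move: (dyadic_const _ _) far_const => D X1; lra.
Qed.

(** After integrating [Y], the second moment is absorbed by the negative term through
    [constants_balance], and only the boundary term at [rho] survives. Its constant may depend on
    [u] and [x], as it disappears in the limit. *)
Let G_bound : exists C : R, forall r rho, 0 < r -> r < d1 -> 1 < rho ->
  Ish `]r, rho[ G <= C * rho `^ (- (1 + 2 * s)).
Proof.
have [CT CT0 HT] := @Ish_parts_boundary R n s lam Lam K n0 s0 lam0 lamLam hK d e d0 e1 u x N du cv uN.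
exists (2 * E0 ^+ 2 * `|V0| * CT) => r rho r0 rd rho1.
have rdd : r < d by exact: lt_trans d1d.
have drho : (3 / 2) * d <= rho by have := d8; lra.
have drho' : d < rho by have := d8; lra.
have rrho : r < rho by exact: lt_trans drho'.
have c1chi : continuous (fun z => 1 - cutoff d z).
  by apply: cB => //; exact: cutoff_continuous.
have iO : ishell `]r, rho[ O.
  by apply: ioo => //; apply: ckM; apply: cM => //; apply: cM => //; exact: cM.
have iSQ : ishell `]r, rho[ SQ.
  apply: ioo => //; apply: ckM; apply: cM => //; apply: csqr.
  exact: enorm_continuous.
have sub : {subset `]r, rho[ <= `]-oo, rho[}.
  by move=> y; rewrite !in_itv/= => /andP[].
have bkV := @ishell_kappaV R n s lam Lam K hK d e d0 u x cv rho.
have bDW := @ishell_DkappaW R n s lam Lam K s0 lam0 lamLam hK d e d0 e1 u x N du uN rho.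
have ik : ishell `]r, rho[ kappa by apply: ioo => // z _; exact: ckappa.
have ikV : ishell `]r, rho[ (fun z => kappa z * V z) by exact: ishellS sub bkV.
have iDW : ishell `]r, rho[ DW by exact: ishellS sub bDW.
have iG : ishell `]r, rho[ G by exact: ioo.
have i1 : ishell `]r, rho[ (fun z => O z + coef * SQ z).
  by apply: ishellD => //; exact: ishellZ.
have i2 : ishell `]r, rho[ (fun z => 2^-1 * E0 ^+ 2 * V0 ^+ 2 * kappa z) by exact: ishellZ.
have i3 : ishell `]r, rho[ (fun z => O z + coef * SQ z - 2^-1 * E0 ^+ 2 * V0 ^+ 2 * kappa z).
  exact: ishellB.
have i4 : ishell `]r, rho[ (fun z => kappa z * V z - DW z) by exact: ishellB.
have i5 : ishell `]r, rho[ (fun z => 2 * E0 ^+ 2 * V0 * (kappa z * V z - DW z)).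
  exact: ishellZ.
have iY : ishell `]r, rho[ Y by exact: ishellD.
apply: (@le_trans _ _ (Ish `]r, rho[ Y)).
  apply: le_Ish => // z; rewrite in_itv/= => /andP[rz _]; apply: G_le_Y.
  exact: enorm_neq0 (ltW r0) rz.
rewrite /Y IshD// IshB// IshD//; last exact: ishellZ.
rewrite !IshZ// IshB//.
rewrite (Ish_odd iO) ?add0r; last first.
  by move=> z; rewrite /O cutoffN dotNr (rkernelN hK); ring.
have zero z : enorm z <= r -> kappa z = 0.
  by move=> zr; apply: (cutoff_kernel0 _ d0); rewrite (le_trans zr)// ltW.
have parts := @Ish_parts R n s lam Lam K s0 lam0 lamLam hK d e d0 e1 u x N du cv uN rho.
rewrite (vanish_ball rrho bkV) in parts; last by move=> z zr; rewrite zero// mul0r.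
rewrite (vanish_ball rrho bDW) in parts; last first.
  move=> z zr; rewrite (cutoff_kernel_derive0 lam0 lamLam hK d0 e1) ?mul0r//.
  by rewrite (le_trans zr)// ltW.
have -> : Ish `]r, rho[ (fun z => kappa z * V z) - Ish `]r, rho[ DW =
    - Ish `]-oo, rho[ (fun z => 'D_e (fun z => kappa z * (u (x - z) - u x)) z).
  by move: parts; rewrite /DW /V /W /v => ->; ring.
have hT := HT rho (lt_trans ltr01 rho1).
set T := Ish `]-oo, rho[ _ in hT *.
have hSQ := SQ_bound r0 rdd drho'.
have hk := kappa_bound r0 rdd drho.
have k1 : 0 <= 2^-1 * E0 ^+ 2 * V0 ^+ 2.
  by rewrite mulr_ge0 ?sqr_ge0// mulr_ge0 ?sqr_ge0// invr_ge0.
have h1 := ler_wpM2l coef0 hSQ; have h2 := ler_wpM2l k1 hk.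
have h3 := constants_balance.
have h4 : 2 * E0 ^+ 2 * V0 * - T <= 2 * E0 ^+ 2 * `|V0| * (CT * rho `^ (- (1 + 2 * s))).
  have E20 : 0 <= 2 * E0 ^+ 2 by rewrite mulr_ge0 ?sqr_ge0.
  rewrite (le_trans (ler_norm _))// (normrM (2 * E0 ^+ 2 * V0)) (normrM (2 * E0 ^+ 2)).
  by rewrite normrN (ger0_norm E20) ler_wpM2l// mulr_ge0.
rewrite -[X in _ <= X]mulrA; lra.
Qed.

Lemma bernstein_nondegenerate :
  (pv_op K F x <= (2 * E0 ^+ 2 * V0 * lv + 2 * sigma * u x * lu)%:E)%E.
Proof.
have [C HC] := G_bound.
have q0 : 0 < 1 + 2 * s by rewrite addr_gt0// mulr_gt0.
have d11 : d1 < 1 by have := d8; rewrite /d1; have := d0; lra.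
exact: (@pv_op_le R n s lam Lam K s0 lam0 lamLam hK F u v G P x
  (2 * E0 ^+ 2 * V0) (2 * sigma * u x) lu lv d1 C (1 + 2 * s) Ju Jv cF F0 cu cv
  cG cP decomposition d10 d11 GP P_cvg q0 HC Lu Lv).
Qed.

End bernstein.

Lemma Linfty_bounded (R : realType) n (f : 'rV[R]_n -> R) :
  continuous f -> Linfty f -> exists N, forall z, `|f z| <= N.
Proof.
move=> cf; rewrite /Linfty unlock.
(* The norm with exponent [+oo] is an essential supremum only when the whole space has positive
   measure. *)
have -> : (0 < leb R n [set: n.-tuple (measurableTypeR R)])%E.
  apply: (@lt_le_trans _ _ (leb R n (@shell R n `[0, 1[))).
    by rewrite leb_unit_ball lte_fin unit_ball_vol_gt0.
  by apply: le_measure; rewrite ?inE//; exact: measurable_shell.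
set g := _ \o _ => gy.
have [N HN] : exists N : R, (ess_sup (leb R n) g <= N%:E)%E.
  case: (ess_sup _ _) gy => [r _||_]; [by exists r; rewrite lexx|by rewrite ltxx|].
  by exists 0; rewrite leNye.
exists N; apply: leb_essential_bound.
  by move=> z; apply: (@continuous_comp _ _ _ f Num.norm); [exact: cf|exact: norm_continuous].
move/ess_supP : HN => [A [mA A0 sA]].
exists A; split => // t /= fN; apply: sA => /=.
Qed.

(** * The gluing constant and the threshold for [sigma] *)

Section threshold.
Variable R : realType.
Implicit Types (n : nat) (s cc M : R).

(* The gluing radius is sqrt (radius_const * eta x). *)
Definition radius_const n s cc M : R :=
  Num.min (64 * (M + 1))^-1
    (far_const n s / (184 * (M + 1) * cc * dyadic_const n (2 - 2 * s))).

(** The [sigma] for which [c1s] is an equality after [eta x] and [Lam] are replaced by their bounds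
    [M + 1] and [cc]. With [M + 1] in place of [M] it stays positive for [eta = 0]. *)
Definition bernstein_const n s cc M : R :=
  8 * (11 + cc) ^+ 2 * (M + 1) / radius_const n s cc M.

Lemma radius_const_den_gt0 n s cc M : s < 1 -> 0 < cc -> 0 <= M ->
  0 < 184 * (M + 1) * cc * dyadic_const n (2 - 2 * s).
Proof.
move=> s1 cc0 M0; have c184 : (0 : R) < 184 by rewrite ltr0n.
have M1 : 0 < M + 1 by rewrite ltr_wpDl.
have q2 : 0 < 2 - 2 * s by lra.
exact: (mulr_gt0 (mulr_gt0 (mulr_gt0 c184 M1) cc0) (dyadic_const_gt0 n q2)).
Qed.

Lemma radius_const_gt0 n s cc M : (0 < n)%N -> s < 1 -> 0 < cc -> 0 <= M ->
  0 < radius_const n s cc M.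
Proof.
move=> n0 s1 cc0 M0; have M1 : 0 < M + 1 by rewrite ltr_wpDl.
have c64 : (0 : R) < 64 by rewrite ltr0n.
rewrite lt_min invr_gt0 (mulr_gt0 c64 M1) /=.
exact: (divr_gt0 (far_const_gt0 s n0) (radius_const_den_gt0 n s1 cc0 M0)).
Qed.

Lemma bernstein_const_gt0 n s cc M : (0 < n)%N -> s < 1 -> 0 < cc -> 0 <= M ->
  0 < bernstein_const n s cc M.
Proof.
move=> n0 s1 cc0 M0; have M1 : 0 < M + 1 by rewrite ltr_wpDl.
rewrite divr_gt0 ?radius_const_gt0// mulr_gt0// mulr_gt0// exprn_gt0//.
by rewrite addr_gt0.
Qed.

End threshold.

Theorem theorem1p6 (R : realType) :
  exists sigma0 : nat -> R -> R -> R -> R,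
  forall (n : nat) (s0 s lam Lam : R) (K : 'rV[R]_n -> \bar R)
         (eta : 'rV[R]_n -> R),
    (0 < n)%N ->
    0 < s0 -> s0 < s -> s < 1 ->
    0 < lam -> lam <= Lam ->
    kernel_class s lam Lam K ->
    C11 eta -> (forall x, 0 <= eta x) ->
    let sg0 := sigma0 n s (class_constant lam Lam) (fine (C11_norm eta)) in
    0 < sg0 /\
    forall (sigma eps : R) (e : 'rV[R]_n) (u : 'rV[R]_n -> R),
      sg0 <= sigma -> 0 < eps -> enorm e = 1 ->
      C_loc (1 + 2 * s + eps) u -> Linfty u ->
      forall x : 'rV[R]_n,
        (pv_op K (fun y => eta y ^+ 2 * ('D_e u y) ^+ 2 + sigma * u y ^+ 2)%R x
         <= (2 * eta x ^+ 2)%:E * pv_op K ('D_e u) x * ('D_e u x)%:E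
            + (2 * sigma)%:E * pv_op K u x * (u x)%:E)%E.
Proof.
exists (@bernstein_const R) => n s0' s lam Lam K eta n0 s0'0 s0's s1 lam0 lamLam hK ceta eta0.
have s0 : 0 < s by exact: lt_trans s0's.
have Lam0 : 0 < Lam by exact: lt_le_trans lamLam.
have [deta M0 etaM etaL] := C11_bounds n0 ceta.
set M := fine (C11_norm eta) in M0 etaM etaL *.
set cc := class_constant lam Lam => sg0.
have ccLam : Lam <= cc by rewrite /cc /class_constant le_max lexx orbT.
have ccratio : Lam <= lam * cc.
  by rewrite mulrC -ler_pdivrMr// /cc /class_constant le_max lexx.
have cc0 : 0 < cc by exact: lt_le_trans ccLam.
have sg0_gt0 : 0 < sg0 by exact: bernstein_const_gt0.
split=> // sigma eps e u sgs eps0 e1 hu uL x.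
pose beta := 1 + 2 * s + eps.
have beta1 : 1 < beta by rewrite /beta; lra.
have beta0 : 0 <= beta by lra.
(* As [beta > 1], at least one derivative of [u] is available: [u] has order [j.+1 + a = beta] and
   its derivative order [j + a]. *)
have [j Ej] : exists j, Num.truncn beta = j.+1.
  exists (Num.truncn beta).-1; rewrite prednK// truncn_ge_nat//; exact: ltW.
pose a := beta - (Num.truncn beta)%:R.
have a0 : 0 <= a by rewrite subr_ge0 truncn_le.
have {}hu : Ck_holder_loc j.+1 a u by rewrite -Ej.
have aj : j.+1%:R + a = beta by rewrite /a -Ej; ring.
have du : forall z, differentiable u z by case: hu.
have hv := Ck_derive e hu.
have cv := Ck_continuous hv; have cu := Ck_continuous hu.
have [N uN] := Linfty_bounded cu uL.
have [Cu [bu [sbu Hu]]] : exists C b, 2 * s < b /\ forall z, enorm z <= 1 ->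
    `|u (x + z) + u (x - z) - 2 * u x| <= C * enorm z `^ b.
  by apply: (Ck_second_difference x a0 s1 hu); rewrite aj /beta; lra.
have [Cv [bv [sbv Hv]]] : exists C b, 2 * s < b /\ forall z, enorm z <= 1 ->
    `|'D_e u (x + z) + 'D_e u (x - z) - 2 * 'D_e u x| <= C * enorm z `^ b.
  (* The order left for the derivative is [beta - 1 = 2 * s + eps], still above [2 * s]. *)
  apply: (Ck_second_difference x a0 s1 hv).
  by move: aj; rewrite (mulrS 1 j) /beta; lra.
have [Ju [lu Lu]] := pv_limit_function s0 lam0 lamLam hK cu uN sbu Hu.
have [Jv [lv Lv]] := pv_limit_derivative n0 s0 lam0 lamLam hK e1 du cv uN sbv Hv.
rewrite (pv_limitE hK cu Lu) (pv_limitE hK cv Lv).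
have -> : ((2 * eta x ^+ 2)%:E * lv%:E * ('D_e u x)%:E + (2 * sigma)%:E * lu%:E * (u x)%:E)%E =
    (2 * eta x ^+ 2 * 'D_e u x * lv + 2 * sigma * u x * lu)%:E.
  by rewrite -!EFinM -EFinD; congr EFin; ring.
have sigma_ge0 : 0 <= sigma by rewrite (le_trans _ sgs)// ltW.
have M1 : 0 < M + 1 by rewrite ltr_wpDl.
have etaL1 y w : enorm (grad eta y - grad eta w) <= (M + 1) * enorm (y - w).
  by rewrite (le_trans (etaL y w))// ler_wpM2r ?enorm_ge0// lerDl.
have [E0|E0] := eqVneq (eta x) 0.
  exact: (bernstein_degenerate s0 lam0 lamLam hK deta du cv sigma_ge0 Lu Lv E0).
have E0_gt0 : 0 < eta x by rewrite lt_neqAle eq_sym E0 eta0.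
pose c1 := radius_const n s cc M.
have c10 : 0 < c1 by exact: radius_const_gt0.
have D0 : 0 < dyadic_const n (2 - 2 * s) by apply: dyadic_const_gt0; lra.
have EM : eta x <= M + 1.
  by rewrite (le_trans (ler_norm _))// (le_trans (etaM x))// lerDl.
have c1M : 64 * (M + 1) * c1 <= 1.
  by rewrite mulrC -ler_pdivlMr ?mulr_gt0// mul1r ge_min lexx.
(* [radius_const] only knows [cc]; multiplying its defining bound by [lam] and using
   [Lam <= lam * cc] restores the two ellipticity constants. *)
have c1C : 184 * (M + 1) * Lam * dyadic_const n (2 - 2 * s) * c1 <= lam * far_const n s.
  have h : c1 * (184 * (M + 1) * cc * dyadic_const n (2 - 2 * s)) <= far_const n s.
    rewrite -(ler_pdivlMr _ _ (radius_const_den_gt0 n s1 cc0 M0)).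
    by rewrite ge_min lexx orbT.
  have X0 : 0 <= 184 * (M + 1) * dyadic_const n (2 - 2 * s) * c1.
    have c184 : (0 : R) <= 184 by rewrite ler0n.
    exact: (mulr_ge0 (mulr_ge0 (mulr_ge0 c184 (ltW M1)) (ltW D0)) (ltW c10)).
  have h1 := ler_wpM2l X0 ccratio; have h2 := ler_wpM2l (ltW lam0) h.
  lra.
have c1s : 8 * (11 + Lam) ^+ 2 * eta x <= c1 * sigma.
  have h1 : c1 * sg0 <= c1 * sigma by rewrite ler_wpM2l// ltW.
  apply: le_trans h1.
  have -> : c1 * sg0 = 8 * (11 + cc) ^+ 2 * (M + 1).
    by rewrite /sg0 /bernstein_const -/c1 mulrCA mulfV ?mulr1// gt_eqF.
  apply: ler_pM => //; first by rewrite mulr_ge0 ?sqr_ge0.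
  apply: ler_wpM2l => //.
  by apply: lerXn2r; rewrite ?nnegrE ?lerD2l// addr_ge0// ltW.
exact: (bernstein_nondegenerate n0 s0 s1 lam0 lamLam hK deta eta0 M1 etaL1 e1 du cv uN
  sigma_ge0 Lu Lv E0_gt0 c10 c1M c1C EM c1s).
Qed.
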